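(* Let $X$ be a simply-laced Dynkin diagram. Then: (1) $X$ has a $\pi$-system of type $A_1^{++}$ if and only if $X$ contains a subdiagram of $\mathrm{Ext}$ type. (2) The number of $W(X)$-orbits of $\pi$-systems of type $A_1^{++}$ in $X$ is twice the number of subdiagrams of $X$ of $\mathrm{Ext}$ type (and is, in particular, finite).
   Context: A generalized Cartan matrix (GCM) is an integer square matrix $A=(a_{ij})$ with $a_{ii}=2$, $a_{ij}\le 0$ for $i\ne j$, and $a_{ij}=0$ whenever $a_{ji}=0$. $\mathfrak{g}(A)$ is the associated Kac-Moody algebra over $\mathbb C$, and $S(A)$ is the Dynkin diagram of $A$. For a symmetrizable GCM $A$ the diagram $X=S(A)$ is identified with $A$; we write $\mathfrak g(X)$, $W(X)$ (Weyl group), $\alpha_p$ ($p$ a vertex; simple roots), etc. $X$ is called simply-laced if $A$ is symmetric (entries less than $-1$ are allowed off the diagonal); then we use the bilinear form on the root lattice given by $(\alpha_i\mid\alpha_j)=a_{ij}$. A subdiagram of $X$ is a subset of the vertices together with all edges between them (i.e. a principal submatrix). A $\pi$-system in $X$ is a finite set of distinct real roots $\{\beta_1,\dots,\beta_m\}$ of $\mathfrak{g}(X)$ such that $\beta_i-\beta_j$ is not a root for all $i\neq j$. Its type is the GCM $(\langle\beta_i^\vee,\beta_j\rangle)_{i,j}$ ($\beta^\vee$ the coroot of $\beta$), taken up to simultaneous permutation of rows and columns. $W(X)$ acts on the set of $\pi$-systems of a given type. A simply-laced Dynkin diagram $Z$ is of $\mathrm{Ext}$ type (an overextension) if there is a vertex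 $p$ of $Z$ such that $Y=Z\setminus\{p\}$ is of affine type and $(\delta_Y\mid\alpha_p)=-1$, where $\delta_Y$ is the null root of $Y$ (the positive imaginary root of $Y$ of minimal height). $A_1^{++}$ denotes the GCM $\begin{pmatrix}2&-1&0\\-1&2&-2\\0&-2&2\end{pmatrix}$. *)

(* Defs.v *)
From mathcomp Require Import all_boot all_order all_algebra.
From mathcomp Require Import boolp classical_sets functions cardinality reals.
From mathcomp Require Import complex.

Set Implicit Arguments.
Unset Strict Implicit.
Unset Printing Implicit Defensive.

Import Order.TTheory GRing.Theory Num.Theory.

Local Open Scope classical_set_scope.
Local Open Scope ring_scope.

Definition gcm (n : nat) (A : 'M[int]_n) : Prop :=
  [/\ forall i, A i i = 2,
      forall i j, i != j -> A i j <= 0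
    & forall i j, A j i = 0 -> A i j = 0].

Definition simply_laced (n : nat) (A : 'M[int]_n) : Prop := A^T = A.

Definition subdiag (n : nat) (A : 'M[int]_n) (S : {set 'I_n}) : 'M[int]_#|S| :=
  mxsub enum_val enum_val A.

Section RootLattice.

(* A row vector in 'rV[int]_n stands either for an element sum_i v_i alpha_i of
   the root lattice or for an element sum_i h_i alpha_i^vee of the coroot
   lattice. *)
Variables (n : nat) (A : 'M[int]_n).

Definition alpha (i : 'I_n) : 'rV[int]_n := delta_mx 0 i.

(* <h, v> for h in the coroot lattice and v in the root lattice; if A is
   symmetric, this is also the bilinear form (h | v) on the root lattice. *)
Definition pairing (h v : 'rV[int]_n) : int := (h *m A *m v^T) 0 0.

Definition refl (i : 'I_n) (v : 'rV[int]_n) : 'rV[int]_n :=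
  v - pairing (alpha i) v *: alpha i.

Definition corefl (i : 'I_n) (h : 'rV[int]_n) : 'rV[int]_n :=
  h - pairing h (alpha i) *: alpha i.

(* An element of the Weyl group is given by a word w in the simple reflections;
   [weyl w] and [coweyl w] are its actions on the root lattice and on the coroot
   lattice. *)
Definition weyl (w : seq 'I_n) (v : 'rV[int]_n) : 'rV[int]_n := foldr refl v w.

Definition coweyl (w : seq 'I_n) (h : 'rV[int]_n) : 'rV[int]_n :=
  foldr corefl h w.

Definition real_root (b : 'rV[int]_n) : Prop :=
  exists (w : seq 'I_n) (i : 'I_n), b = weyl w (alpha i).

Definition is_coroot (b bv : 'rV[int]_n) : Prop :=
  exists (w : seq 'I_n) (i : 'I_n),
    b = weyl w (alpha i) /\ bv = coweyl w (alpha i).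

Definition height (v : 'rV[int]_n) : int := \sum_i v 0 i.

Definition positive (v : 'rV[int]_n) : Prop := v != 0 /\ forall i, 0 <= v 0 i.

End RootLattice.

Section KacMoody.

Variables (K : fieldType) (n : nat) (A : 'M[int]_n).

Let AK : 'M[K]_n := map_mx intr A.

(* A realization (h, Pi, Pi^vee) of A, with h = K^(2n - rank A): the coroots are
   the first n coordinate vectors, and the simple roots are the columns of A
   extended by corank A further rows that make them linearly independent. *)
Definition cartan_dim : nat := (n + \rank (AK^C)%MS)%N.

Definition cartan_coroot (i : 'I_n) : 'rV[K]_cartan_dim :=
  row_mx (delta_mx 0 i) 0.

Definition cartan_roots : 'M[K]_(cartan_dim, n) :=
  col_mx AK (row_base (AK^C)%MS).

Definition simple_root (i : 'I_n) (h : 'rV[K]_cartan_dim) : K :=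
  (h *m cartan_roots) 0 i.

Lemma cartan_dimE : cartan_dim = (2 * n - \rank AK)%N.
Proof.
by rewrite /cartan_dim mxrank_compl mul2n -addnn addnBA // rank_leq_row.
Qed.

Lemma simple_root_coroot (i j : 'I_n) :
  simple_root j (cartan_coroot i) = (A i j)%:~R.
Proof.
rewrite /simple_root /cartan_coroot /cartan_roots mul_row_col mul0mx addr0.
by rewrite -rowE !mxE.
Qed.

Lemma cartan_coroots_free : row_free (\matrix_i cartan_coroot i).
Proof.
have -> : \matrix_i cartan_coroot i = row_mx 1%:M 0.
  apply/row_matrixP => i; rewrite rowK row_row_mx rowE mulmx1.
  by congr row_mx; apply/rowP => j; rewrite !mxE.
by rewrite /row_free rank_row_mx0 mxrank1.
Qed.

Lemma cartan_roots_free : row_free cartan_roots^T.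
Proof.
rewrite /row_free mxrank_tr -/(row_full _) -sub1mx /cartan_roots.
rewrite -addsmxE (adds_eqmx (eqmx_refl AK) (eq_row_base (AK^C)%MS)).
by rewrite sub1mx addsmx_compl_full.
Qed.

(* Terms denote elements of the Lie algebra g~(A) generated by h and the e_i and
   f_i; [km_eq] is equality in g~(A). *)
Inductive kmterm : Type :=
| KMe of 'I_n
| KMf of 'I_n
| KMh of 'rV[K]_cartan_dim
| KM0
| KMadd of kmterm & kmterm
| KMscale of K & kmterm
| KMbr of kmterm & kmterm.

Definition KMsub (x y : kmterm) : kmterm := KMadd x (KMscale (-1) y).

Inductive km_eq : kmterm -> kmterm -> Prop :=
| km_refl x : km_eq x x
| km_sym x y : km_eq x y -> km_eq y x
| km_trans x y z : km_eq x y -> km_eq y z -> km_eq x z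
| km_add_congr x x' y y' :
    km_eq x x' -> km_eq y y' -> km_eq (KMadd x y) (KMadd x' y')
| km_scale_congr a x x' : km_eq x x' -> km_eq (KMscale a x) (KMscale a x')
| km_br_congr x x' y y' :
    km_eq x x' -> km_eq y y' -> km_eq (KMbr x y) (KMbr x' y')
| km_addA x y z : km_eq (KMadd x (KMadd y z)) (KMadd (KMadd x y) z)
| km_addC x y : km_eq (KMadd x y) (KMadd y x)
| km_add0 x : km_eq (KMadd KM0 x) x
| km_addN x : km_eq (KMsub x x) KM0
| km_scale1 x : km_eq (KMscale 1 x) x
| km_scaleA a b x : km_eq (KMscale a (KMscale b x)) (KMscale (a * b) x)
| km_scaleDr a x y :
    km_eq (KMscale a (KMadd x y)) (KMadd (KMscale a x) (KMscale a y))
| km_scaleDl a b x :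
    km_eq (KMscale (a + b) x) (KMadd (KMscale a x) (KMscale b x))
| km_brDl x y z : km_eq (KMbr (KMadd x y) z) (KMadd (KMbr x z) (KMbr y z))
| km_brDr x y z : km_eq (KMbr x (KMadd y z)) (KMadd (KMbr x y) (KMbr x z))
| km_brZl a x y : km_eq (KMbr (KMscale a x) y) (KMscale a (KMbr x y))
| km_brZr a x y : km_eq (KMbr x (KMscale a y)) (KMscale a (KMbr x y))
| km_brxx x : km_eq (KMbr x x) KM0
| km_jacobi x y z :
    km_eq (KMadd (KMbr x (KMbr y z))
             (KMadd (KMbr y (KMbr z x)) (KMbr z (KMbr x y)))) KM0
| km_h_lin a h h' :
    km_eq (KMh (a *: h + h')) (KMadd (KMscale a (KMh h)) (KMh h'))
| km_ef i : km_eq (KMbr (KMe i) (KMf i)) (KMh (cartan_coroot i))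
| km_ef0 i j : i != j -> km_eq (KMbr (KMe i) (KMf j)) KM0
| km_hh h h' : km_eq (KMbr (KMh h) (KMh h')) KM0
| km_he h i : km_eq (KMbr (KMh h) (KMe i)) (KMscale (simple_root i h) (KMe i))
| km_hf h i :
    km_eq (KMbr (KMh h) (KMf i)) (KMscale (- simple_root i h) (KMf i)).

Definition lie_ideal (I : set kmterm) : Prop :=
  [/\ forall x y, km_eq x y -> I x -> I y,
      I KM0,
      forall x y, I x -> I y -> I (KMadd x y),
      forall a x, I x -> I (KMscale a x)
    & forall x y, I y -> I (KMbr x y)].

(* The maximal ideal of g~(A) that meets h trivially. *)
Definition km_radical : set kmterm :=
  [set x | exists I : set kmterm,
     [/\ lie_ideal I, forall h, I (KMh h) -> km_eq (KMh h) KM0 & I x]].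

(* Equality in g(A) = g~(A) / km_radical. *)
Definition g_eq (x y : kmterm) : Prop := km_radical (KMsub x y).

Definition weight (v : 'rV[int]_n) (h : 'rV[K]_cartan_dim) : K :=
  \sum_i (v 0 i)%:~R * simple_root i h.

(* All roots of g(A) lie in the root lattice. *)
Definition km_root (v : 'rV[int]_n) : Prop :=
  v != 0 /\
  exists x : kmterm, ~ g_eq x KM0 /\
    forall h, g_eq (KMbr (KMh h) x) (KMscale (weight v h) x).

Definition positive_imaginary_root (v : 'rV[int]_n) : Prop :=
  [/\ km_root v, ~ real_root A v & positive v].

Definition null_root (d : 'rV[int]_n) : Prop :=
  positive_imaginary_root d /\
  forall v, positive_imaginary_root v -> height d <= height v.

Definition pi_system (S : set 'rV[int]_n) : Prop :=
  [/\ finite_set S,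
      forall b, S b -> real_root A b
    & forall b c, S b -> S c -> b <> c -> ~ km_root (b - c)].

End KacMoody.

(* The choice of the enumeration b accounts for simultaneous permutations of the
   rows and columns of M. *)
Definition has_type (n : nat) (A : 'M[int]_n) (S : set 'rV[int]_n)
    (m : nat) (M : 'M[int]_m) : Prop :=
  exists b bv : 'I_m -> 'rV[int]_n,
    [/\ injective b, S = range b,
        forall i, is_coroot A (b i) (bv i)
      & M = \matrix_(i, j) pairing A (bv i) (b j)].

Definition pi_systems (K : fieldType) (n : nat) (A : 'M[int]_n)
    (m : nat) (M : 'M[int]_m) : set (set 'rV[int]_n) :=
  [set S | pi_system K A S /\ has_type A S M].

Definition weyl_orbit (n : nat) (A : 'M[int]_n) (S : set 'rV[int]_n) :
    set (set 'rV[int]_n) :=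
  [set weyl A w @` S | w in [set: seq 'I_n]].

Definition weyl_orbits (n : nat) (A : 'M[int]_n)
    (P : set (set 'rV[int]_n)) : set (set (set 'rV[int]_n)) :=
  weyl_orbit A @` P.

Definition indecomposable (n : nat) (A : 'M[int]_n) : Prop :=
  forall S : {set 'I_n}, S != finset.set0 -> S != [set: 'I_n]%SET ->
    exists i j, [/\ i \in S, j \notin S & A i j != 0].

Definition affine_type (R : realType) (n : nat) (A : 'M[int]_n) : Prop :=
  let AR : 'M[R]_n := map_mx intr A in
  [/\ indecomposable A,
      (n - \rank AR)%N = 1%N,
      exists u : 'cV[R]_n, (forall i, 0 < u i 0) /\ AR *m u = 0
    & forall v : 'cV[R]_n, (forall i, 0 <= (AR *m v) i 0) -> AR *m v = 0].

(* The inclusion of the root lattice of a subdiagram. *)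
Definition incl (n : nat) (S : {set 'I_n}) (v : 'rV[int]_#|S|) : 'rV[int]_n :=
  \sum_i v 0 i *: alpha (enum_val i).

Definition ext_type (R : realType) (n : nat) (Z : 'M[int]_n) : Prop :=
  exists p : 'I_n, let Y := [set~ p]%SET in
    affine_type R (subdiag Z Y) /\
    exists d, null_root R[i] (subdiag Z Y) d /\
      pairing Z (incl d) (alpha p) = -1.

Definition ext_subdiagrams (R : realType) (n : nat) (A : 'M[int]_n) :
    {set {set 'I_n}} :=
  [set S : {set 'I_n} | `[< ext_type R (subdiag A S) >]]%SET.

Definition A1pp : 'M[int]_3 :=
  \matrix_(i, j) nth 0 (nth [::] [:: [:: 2; -1; 0];
                                     [:: -1; 2; -2];
                                     [:: 0; -2; 2]] i) j.

(* Main.v *)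
(* Let b0, b1, b2 be a pi-system of type A_1^{++}, with (b1 | b2) = -2.  The
   vector d = b1 + b2 is isotropic, and the reflections in b1 and b2 translate b1
   along d, so that d and all its W-conjugates have coefficients of one sign.  A
   conjugate of d or -d of least height is antidominant; its support Y is connected
   because supports of real roots are, and it is the null root of Y, which is
   therefore affine.  The stabilizer of d moves b0, where (b0 | d) = -1, to a
   simple root alpha_p, so that Z = Y + p is of Ext type.  Then p has one neighbour
   o in Y, and the finite Weyl group of Y - o moves b2 to the highest root
   d - alpha_o.  So Z and a sign determine the orbit of the pi-system.

   Conversely, w d - d >= 0 for an antidominant d, and the stabilizer of d only
   involves simple reflections orthogonal to d; so the orbit determines the sign, d
   and p.  It remains to see that Z determines p.  If Z = Y + p = Y' + p' with p
   different from p', then p' is a leaf of Y whose mark is that of p in Y', and the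
   marks along the arms of Z that end in p and p' lead to two distinct vertices of
   degree at least 3 in the intersection of Y and Y', which is connected and of
   finite type: a contradiction.

   About g(A) this uses that roots have coefficients of one sign, that simple
   reflections permute the positive roots other than the reflected one, and that
   v + alpha_i is a root if v is a positive root with (alpha_i | v) < 0.  The
   reflections are handled by the Serre relations and sl_2-strings, and h embeds in
   g~(A) by its action on dual Verma modules.  A root below the null root d of an
   affine diagram, maximal for this property, has nonpositive norm and thus is d. *)

From HB Require Import structures.
Require Import Defs.
From mathcomp Require Import all_boot all_order all_algebra.
From mathcomp Require Import generic_quotient.
From mathcomp Require Import boolp classical_sets functions cardinality reals.
From mathcomp Require Import complex.
From mathcomp Require Import ring zify.

Set Implicit Arguments.
Unset Strict Implicit.
Unset Printing Implicit Defensive.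

Import Order.TTheory GRing.Theory Num.Theory.

Local Open Scope classical_set_scope.
Local Open Scope ring_scope.

(** * Quotients of the Lie algebra of terms *)

(** Neither finite nor affine diagrams are classified. What replaces the tables is that the form is
    integral and even: on the support of a null vector d it is nonnegative and vanishes only on
    multiples of d, so a nonzero vector on this support that misses one of its vertices has norm at
    least 2, and vectors of norm 2 behave like roots ([affine_norm2_coherent]). This yields the
    highest root, the bound on its conjugates and the exclusion of two branch points. The Lie
    algebra is needed mainly for signs. That a real root has coefficients of one sign is a statement
    about the lattice, but it is drawn from g(X), taken over [rat]; the field of the theorem returns
    with null roots and with the differences in a pi-system. When Z has two overextending vertices p
    and p', the number m = d p' = d' p is -(d | d'). The branch points t and u satisfy d' t = (d t +
    1) m and d u = (d' u + 1) m; both relations cannot hold at one vertex, so t and u differ. *)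

Section Quotient.

Variables (K : fieldType) (n : nat) (A : 'M[int]_n).
Local Notation T := (kmterm K A).

(** Interface to the quotient by I. It serves both g~(A), with I the terms equal to 0, and g(A),
    with I = [km_radical]; the choice of representatives stays hidden behind the opaque
    [quot_model]. *)
Record lie_model (I : set T) := LieModel {
  lm_car :> lmodType K;
  lm_br : lm_car -> lm_car -> lm_car;
  lm_pi : T -> lm_car;
  lm_surj : forall x, exists t, x = lm_pi t;
  lm_eq : forall s t, lm_pi s = lm_pi t <-> I (KMsub s t);
  lm_add : forall s t, lm_pi (KMadd s t) = lm_pi s + lm_pi t;
  lm_scale : forall a t, lm_pi (KMscale a t) = a *: lm_pi t;
  lm_brE : forall s t, lm_pi (KMbr s t) = lm_br (lm_pi s) (lm_pi t);
  lm_0 : lm_pi (KM0 K A) = 0 }.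

HB.instance Definition _ := gen_eqMixin T.
HB.instance Definition _ := gen_choiceMixin T.

Section Build.

Variables (I : set T) (idI : lie_ideal I).

Let congr_I x y : km_eq x y -> I x -> I y. Proof. by case: idI => h _ _ _ _; apply: h. Qed.
Arguments congr_I {x y}.
Let I0 : I (KM0 K A). Proof. by case: idI. Qed.
Let ID x y : I x -> I y -> I (KMadd x y). Proof. by case: idI => _ _ h _ _; apply: h. Qed.
Let IZ a x : I x -> I (KMscale a x). Proof. by case: idI => _ _ _ h _; apply: h. Qed.
Let IB x y : I y -> I (KMbr x y). Proof. by case: idI => _ _ _ _ h; apply: h. Qed.

Lemma km_add0r (x : T) : km_eq (KMadd x (KM0 K A)) x.
Proof. by apply: km_trans (km_addC _ _) (km_add0 _). Qed.

Lemma km_addAC (x y z : T) : km_eq (KMadd (KMadd x y) z) (KMadd (KMadd x z) y).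
Proof.
apply: km_trans (km_sym (km_addA _ _ _)) _.
apply: km_trans (km_add_congr (km_refl _) (km_addC _ _)) _.
exact: km_addA.
Qed.

Lemma km_addACA (x y z t : T) :
  km_eq (KMadd (KMadd x y) (KMadd z t)) (KMadd (KMadd x z) (KMadd y t)).
Proof.
apply: km_trans (km_addA _ _ _) _.
apply: km_trans (km_add_congr (km_addAC _ _ _) (km_refl _)) _.
exact: km_sym (km_addA _ _ _).
Qed.

Lemma km_scale_sub a (x y : T) :
  km_eq (KMscale a (KMsub x y)) (KMsub (KMscale a x) (KMscale a y)).
Proof.
apply: km_trans (km_scaleDr _ _ _) _; apply: km_add_congr (km_refl _) _.
apply: km_trans (km_scaleA _ _ _) _; rewrite mulrC.
exact: km_sym (km_scaleA _ _ _).
Qed.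

Lemma km_sub_add (x y z t : T) :
  km_eq (KMadd (KMsub x y) (KMsub z t)) (KMsub (KMadd x z) (KMadd y t)).
Proof.
apply: km_trans (km_addACA _ _ _ _) _; apply: km_add_congr (km_refl _) _.
exact: km_sym (km_scaleDr _ _ _).
Qed.

Lemma km_sub_trans (x y z : T) :
  km_eq (KMadd (KMsub x y) (KMsub y z)) (KMsub x z).
Proof.
apply: km_trans (km_sym (km_addA _ _ _)) _; apply: km_add_congr (km_refl _) _.
apply: km_trans (km_addA _ _ _) _.
apply: km_trans (km_add_congr (km_addC _ _) (km_refl _)) _.
apply: km_trans (km_add_congr (km_addN _) (km_refl _)) _.
exact: km_add0.
Qed.

Lemma km_sub_br (x y z t : T) :
  km_eq (KMadd (KMbr x (KMsub z t)) (KMbr (KMsub x y) t))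
        (KMsub (KMbr x z) (KMbr y t)).
Proof.
apply: km_trans (km_sub_trans _ (KMbr x t) _); apply: km_add_congr.
  apply: km_trans (km_brDr _ _ _) _; apply: km_add_congr (km_refl _) _.
  exact: km_brZr.
apply: km_trans (km_brDl _ _ _) _; apply: km_add_congr (km_refl _) _.
exact: km_brZl.
Qed.

Lemma km_br_anti (x y : T) : km_eq (KMbr x y) (KMscale (-1) (KMbr y x)).
Proof.
have h : km_eq (KMadd (KMbr x y) (KMbr y x)) (KM0 K A).
  apply: km_trans (km_brxx (KMadd x y)); apply: km_sym.
  apply: km_trans (km_brDl _ _ _) _.
  apply: km_add_congr; apply: km_trans (km_brDr _ _ _) _.
    apply: km_trans (km_add_congr (km_brxx _) (km_refl _)) _; exact: km_add0.
  apply: km_trans (km_add_congr (km_refl _) (km_brxx _)) _; exact: km_add0r.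
apply: km_trans (km_sym (km_add0r _)) _.
apply: km_trans (km_add_congr (km_refl _) (km_sym (km_addN (KMbr y x)))) _.
apply: km_trans (km_addA _ _ _) _.
apply: km_trans (km_add_congr h (km_refl _)) _; exact: km_add0.
Qed.

Let IBl x y : I x -> I (KMbr x y).
Proof. by move=> Ix; apply: congr_I (km_sym (km_br_anti _ _)) _; apply/IZ/IB. Qed.

Let e (x y : T) : bool := `[< I (KMsub x y) >].

Let eP x y : km_eq x y -> e x y.
Proof.
rewrite /e => xy; apply/asboolP.
apply: (congr_I _ I0); apply: km_sym.
apply: km_trans (km_addN y); exact: km_add_congr xy (km_refl _).
Qed.

Let e_refl : reflexive e. Proof. by move=> x; apply/eP/km_refl. Qed.
Let e_sym : symmetric e.
Proof.
suff h x y : e x y -> e y x by move=> x y; apply/idP/idP; apply: h.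
rewrite /e => /asboolP xy; apply/asboolP; apply: (congr_I _ (IZ (-1) xy)).
apply: km_trans (km_scale_sub _ _ _) _.
apply: km_trans (km_addC _ _) _; apply: km_add_congr (km_refl _).
apply: km_trans (km_scaleA _ _ _) _; rewrite mulrNN mulr1; exact: km_scale1.
Qed.
Let e_trans : transitive e.
Proof.
rewrite /e => y x z /asboolP xy /asboolP yz; apply/asboolP.
exact: congr_I (km_sub_trans _ _ _) (ID xy yz).
Qed.

Definition km_equiv : equiv_rel T := EquivRel e e_refl e_sym e_trans.
Definition km_quot : Type := {eq_quot km_equiv}%qT.
HB.instance Definition _ := Choice.on km_quot.
HB.instance Definition _ := Quotient.on km_quot.

Let pi (t : T) : km_quot := (\pi_km_quot t)%qT.
Let piP s t : pi s = pi t <-> I (KMsub s t).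
Proof. by split=> [/eqquotP/asboolP//|/asboolP h]; apply/eqquotP. Qed.
Let pi_km s t : km_eq s t -> pi s = pi t.
Proof. by move=> /eP; rewrite /e => /asboolP h; apply/piP. Qed.
Let pi_repr (x : km_quot) : pi (repr x) = x. Proof. exact: reprK. Qed.
Let repr_pi t : I (KMsub (repr (pi t)) t).
Proof. by apply/piP; rewrite pi_repr. Qed.

Let qadd (x y : km_quot) := pi (KMadd (repr x) (repr y)).
Let qopp (x : km_quot) := pi (KMscale (-1) (repr x)).
Let qscale a (x : km_quot) := pi (KMscale a (repr x)).
Let qbr (x y : km_quot) := pi (KMbr (repr x) (repr y)).

Let pi_add s t : pi (KMadd s t) = qadd (pi s) (pi t).
Proof.
apply/esym/piP; apply: congr_I (km_sub_add _ _ _ _) _.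
by apply: ID; exact: repr_pi.
Qed.
Let pi_scale a t : pi (KMscale a t) = qscale a (pi t).
Proof.
by apply/esym/piP; apply: congr_I (km_scale_sub _ _ _) _; apply/IZ/repr_pi.
Qed.
Let pi_br s t : pi (KMbr s t) = qbr (pi s) (pi t).
Proof.
apply/esym/piP; apply: congr_I (km_sub_br _ _ _ _) _.
by apply: ID; [apply/IB/repr_pi|apply/IBl/repr_pi].
Qed.

Let qaddA : associative qadd.
Proof.
move=> x y z; rewrite -(pi_repr x) -(pi_repr y) -(pi_repr z) -!pi_add.
by apply: pi_km; exact: km_addA.
Qed.
Let qaddC : commutative qadd.
Proof.
by move=> x y; rewrite -(pi_repr x) -(pi_repr y) -!pi_add; apply/pi_km/km_addC.
Qed.
Let qadd0 : left_id (pi (KM0 K A)) qadd.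
Proof. by move=> x; rewrite -(pi_repr x) -!pi_add; apply/pi_km/km_add0. Qed.
Let qaddN : left_inverse (pi (KM0 K A)) qopp qadd.
Proof.
move=> x; rewrite qaddC -{1}(pi_repr x) -pi_add; apply/pi_km/km_addN.
Qed.

HB.instance Definition _ := GRing.isZmodule.Build km_quot qaddA qaddC qadd0 qaddN.

Let qscaleA a b v : qscale a (qscale b v) = qscale (a * b) v.
Proof. by rewrite -(pi_repr v) -!pi_scale; apply/pi_km/km_scaleA. Qed.
Let qscale1 : left_id 1 qscale.
Proof. by move=> v; rewrite -(pi_repr v) -!pi_scale; apply/pi_km/km_scale1. Qed.
Let qscaleDr : right_distributive qscale +%R.
Proof.
move=> a x y; rewrite -(pi_repr x) -(pi_repr y).
rewrite -[_ + _]pi_add -!pi_scale -[RHS]pi_add; exact/pi_km/km_scaleDr.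
Qed.
Let qscaleDl v : {morph qscale^~ v : a b / a + b}.
Proof.
move=> a b; rewrite -(pi_repr v) -!pi_scale -[RHS]pi_add; exact/pi_km/km_scaleDl.
Qed.

HB.instance Definition _ :=
  GRing.Zmodule_isLmodule.Build K km_quot qscaleA qscale1 qscaleDr qscaleDl.

Lemma quot_model : lie_model I.
Proof.
exact: (@LieModel I km_quot qbr pi (fun x => ex_intro _ (repr x) (esym (pi_repr x)))
    piP pi_add pi_scale pi_br erefl).
Qed.

End Build.

End Quotient.

(** * Weights and spanning words in a quotient of g~(A) *)

Section Model.

Variables (K : numFieldType) (n : nat) (A : 'M[int]_n).
Local Notation T := (kmterm K A).
Variables (I : set T) (idI : lie_ideal I) (L : lie_model I).

Local Notation pi := (@lm_pi _ _ _ _ L).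
Local Notation br := (@lm_br _ _ _ _ L).
Local Notation rlat := 'rV[int]_n.
Implicit Types (x y z : L) (h : 'rV[K]_(cartan_dim K A)) (v : rlat).

Definition gE i : L := pi (KMe K A i).
Definition gF i : L := pi (KMf K A i).
Definition gH h : L := pi (KMh h).

Lemma lm_km (s t : T) : km_eq s t -> pi s = pi t.
Proof.
move=> st; apply/lm_eq; case: (idI) => hc h0 _ _ _; apply: hc h0.
apply: km_sym; apply: km_trans (km_addN t).
exact: km_add_congr st (km_refl _).
Qed.

Lemma brDl x y z : br (x + y) z = br x z + br y z.
Proof.
have [a ->] := lm_surj x; have [b ->] := lm_surj y; have [c ->] := lm_surj z.
by rewrite -lm_add -!lm_brE -lm_add; apply: lm_km; exact: km_brDl.
Qed.

Lemma brDr x y z : br x (y + z) = br x y + br x z.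
Proof.
have [a ->] := lm_surj x; have [b ->] := lm_surj y; have [c ->] := lm_surj z.
by rewrite -lm_add -!lm_brE -lm_add; apply: lm_km; exact: km_brDr.
Qed.

Lemma brZl a x y : br (a *: x) y = a *: br x y.
Proof.
have [b ->] := lm_surj x; have [c ->] := lm_surj y.
by rewrite -lm_scale -!lm_brE -lm_scale; apply: lm_km; exact: km_brZl.
Qed.

Lemma brZr a x y : br x (a *: y) = a *: br x y.
Proof.
have [b ->] := lm_surj x; have [c ->] := lm_surj y.
by rewrite -lm_scale -!lm_brE -lm_scale; apply: lm_km; exact: km_brZr.
Qed.

Lemma brxx x : br x x = 0.
Proof.
by have [b ->] := lm_surj x; rewrite -lm_brE -(lm_0 L); exact/lm_km/km_brxx.
Qed.

Lemma br0r x : br x 0 = 0.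
Proof. by have := brZr 0 x 0; rewrite !scale0r. Qed.

Lemma br0l x : br 0 x = 0.
Proof. by have := brZl 0 0 x; rewrite !scale0r. Qed.

Lemma brNr x y : br x (- y) = - br x y.
Proof. by rewrite -scaleN1r brZr scaleN1r. Qed.

Lemma brNl x y : br (- x) y = - br x y.
Proof. by rewrite -scaleN1r brZl scaleN1r. Qed.

Lemma brC x y : br x y = - br y x.
Proof.
apply/eqP; rewrite -addr_eq0; have := brxx (x + y).
by rewrite brDl !brDr !brxx add0r addr0 => ->.
Qed.

Lemma brJ x y z : br x (br y z) = br (br x y) z + br y (br x z).
Proof.
have : br x (br y z) + (br y (br z x) + br z (br x y)) = 0.
  have [a ->] := lm_surj x; have [b ->] := lm_surj y; have [c ->] := lm_surj z.
  by rewrite -!lm_brE -!lm_add -(lm_0 L); exact/lm_km/km_jacobi.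
move/eqP; rewrite addr_eq0 => /eqP ->.
by rewrite opprD [in RHS]addrC (brC z x) brNr opprK [br z _]brC opprK.
Qed.

Lemma gHD a h h' : gH (a *: h + h') = a *: gH h + gH h'.
Proof. by rewrite /gH -lm_scale -lm_add; exact/lm_km/km_h_lin. Qed.

Lemma gH0 : gH 0 = 0.
Proof.
have := gHD (-1) 0 0; rewrite scaler0 addr0 => ->.
by rewrite scaleN1r addNr.
Qed.

Lemma gHZ a h : gH (a *: h) = a *: gH h.
Proof. by rewrite -[_ *: h]addr0 gHD gH0 addr0. Qed.

Lemma gHDD h h' : gH (h + h') = gH h + gH h'.
Proof. by rewrite -{1}[h]scale1r gHD scale1r. Qed.

Lemma br_EF i j : br (gE i) (gF j) = if i == j then gH (cartan_coroot K A i) else 0.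
Proof.
rewrite -lm_brE; case: eqP => [<-|/eqP ij]; first exact/lm_km/km_ef.
by rewrite -(lm_0 L); exact/lm_km/km_ef0.
Qed.

Lemma br_HH h h' : br (gH h) (gH h') = 0.
Proof. by rewrite -lm_brE -(lm_0 L); exact/lm_km/km_hh. Qed.

Lemma br_HE h i : br (gH h) (gE i) = simple_root i h *: gE i.
Proof. by rewrite -lm_brE -lm_scale; exact/lm_km/km_he. Qed.

Lemma br_HF h i : br (gH h) (gF i) = - simple_root i h *: gF i.
Proof. by rewrite -lm_brE -lm_scale; exact/lm_km/km_hf. Qed.

Lemma lm_gen (P : L -> Prop) :
  (forall i, P (gE i)) -> (forall i, P (gF i)) -> (forall h, P (gH h)) ->
  (forall x y, P x -> P y -> P (x + y)) -> (forall a x, P x -> P (a *: x)) ->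
  (forall x y, P x -> P y -> P (br x y)) -> forall x, P x.
Proof.
move=> PE PF PH PD PZ PB x; have [t ->] := lm_surj x; elim: t {x} => [i|i|h||s s' t t'|a s s'|s s' t t'].
- exact: PE.
- exact: PF.
- exact: PH.
- by rewrite lm_0 -(scale0r (gH 0)); apply: PZ.
- by rewrite lm_add; apply: PD.
- by rewrite lm_scale; apply: PZ.
- by rewrite lm_brE; apply: PB.
Qed.

Lemma weightD u v h : weight (u + v) h = weight u h + weight v h.
Proof.
by rewrite /weight -big_split /=; apply: eq_bigr => i _; rewrite !mxE rmorphD mulrDl.
Qed.

Lemma weightN v h : weight (- v) h = - weight v h.
Proof.
by rewrite /weight -sumrN; apply: eq_bigr => i _; rewrite !mxE rmorphN mulNr.
Qed.

Lemma weight0 h : weight (0 : rlat) h = 0.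
Proof. by rewrite /weight big1 // => i _; rewrite !mxE mul0r. Qed.

Lemma weight_alpha i h : weight (alpha i) h = simple_root i h.
Proof.
rewrite /weight (bigD1 i) //= big1 ?addr0; first by rewrite !mxE !eqxx mul1r.
by move=> j /negPf ji; rewrite !mxE ji andbF mul0r.
Qed.

Lemma simple_rootD a i h h' :
  simple_root i (a *: h + h') = a * simple_root i h + simple_root i h'.
Proof. by rewrite /simple_root mulmxDl -scalemxAl !mxE. Qed.

Lemma dual_coroots (c : 'rV[K]_n) :
  exists h : 'rV[K]_(cartan_dim K A), forall i, simple_root i h = c 0 i.
Proof.
have := cartan_roots_free K A; rewrite /row_free mxrank_tr -/(row_full _).
case/row_fullP=> B BM; exists (c *m B) => i.
by rewrite /simple_root -mulmxA BM mulmx1.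
Qed.

(** The simple roots of the realization are independent, so some h reads off a coordinate in which u
    and v differ; in characteristic 0 the two integers stay distinct in K. *)
Lemma weight_sep u v : u != v ->
  exists h : 'rV[K]_(cartan_dim K A), weight u h != weight v h.
Proof.
move=> uv; have [i ui] : exists i, u 0 i != v 0 i.
  apply/existsP; apply: contraNT uv => /existsPn h.
  by apply/eqP/rowP => i; apply/eqP; have := h i; rewrite negbK.
have [h hi] := dual_coroots (delta_mx 0 i); exists h.
have w u' : weight u' h = (u' 0 i)%:~R.
  rewrite /weight (bigD1 i) //= big1 ?addr0; first by rewrite hi mxE !eqxx mulr1.
  by move=> j /negPf ji; rewrite hi mxE ji andbF mulr0.
by rewrite !w eqr_int.
Qed.

Definition wt v x := forall h, br (gH h) x = weight v h *: x.

Lemma wtZ v a x : wt v x -> wt v (a *: x).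
Proof. by move=> hx h; rewrite brZr hx !scalerA mulrC. Qed.
Lemma wtN v x : wt v x -> wt v (- x).
Proof. by rewrite -scaleN1r; apply: wtZ. Qed.
Lemma wt_br u v x y : wt u x -> wt v y -> wt (u + v) (br x y).
Proof. by move=> hx hy h; rewrite brJ hx hy brZl brZr weightD scalerDl. Qed.
Lemma wt_E i : wt (alpha i) (gE i).
Proof. by move=> h; rewrite br_HE weight_alpha. Qed.
Lemma wt_F i : wt (- alpha i) (gF i).
Proof. by move=> h; rewrite br_HF weightN weight_alpha. Qed.
Lemma wt_H h : wt 0 (gH h).
Proof. by move=> h'; rewrite br_HH weight0 scale0r. Qed.

(* Weight components of an element of an ideal J lie in J: the operator
   ad h - mu(h), with h separating mu from the weight of y, removes one term. *)
Lemma graded_ideal (J : L -> Prop) v y (s : seq (rlat * L)) :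
    (forall x y, J x -> J y -> J (x + y)) -> (forall a x, J x -> J (a *: x)) ->
    (forall h x, J x -> J (br (gH h) x)) ->
    wt v y -> (forall p, p \in s -> p.1 != v /\ wt p.1 p.2) ->
  J (y + \sum_(p <- s) p.2) -> J y.
Proof.
move=> JD JZ JH; move sk: (size s) => k.
elim: k s y sk => [|k IH] [|p s] y //= sk vy hs; first by rewrite big_nil addr0.
have [pv pw] := hs p (mem_head _ _).
have [h hh] := weight_sep pv; rewrite eq_sym -subr_eq0 in hh.
rewrite big_cons => Jy.
pose f (q : rlat * L) := (q.1, (weight q.1 h - weight p.1 h) *: q.2).
have : J ((weight v h - weight p.1 h) *: y).
  apply: (IH (map f s)).
  - by rewrite size_map; case: sk.
  - exact: wtZ.
  - move=> _ /mapP[q qs ->] /=; have [] := hs q; first by rewrite inE qs orbT.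
    by move=> ? ?; split=> //; apply: wtZ.
  - have := JD _ _ (JH h _ Jy) (JZ (- weight p.1 h) _ Jy).
    congr J; rewrite big_map !brDr vy pw !scalerDr !scaleNr.
    rewrite addrACA [X in _ + X = _]addrACA subrr add0r scalerBl; congr (_ + _).
    rewrite -scaleNr scaler_sumr (big_morph _ (brDr (gH h)) (br0r _)) -big_split /=.
    rewrite big_seq [RHS]big_seq; apply: eq_bigr => q qs.
    have [] := hs q; first by rewrite inE qs orbT.
    by move=> _ ->; rewrite scaleNr scalerBl.
by move/(JZ (weight v h - weight p.1 h)^-1); rewrite scalerA mulVf // scale1r.
Qed.

Fixpoint eword s i : L := if s is j :: s' then br (gE j) (eword s' i) else gE i.
Fixpoint fword s i : L := if s is j :: s' then br (gF j) (fword s' i) else gF i.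
Definition wordwt s i : rlat := \sum_(j <- s) alpha j + alpha i.

Lemma wt_eword s i : wt (wordwt s i) (eword s i).
Proof.
elim: s => [|j s IH] /=; first by rewrite /wordwt big_nil add0r; apply: wt_E.
by rewrite /wordwt big_cons -addrA; apply: wt_br IH; apply: wt_E.
Qed.

Lemma wt_fword s i : wt (- wordwt s i) (fword s i).
Proof.
elim: s => [|j s IH] /=; first by rewrite /wordwt big_nil add0r; apply: wt_F.
by rewrite /wordwt big_cons -addrA opprD; apply: wt_br IH; apply: wt_F.
Qed.

(** The label is visibly 0, a sum of simple roots or minus such a sum: this is where roots get
    coefficients of one sign. The scalar a makes the family closed under scaling. *)
Inductive homog : rlat -> L -> Prop :=
| homog_H h : homog 0 (gH h)
| homog_E a s i : homog (wordwt s i) (a *: eword s i)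
| homog_F a s i : homog (- wordwt s i) (a *: fword s i).

Lemma homog_wt v x : homog v x -> wt v x.
Proof.
case=> [h|a s i|a s i]; first exact: wt_H.
  by apply/wtZ/wt_eword.
by apply/wtZ/wt_fword.
Qed.

Definition hsum x := exists s : seq (rlat * L),
  (forall p, p \in s -> homog p.1 p.2) /\ x = \sum_(p <- s) p.2.

Lemma hsum_homog v x : homog v x -> hsum x.
Proof.
move=> hx; exists [:: (v, x)]; split; last by rewrite big_seq1.
by move=> p; rewrite inE => /eqP ->.
Qed.

Lemma hsumD x y : hsum x -> hsum y -> hsum (x + y).
Proof.
move=> [s [hs ->]] [t [ht ->]]; exists (s ++ t); rewrite big_cat; split=> // p.
by rewrite mem_cat => /orP[/hs|/ht].
Qed.

Lemma homogZ a v x : homog v x -> homog v (a *: x).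
Proof.
case=> [h|b s i|b s i]; first by rewrite -gHZ; constructor.
  by rewrite scalerA; constructor.
by rewrite scalerA; constructor.
Qed.

Lemma hsumZ a x : hsum x -> hsum (a *: x).
Proof.
move=> [s [hs ->]]; exists (map (fun p => (p.1, a *: p.2)) s).
rewrite big_map scaler_sumr; split=> // _ /mapP[p /hs hp ->]; exact: homogZ.
Qed.

Lemma hsum0 : hsum 0.
Proof. by exists [::]; rewrite big_nil. Qed.

Lemma br_FE i j : br (gF i) (gE j) = if i == j then - gH (cartan_coroot K A i) else 0.
Proof. by rewrite brC br_EF eq_sym; case: eqP => [->|]//; rewrite oppr0. Qed.

Inductive span (G : L -> Prop) : L -> Prop :=
| span_gen x : G x -> span G x
| span_0 : span G 0
| span_D x y : span G x -> span G y -> span G (x + y)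
| span_Z a x : span G x -> span G (a *: x).

Lemma span_br (G G' : L -> Prop) u x :
  (forall y, G y -> span G' (br u y)) -> span G x -> span G' (br u x).
Proof.
move=> h; elim=> [y /h//||y z _ hy _ hz|a y _ hy].
- by rewrite br0r; apply: span_0.
- by rewrite brDr; apply: span_D.
- by rewrite brZr; apply: span_Z.
Qed.

Lemma span_sub (G G' : L -> Prop) x :
  (forall y, G y -> span G' y) -> span G x -> span G' x.
Proof.
by move=> h; elim=> [y /h//||y z _ hy _ hz|a y _ hy];
  [apply: span_0|apply: span_D|apply: span_Z].
Qed.

Lemma span_N G x : span G x -> span G (- x).
Proof. by rewrite -scaleN1r; apply: span_Z. Qed.

(* Operators that map span G to itself form a Lie subalgebra. *)
Lemma span_stable (G : L -> Prop) :
  (forall i y, G y -> span G (br (gE i) y)) ->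
  (forall i y, G y -> span G (br (gF i) y)) ->
  (forall h y, G y -> span G (br (gH h) y)) ->
  forall u y, span G y -> span G (br u y).
Proof.
move=> GE GF GH; apply: lm_gen => [i y|i y|h y|x y hx hy z|a x hx y|x y hx hy z].
- exact/span_br/GE.
- exact/span_br/GF.
- exact/span_br/GH.
- by rewrite brDl => hz; apply: span_D; [apply: hx|apply: hy].
- by rewrite brZl => hy; apply/span_Z/hx.
- move=> hz; have -> : br (br x y) z = br x (br y z) - br y (br x z).
    by rewrite brJ addrK.
  by apply: span_D; [apply/hx/hy|apply/span_N/hy/hx].
Qed.

Definition HEgen x := (exists h, x = gH h) \/ (exists s i, x = eword s i).
Definition HFgen x := (exists h, x = gH h) \/ (exists s i, x = fword s i).
Definition gens x := HEgen x \/ HFgen x.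

(** In [e_i, [f_k, y]] the part [[e_i, f_k], y] is a multiple of y, because y has a weight. The
    other part is f_k applied to the span, where [f_k, h] is a multiple of the one-letter word
    f_k. *)
Lemma span_E_fword i s j : span HFgen (br (gE i) (fword s j)).
Proof.
elim: s => [|k s IH] /=.
  rewrite br_EF; case: eqP => _; last exact: span_0.
  by apply: span_gen; left; eexists.
rewrite brJ br_EF; apply: span_D.
  case: eqP => _; last by rewrite br0l; apply: span_0.
  rewrite wt_fword; apply/span_Z/span_gen; right; by exists s, j.
apply: span_br IH => _ [[h ->]|[s' [i' ->]]].
  rewrite brC br_HF scaleNr opprK; apply/span_Z/span_gen; right; by exists [::], k.
by apply: span_gen; right; exists (k :: s'), i'.
Qed.

Lemma span_F_eword i s j : span HEgen (br (gF i) (eword s j)).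
Proof.
elim: s => [|k s IH] /=.
  rewrite br_FE; case: eqP => _; last exact: span_0.
  by apply/span_N/span_gen; left; eexists.
rewrite brJ br_FE; apply: span_D.
  case: eqP => _; last by rewrite br0l; apply: span_0.
  rewrite brNl wt_eword; apply/span_N/span_Z/span_gen; right; by exists s, j.
apply: span_br IH => _ [[h ->]|[s' [i' ->]]].
  rewrite brC br_HE; apply/span_N/span_Z/span_gen; right; by exists [::], k.
by apply: span_gen; right; exists (k :: s'), i'.
Qed.

(** Spanning part of the triangular decomposition: the span of h, the e-words and the f-words
    contains the generators and is stable under ad of every element. *)
Lemma span_gens x : span gens x.
Proof.
have gE_ i : gens (gE i) by left; right; exists [::], i.
have gF_ i : gens (gF i) by right; right; exists [::], i.
have gH_ h : gens (gH h) by left; left; exists h.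
have st : forall u y, span gens y -> span gens (br u y).
  apply: span_stable => [i|i|h] y.
  - case=> [[[h ->]|[s [j ->]]]|[[h ->]|[s [j ->]]]].
    + by rewrite brC br_HE; apply/span_N/span_Z/span_gen.
    + by apply: span_gen; left; right; exists (i :: s), j.
    + by rewrite brC br_HE; apply/span_N/span_Z/span_gen.
    + by apply: span_sub (span_E_fword i s j) => z hz; apply: span_gen; right.
  - case=> [[[h ->]|[s [j ->]]]|[[h ->]|[s [j ->]]]].
    + by rewrite brC br_HF; apply/span_N/span_Z/span_gen.
    + by apply: span_sub (span_F_eword i s j) => z hz; apply: span_gen; left.
    + by rewrite brC br_HF; apply/span_N/span_Z/span_gen.
    + by apply: span_gen; right; right; exists (i :: s), j.
  - case=> [[[h' ->]|[s [j ->]]]|[[h' ->]|[s [j ->]]]].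
    + by rewrite br_HH; apply: span_0.
    + by rewrite wt_eword; apply/span_Z/span_gen; left; right; exists s, j.
    + by rewrite br_HH; apply: span_0.
    + by rewrite wt_fword; apply/span_Z/span_gen; right; right; exists s, j.
elim/lm_gen: x => [i|i|h|x y|a x|x y].
- exact: span_gen.
- exact: span_gen.
- exact: span_gen.
- exact: span_D.
- exact: span_Z.
- by move=> _; apply: st.
Qed.

Lemma hsum_all x : hsum x.
Proof.
elim: (span_gens x) => [y hy||y z _ hy _ hz|a y _ hy].
- case: hy => [[[h ->]|[s [j ->]]]|[[h ->]|[s [j ->]]]].
  + exact: hsum_homog (homog_H h).
  + by rewrite -[eword _ _]scale1r; apply: hsum_homog (homog_E _ _ _).
  + exact: hsum_homog (homog_H h).
  + by rewrite -[fword _ _]scale1r; apply: hsum_homog (homog_F _ _ _).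
- exact: hsum0.
- exact: hsumD.
- exact: hsumZ.
Qed.

(* Only the terms of weight v contribute to an element of weight v. *)
Lemma wt_component v x : wt v x -> x != 0 -> exists y, homog v y /\ y != 0.
Proof.
move=> vx x0; have [s [hs xE]] := hsum_all x.
apply: contrapT => noy.
have {}noy y : homog v y -> y = 0.
  by move=> hy; apply: contrapT => /eqP y0; apply: noy; exists y.
have : x = 0; last by apply/eqP.
(* Cancelling from x its terms of other weights leaves homogeneous elements of weight v, which
   vanish by [noy]; [graded_ideal] for the zero ideal then kills x. *)
pose t := [seq (p.1, - p.2) | p <- s & p.1 != v].
apply: (@graded_ideal (fun z => z = 0) v x t) => //.
- by move=> ? ? -> ->; rewrite addr0.
- by move=> ? ? ->; rewrite scaler0.
- by move=> ? ? ->; rewrite br0r.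
- move=> _ /mapP[q + ->] /=; rewrite mem_filter => /andP[-> qs].
  by split=> //; apply/wtN/homog_wt/hs.
- rewrite xE big_map big_filter (bigID (fun p => p.1 != v)) /= addrAC sumrN subrr add0r.
  rewrite big_seq_cond big1 // => p /andP[ps]; rewrite negbK => /eqP pv.
  by apply: noy; rewrite -pv; apply: hs.
Qed.

Lemma wordwt_ge s i j : 0 <= wordwt s i 0 j.
Proof.
rewrite mxE summxE; apply: addr_ge0; last by rewrite mxE; case: (_ && _).
by apply: sumr_ge0 => k _; rewrite mxE; case: (_ && _).
Qed.

Lemma wordwt_pos s i : positive (wordwt s i).
Proof.
split; last exact: wordwt_ge.
apply/eqP => /rowP/(_ i); rewrite !mxE summxE => /eqP.
apply/negP/lt0r_neq0/ltr_wpDl; last by rewrite !eqxx.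
by apply: sumr_ge0 => k _; rewrite mxE; case: (_ && _).
Qed.

Lemma homog0_H x : homog 0 x -> exists h, x = gH h.
Proof.
move vE: (0 : rlat) => v hx; case: hx vE => [h _|a s i vE|a s i vE]; first by exists h.
  by have [] := wordwt_pos s i; rewrite -vE eqxx.
by have [] := wordwt_pos s i; rewrite -oppr_eq0 -vE eqxx.
Qed.

End Model.

(** * The radical *)

Section Radical.

Variables (K : numFieldType) (n : nat) (A : 'M[int]_n).
Local Notation T := (kmterm K A).
Local Notation hspace := 'rV[K]_(cartan_dim K A).

(* The dual of a Verma module: functions on words, with e_i acting by left
   translation.  It shows that h embeds in g~(A). *)
Section Verma.

Variable c : 'I_(cartan_dim K A).
Local Notation W := (seq 'I_n -> K).

(** The highest weight is the c-th coordinate functional on h; letting c vary, [kmh_inj] recovers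
    every coordinate. *)
Definition vermaH (h : hspace) (phi : W) : W :=
  fun w => (h 0 c - \sum_(j <- w) simple_root j h) * phi w.

Definition vermaE (i : 'I_n) (phi : W) : W := fun w => phi (i :: w).

(** The relation between e_i and f_j, evaluated at the word i :: w', forces this recursion; the
    value at the empty word is set to 0. *)
Fixpoint vermaF_rec (j : 'I_n) (w : seq 'I_n) (phi : W) : K :=
  if w is i :: w' then
    vermaF_rec j w' (vermaE i phi) +
    (if i == j then vermaH (cartan_coroot K A i) phi w' else 0)
  else 0.

Definition vermaF j phi : W := fun w => vermaF_rec j w phi.

Fixpoint verma (t : T) (phi : W) : W :=
  match t with
  | KMe i => vermaE i phi
  | KMf i => vermaF i phi
  | KMh h => vermaH h phi
  | KM0 => fun _ => 0
  | KMadd s t => fun w => verma s phi w + verma t phi w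
  | KMscale a t => fun w => a * verma t phi w
  | KMbr s t => fun w => verma s (verma t phi) w - verma t (verma s phi) w
  end.

Lemma vermaF_lin j w a (phi psi : W) :
  vermaF_rec j w (fun u => a * phi u + psi u) =
  a * vermaF_rec j w phi + vermaF_rec j w psi.
Proof.
elim: w phi psi => [|i w IH] phi psi /=; first by rewrite mulr0 addr0.
rewrite [X in X + _]IH; case: eqP => _; last by rewrite !addr0.
by rewrite /vermaH; ring.
Qed.

Lemma verma_lin t a (phi psi : W) w :
  verma t (fun u => a * phi u + psi u) w = a * verma t phi w + verma t psi w.
Proof.
elim: t phi psi w => [i|i|h||s IHs t IHt|b t IHt|s IHs t IHt] phi psi w //=.
- exact: vermaF_lin.
- by rewrite /vermaH; ring.
- by rewrite mulr0 addr0.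
- by rewrite IHs IHt; ring.
- by rewrite IHt; ring.
- have e (u u' : T) : (forall phi psi w, verma u (fun x => a * phi x + psi x) w =
      a * verma u phi w + verma u psi w) ->
      verma u (fun x => a * phi x + psi x) = fun x => a * verma u phi x + verma u psi x.
    by move=> h; apply/funext => x; apply: h.
  by rewrite (e t t) // (e s s) // IHs IHt; ring.
Qed.

Lemma verma0 t w : verma t (fun _ => 0) w = 0.
Proof.
have := verma_lin t (-1) (fun _ => 0) (fun _ => 0) w.
rewrite (_ : (fun u : seq 'I_n => -1 * 0 + 0 : K) = fun _ => 0); last first.
  by apply/funext => u; rewrite mulr0 addr0.
by rewrite mulN1r addNr.
Qed.

Lemma vermaD t (phi psi : W) w :
  verma t (fun u => phi u + psi u) w = verma t phi w + verma t psi w.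
Proof.
rewrite -[X in X + _]mul1r -verma_lin; congr verma; apply/funext => u.
by rewrite mul1r.
Qed.

Lemma vermaZ t a (phi : W) w : verma t (fun u => a * phi u) w = a * verma t phi w.
Proof.
rewrite -[RHS]addr0 -(verma0 t w) -verma_lin; congr verma; apply/funext => u.
by rewrite addr0.
Qed.

Lemma vermaB t (phi psi : W) w :
  verma t (fun u => phi u - psi u) w = verma t phi w - verma t psi w.
Proof.
rewrite vermaD -[X in _ + X = _]/(verma t (fun u => - psi u) w).
rewrite (_ : (fun u => - psi u) = fun u => -1 * psi u); last first.
  by apply/funext => u; rewrite mulN1r.
by rewrite vermaZ mulN1r.
Qed.

Lemma vermaHF h j (phi : W) w :
  vermaH h (vermaF j phi) w - vermaF j (vermaH h phi) w =
  - simple_root j h * vermaF j phi w.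
Proof.
rewrite /vermaF; elim: w phi => [|i w IH] phi /=; first by rewrite /vermaH /=; ring.
have IHi := IH (vermaE i phi).
(* Moving h past the letter i costs alpha_i(h). *)
have {}IH : vermaF_rec j w (vermaE i (vermaH h phi)) =
    vermaF_rec j w (vermaH h (vermaE i phi)) -
    simple_root i h * vermaF_rec j w (vermaE i phi).
  rewrite addrC -mulNr -vermaF_lin; congr vermaF_rec; apply/funext => u.
  by rewrite /vermaE /vermaH big_cons; ring.
rewrite {}IH; move: IHi; rewrite /vermaH /= big_cons.
set x := vermaF_rec j w _; set y := vermaF_rec j w _ => IHi.
have {IHi} -> : y = (h 0 c - \sum_(k <- w) simple_root k h) * x + simple_root j h * x.
  by rewrite -[y](subKr ((h 0 c - \sum_(k <- w) simple_root k h) * x)) IHi; ring.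
case: eqP => [->|_]; rewrite /vermaH; ring.
Qed.

Lemma vermaP (s t : T) : km_eq s t -> forall phi w, verma s phi w = verma t phi w.
Proof.
have fe (u v : T) : (forall phi w, verma u phi w = verma v phi w) ->
    forall phi, verma u phi = verma v phi.
  by move=> h phi; apply/funext => w; apply: h.
elim=> {s t} //=.
- by move=> x y z _ h1 _ h2 phi w; rewrite h1.
- by move=> x x' y y' _ h1 _ h2 phi w; rewrite h1 h2.
- by move=> a x x' _ h phi w; rewrite h.
- by move=> x x' y y' _ h1 _ h2 phi w; rewrite !(fe _ _ h1) !(fe _ _ h2).
- by move=> x y z phi w; rewrite addrA.
- by move=> x y phi w; rewrite addrC.
- by move=> x phi w; rewrite add0r.
- by move=> x phi w; rewrite mulN1r subrr.
- by move=> x phi w; rewrite mul1r.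
- by move=> a b x phi w; rewrite mulrA.
- by move=> a x y phi w; rewrite mulrDr.
- by move=> a b x phi w; rewrite mulrDl.
- by move=> x y z phi w; rewrite vermaD; ring.
- by move=> x y z phi w; rewrite vermaD; ring.
- by move=> a x y phi w; rewrite vermaZ; ring.
- by move=> a x y phi w; rewrite vermaZ; ring.
- by move=> x phi w; rewrite subrr.
- by move=> x y z phi w; rewrite !vermaB; ring.
- by move=> a h h' phi w; rewrite /vermaH !mxE (eq_bigr _ (fun i _ => simple_rootD a i h h')) big_split /= -mulr_sumr; ring.
- by move=> i phi w; rewrite /vermaE /vermaF /= eqxx [_ + vermaH _ _ _]addrC addrK.
- by move=> i j /negPf ij phi w; rewrite /vermaE /vermaF /= ij addr0 subrr.
- by move=> h h' phi w; rewrite /vermaH; ring.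
- by move=> h i phi w; rewrite /vermaE /vermaH big_cons; ring.
- by move=> h i phi w; exact: vermaHF.
Qed.

End Verma.

Lemma kmh_inj (h : hspace) : km_eq (KMh h) (KM0 K A) -> h = 0.
Proof.
move=> h0; apply/rowP => c; have := vermaP c h0 (fun _ => 1) [::].
by rewrite /= /vermaH big_nil subr0 mulr1 mxE.
Qed.

Definition km_null : set T := [set t | km_eq t (KM0 K A)].

Lemma km_null_ideal : lie_ideal km_null.
Proof.
split=> [x y xy hx||x y hx hy|a x hx|x y hy].
- exact: km_trans (km_sym xy) hx.
- exact: km_refl.
- exact: km_trans (km_add_congr hx hy) (km_add0 _).
- apply: km_trans (km_scale_congr a hx) _.
  apply: km_trans (km_scale_congr a (km_sym (km_addN (KM0 K A)))) _.
  apply: km_trans (km_scale_sub _ _ _) _; exact: km_addN.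
- apply: km_trans (km_br_congr (km_refl x) hy) _.
  apply: km_trans (km_br_congr (km_refl x) (km_sym (km_addN (KM0 K A)))) _.
  apply: km_trans (km_brDr _ _ _) _.
  apply: km_trans (km_add_congr (km_refl _) (km_brZr _ _ _)) _; exact: km_addN.
Qed.

Let L0 := quot_model km_null_ideal.
Local Notation pi0 := (@lm_pi _ _ _ _ L0).

Lemma pi0_eq (s t : T) : pi0 s = pi0 t <-> km_eq s t.
Proof.
split=> [/lm_eq h|]; last exact: (lm_km km_null_ideal).
apply: km_trans (km_sym (km_add0r _)) _.
apply: km_trans (km_add_congr (km_refl _) (km_sym (km_addN t))) _.
apply: km_trans (km_add_congr (km_refl _) (km_addC _ _)) _.
apply: km_trans (km_addA _ _ _) _.
by apply: km_trans (km_add_congr h (km_refl _)) _; exact: km_add0.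
Qed.

(** The component of weight 0 lies in h, and in I by [graded_ideal]; hence it vanishes. *)
Lemma ideal_no_h (I : set T) t : lie_ideal I ->
    (forall h, I (KMh h) -> km_eq (KMh h) (KM0 K A)) -> I t ->
  exists s : seq ('rV[int]_n * L0),
    (forall p, p \in s -> p.1 != 0 /\ wt p.1 p.2) /\ pi0 t = \sum_(p <- s) p.2.
Proof.
move=> [Icg I0 ID IZ IB] Ih It.
have [s [hs tE]] := hsum_all km_null_ideal (pi0 t).
exists [seq p <- s | p.1 != 0]; split.
  move=> p; rewrite mem_filter => /andP[-> /hs hp]; split=> //.
  exact: (homog_wt km_null_ideal).
have [h hE] : exists h, \sum_(p <- s | p.1 == 0) p.2 = gH L0 h.
  elim: (s) hs => [|p s' IH] hs; first by exists 0; rewrite big_nil (gH0 km_null_ideal).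
  have {}IH := IH (fun q qs => hs q (mem_behead (s := p :: s') qs)).
  rewrite big_cons; case: eqP => // p0; case: IH => h ->.
  have := hs p (mem_head _ _); rewrite p0 => /homog0_H[h' ->].
  by exists (h' + h); rewrite (gHDD km_null_ideal).
have tE2 : pi0 t = gH L0 h + \sum_(p <- s | p.1 != 0) p.2.
  by rewrite tE (bigID (fun p => p.1 == 0)) /= hE.
rewrite big_filter {1}tE2; suff -> : gH L0 h = 0 by rewrite add0r.
suff Jh : exists2 t', I t' & gH L0 h = pi0 t'.
  have [t' It' /pi0_eq e] := Jh; rewrite -(lm_0 L0); apply/pi0_eq/Ih.
  exact: Icg (km_sym e) It'.
apply: (@graded_ideal _ _ _ _ km_null_ideal L0 (fun x => exists2 t', I t' & x = pi0 t') 0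
          (gH L0 h) [seq p <- s | p.1 != 0]).
- move=> _ _ [a Ia ->] [b Ib ->]; exists (KMadd a b); first exact: ID.
  by rewrite lm_add.
- move=> a _ [b Ib ->]; exists (KMscale a b); first exact: IZ.
  by rewrite lm_scale.
- move=> h' _ [b Ib ->]; exists (KMbr (KMh h') b); first exact: IB.
  by rewrite lm_brE.
- exact: (wt_H km_null_ideal).
- move=> p; rewrite mem_filter => /andP[-> /hs hp]; split=> //.
  exact: (homog_wt km_null_ideal).
- by exists t => //; rewrite big_filter.
Qed.

Lemma km_radical_h h : km_radical (KMh h : T) -> h = 0.
Proof. by case=> I [_ hI Ih]; apply/kmh_inj/hI. Qed.

(** The point is closure under addition, where x and y come from different ideals I and J: elements
    of I and of J have no component of weight 0, so neither have those of I + J, which therefore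
    meets h trivially. *)
Lemma km_radical_ideal : lie_ideal (@km_radical K n A).
Proof.
split=> [x y xy [I [hI Ih Ix]]||x y [I [hI Ih Ix]] [J [hJ Jh Jy]]
        |a x [I [hI Ih Ix]]|x y [I [hI Ih Iy]]].
- by exists I; split=> //; case: hI => h _ _ _ _; apply: h xy Ix.
- by exists km_null; split; [exact: km_null_ideal|by []|exact: km_refl].
- exists [set z | exists a b, [/\ I a, J b & km_eq (KMadd a b) z]]; split.
  + case: (hI) (hJ) => [Icg I0 ID IZ IB] [Jcg J0 JD JZ JB].
    split=> [z z' zz' [a [b [Ia Jb e]]]||z z' [a [b [Ia Jb e]]] [a' [b' [Ia' Jb' e']]]
            |k z [a [b [Ia Jb e]]]|z z' [a [b [Ia Jb e]]]].
    * by exists a, b; split=> //; apply: km_trans e zz'.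
    * by exists (KM0 K A), (KM0 K A); split=> //; exact: km_add0.
    * exists (KMadd a a'), (KMadd b b'); split; [exact: ID|exact: JD|].
      apply: km_trans (km_addACA _ _ _ _) _; exact: km_add_congr e e'.
    * exists (KMscale k a), (KMscale k b); split; [exact: IZ|exact: JZ|].
      apply: km_trans (km_sym (km_scaleDr _ _ _)) _; exact: km_scale_congr.
    * exists (KMbr z a), (KMbr z b); split; [exact: IB|exact: JB|].
      apply: km_trans (km_sym (km_brDr _ _ _)) _; exact: km_br_congr (km_refl _) e.
  + move=> h [a [b [Ia Jb /pi0_eq]]]; rewrite lm_add => e.
    have [s [hs sE]] := ideal_no_h hI Ih Ia.
    have [t [ht tE]] := ideal_no_h hJ Jh Jb.
    apply/pi0_eq; rewrite lm_0.
    pose r := [seq (p.1, - p.2) | p <- s ++ t].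
    apply: (@graded_ideal _ _ _ _ km_null_ideal L0 (fun x => x = 0) 0 (gH L0 h) r).
    * by move=> ? ? -> ->; rewrite addr0.
    * by move=> ? ? ->; rewrite scaler0.
    * by move=> ? ? ->; rewrite (br0r km_null_ideal).
    * exact: (wt_H km_null_ideal).
    * move=> _ /mapP[q + ->] /=; rewrite mem_cat => /orP[/hs|/ht] [-> hq];
      split=> //; exact: (wtN km_null_ideal).
    * have -> : gH L0 h = pi0 a + pi0 b by rewrite e.
      by rewrite big_map sumrN big_cat /= -sE -tE subrr.
  + exists x, y; split=> //; exact: km_refl.
- by exists I; split=> //; case: hI => _ _ _ h _; apply: h Ix.
- by exists I; split=> //; case: hI => _ _ _ _ h; apply: h Iy.
Qed.

End Radical.

(** * Roots of a Kac-Moody algebra *)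

Section SL2.

Variables (K : numFieldType) (V : lmodType K) (e f h : V -> V).
Hypotheses (eZ : forall a x, e (a *: x) = a *: e x)
           (fZ : forall a x, f (a *: x) = a *: f x)
           (ef : forall x, e (f x) = f (e x) + h x)
           (he : forall x, h (e x) = e (h x) + 2%:R *: e x)
           (hf : forall x, h (f x) = f (h x) - 2%:R *: f x).

Lemma sl2_weight_f l z k : h z = l *: z ->
  h (iter k f z) = (l - 2%:R * k%:R) *: iter k f z.
Proof.
move=> hz; elim: k => [|k IH] /=; first by rewrite mulr0 subr0.
by rewrite hf IH fZ -scalerBl -natr1; congr (_ *: _); ring.
Qed.

Lemma sl2_weight_e l z k : h z = l *: z ->
  h (iter k e z) = (l + 2%:R * k%:R) *: iter k e z.
Proof.
move=> hz; elim: k => [|k IH] /=; first by rewrite mulr0 addr0.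
by rewrite he IH eZ -scalerDl -natr1; congr (_ *: _); ring.
Qed.

Lemma sl2_ef l z k : h z = l *: z -> e z = 0 ->
  e (iter k.+1 f z) = (k.+1%:R * (l - k%:R)) *: iter k f z.
Proof.
move=> hz ez; elim: k => [|k IH].
  have f0 : f 0 = 0 by rewrite -(scale0r z) fZ !scale0r.
  by rewrite /= ef ez f0 hz add0r; congr (_ *: _); ring.
rewrite iterS ef IH fZ (sl2_weight_f k.+1 hz) -iterS -scalerDl; congr (_ *: _).
by rewrite -!natr1; ring.
Qed.

(** Let y = e^q x be the last nonzero vector upwards. Its weight is k + 2q, so f^j y is nonzero for
    j <= k + 2q, in particular for j = k + q, where the weight is -k, the reflection of that of
    x. *)
Lemma sl2_string x k p : x != 0 -> h x = k%:R *: x -> iter p e x = 0 ->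
  exists q, iter (k + q) f (iter q e x) != 0.
Proof.
move=> x0 hx; elim: p => [|p IH] px; first by case/eqP: x0.
case: (eqVneq (iter p e x) 0) => [/IH//|y0]; exists p.
set y := iter p e x in px y0 |- *.
have hy : h y = (k + 2 * p)%:R *: y.
  by rewrite (sl2_weight_e p hx) natrD natrM.
have ey : e y = 0 by [].
have : (k + p <= k + 2 * p)%N by rewrite leq_add2l leq_pmull.
elim: (k + p)%N => [//|j IHj] jk /=; apply: contraNneq (IHj (ltnW jk)) => fy.
have e0 : e 0 = 0 by rewrite -(scale0r x) eZ !scale0r.
have := sl2_ef j hy ey; rewrite /= fy e0 => /esym/eqP; rewrite scaler_eq0 => /orP[|//].
by rewrite mulf_eq0 pnatr_eq0 /= subr_eq0 eqr_nat gtn_eqF.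
Qed.

End SL2.

Section KMRoots.

Variables (K : numFieldType) (n : nat) (A : 'M[int]_n).
Hypothesis gcmA : gcm A.
Local Notation T := (kmterm K A).
Local Notation rlat := 'rV[int]_n.

Let R := @km_radical K n A.
Let idR : lie_ideal R := @km_radical_ideal K n A.
Let L : lie_model R := quot_model idR.
Local Notation pi := (@lm_pi _ _ _ _ L).
Local Notation br := (@lm_br _ _ _ _ L).
Local Notation E := (gE L).
Local Notation F := (gF L).
Local Notation H := (gH L).
Local Notation coroot := (cartan_coroot K A).

Lemma km_rootP v : km_root K A v <-> v != 0 /\ exists x : L, x != 0 /\ wt v x.
Proof.
split=> -[v0 [x [x0 hx]]]; split=> //.
  exists (pi x); split=> [|h].
    apply/eqP; rewrite -(lm_0 L) => e; apply: x0; exact/(lm_eq L).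
  by rewrite -lm_brE -lm_scale; apply/(lm_eq L)/hx.
have [t xt] := lm_surj x; exists t; split.
  by move=> e; case/eqP: x0; rewrite xt -(lm_0 L); apply/(lm_eq L).
by move=> h; apply/(lm_eq L); rewrite lm_brE lm_scale -xt; apply: hx.
Qed.

Lemma gH_eq0 h : H h = 0 -> h = 0.
Proof.
rewrite /gH -(lm_0 L) => /lm_eq h0.
case: idR => Rc _ _ _ _; apply: (@km_radical_h _ _ A); apply: Rc h0.
apply: km_trans (km_add_congr (km_refl _) _) (km_add0r _).
exact: km_trans (km_scale_congr _ (km_sym (km_addN (KM0 K A))))
  (km_trans (km_scale_sub _ _ _) (km_addN _)).
Qed.

Lemma coroot_neq0 i : coroot i != 0.
Proof.
apply/eqP => /(congr1 (fun h => simple_root i h)); rewrite simple_root_coroot.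
case: gcmA => -> _ _; rewrite /simple_root mul0mx mxE => /eqP.
by rewrite pnatr_eq0.
Qed.

Lemma gE_neq0 i : E i != 0.
Proof.
apply: contraNneq (coroot_neq0 i) => E0; apply/eqP/gH_eq0.
by have := br_EF idR L i i; rewrite E0 eqxx (br0l idR).
Qed.

Lemma alpha_neq0 i : alpha i != 0 :> rlat.
Proof. by apply/eqP => /rowP/(_ i)/eqP; rewrite !mxE !eqxx. Qed.

Lemma km_root_alpha i : km_root K A (alpha i).
Proof.
apply/km_rootP; split; first exact: alpha_neq0.
by exists (E i); split; [exact: gE_neq0|exact: (wt_E idR)].
Qed.

Lemma km_root_sign v : km_root K A v -> positive v \/ positive (- v).
Proof.
case/km_rootP=> v0 [x [x0 vx]]; have [y [hy _]] := wt_component idR vx x0.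
case: hy v0 => [h|a s i _|a s i _]; first by rewrite eqxx.
  by left; exact: wordwt_pos.
by right; rewrite opprK; exact: wordwt_pos.
Qed.

Lemma eword_line (s : seq 'I_n) i : all (pred1 i) s -> s != [::] -> eword L s i = 0.
Proof.
case: s => // j s /= /andP[/eqP -> hs] _; elim: s hs => [_|k s IH /= /andP[/eqP -> hs]].
  by rewrite /= (brxx idR).
by rewrite /= IH // (br0r idR).
Qed.

(** A word whose weight is a multiple of alpha_i has all its letters equal to i, and vanishes by
    [e_i, e_i] = 0 unless it is a single letter. *)
Lemma km_root_line v i : km_root K A v -> positive v ->
  (forall k, k != i -> v 0 k = 0) -> v = alpha i.
Proof.
case/km_rootP=> v0 [x [x0 vx]] [_ vp] vi.
have [y [hy y0]] := wt_component idR vx x0.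
case: hy v0 vp vi y0 => [h|a s j _ _ vi y0|a s j _ vp]; first by rewrite eqxx.
- have ji : j = i.
    apply: contraTeq isT => /vi; rewrite !mxE summxE !eqxx /= => /eqP.
    rewrite gt_eqF // ltr_wpDl //; apply: sumr_ge0 => k _.
    by rewrite mxE; case: (_ && _).
  have si : all (pred1 i) s.
    apply/allP => k ks; apply: contraTT isT => /vi /eqP.
    rewrite mxE summxE gt_eqF // ltr_wpDr //; first by rewrite mxE; case: (_ && _).
    rewrite (big_rem k) //= ltr_wpDr //; last by rewrite mxE !eqxx.
    by apply: sumr_ge0 => l _; rewrite mxE; case: (_ && _).
  case: (s =P [::]) => [->|/eqP sn]; first by rewrite /wordwt big_nil add0r ji.
  by move: y0; rewrite -ji in si *; rewrite eword_line // scaler0 eqxx.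
- move=> _ _; have [wn0 wp] := wordwt_pos s j; case/eqP: wn0; apply/rowP => k.
  rewrite [RHS]mxE; apply/eqP; rewrite eq_le wp andbT -oppr_ge0; have := vp k.
  by rewrite [X in 0 <= X]mxE.
Qed.

Lemma weight_coroot i v : weight v (coroot i) = (pairing A (alpha i) v)%:~R.
Proof.
rewrite /weight /pairing /alpha -rowE mxE rmorph_sum; apply: eq_bigr => j _.
by rewrite simple_root_coroot rmorphM !mxE mulrC.
Qed.

(* An element of positive weight killed by every f_k generates an ideal that
   meets h trivially. *)
Lemma singular_vector_eq0 v (x : L) : wt v x -> positive v ->
  (forall k, br (F k) x = 0) -> x = 0.
Proof.
move=> vx vp Fx.
pose up s := foldr (fun j y => br (E j) y) x s.
pose G y := exists s, y = up s.
have upw s : wt (\sum_(j <- s) alpha j + v) (up s).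
  elim: s => [|j s IH]; first by rewrite big_nil add0r.
  by rewrite big_cons -addrA; apply: (wt_br idR) IH; apply: (wt_E idR).
have Gst : forall u y, span G y -> span G (br u y).
  apply: (span_stable idR) => [i _ [s ->]|i _ [s ->]|h _ [s ->]].
  - by apply: span_gen; exists (i :: s).
  - elim: s => [|k s IH] /=; first by rewrite Fx; apply: span_0.
    rewrite (brJ idR) (br_FE idR); apply: span_D.
      case: eqP => _; last by rewrite (br0l idR); apply: span_0.
      rewrite (brNl idR) upw; apply: span_N; apply: span_Z.
      by apply: span_gen; exists s.
    apply: (span_br idR) IH => _ [s' ->]; apply: span_gen; by exists (k :: s').
  - by rewrite upw; apply/span_Z/span_gen; exists s.
have Gs y : span G y -> exists s : seq (rlat * L),
    (forall p, p \in s -> p.1 != 0 /\ wt p.1 p.2) /\ y = \sum_(p <- s) p.2.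
  elim=> [_ [s ->]||z t _ [s [hs ->]] _ [s' [hs' ->]]|a z _ [s [hs ->]]].
  - exists [:: (\sum_(j <- s) alpha j + v, up s)]; rewrite big_seq1; split=> // p.
    rewrite inE => /eqP -> /=; split=> //; case: (vp) => /eqP v0 vge.
    apply/eqP => /rowP e; apply: v0; apply/rowP => k.
    apply/eqP; rewrite mxE eq_le vge andbT; have := e k; rewrite !mxE summxE => <-.
    by rewrite lerDr; apply: sumr_ge0 => l _; rewrite mxE; case: (_ && _).
  - by exists [::]; rewrite big_nil.
  - exists (s ++ s'); rewrite big_cat; split=> // p.
    by rewrite mem_cat => /orP[/hs|/hs'].
  - exists [seq (p.1, a *: p.2) | p <- s]; rewrite big_map scaler_sumr; split=> //.
    by move=> _ /mapP[p /hs [p0 pw] ->]; split=> //; apply: (wtZ idR).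
have [t xt] := lm_surj x; rewrite xt -(lm_0 L); apply/(lm_eq L).
suff Rt : R t.
  case: idR => Rc R0 RD RZ _; apply: RD => //; exact: RZ.
exists [set t' | span G (pi t')]; split; last 1 first.
- by rewrite /= -xt; apply: span_gen; exists [::].
- split=> /= [y z /(lm_km idR L) -> //||y z hy hz|a y hy|y z hz].
  + by rewrite lm_0; apply: span_0.
  + by rewrite lm_add; apply: span_D.
  + by rewrite lm_scale; apply: span_Z.
  + by rewrite lm_brE; apply: Gst.
- move=> h /= /Gs [s [hs hE]].
  have : H h = 0.
    apply: (@graded_ideal _ _ _ _ idR L (fun x => x = 0) 0 (H h) [seq (p.1, - p.2) | p <- s]).
    + by move=> ? ? -> ->; rewrite addr0.
    + by move=> ? ? ->; rewrite scaler0.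
    + by move=> ? ? ->; rewrite (br0r idR).
    + exact: (wt_H idR).
    + by move=> _ /mapP[q /hs [q0 qw] ->]; split=> //; apply: (wtN idR).
    + by rewrite big_map sumrN /gH hE subrr.
  by move=> /gH_eq0 ->; apply/pi0_eq; rewrite lm_0; apply: (gH0 (@km_null_ideal _ _ A)).
Qed.

Lemma br_linZ u a (x : L) : br u (a *: x) = a *: br u x. Proof. exact: (brZr idR). Qed.

Lemma simple_root_diag i : simple_root i (coroot i) = 2%:R :> K.
Proof. by rewrite simple_root_coroot; case: gcmA => -> _ _. Qed.

Lemma sl2_EF i (x : L) : br (E i) (br (F i) x) = br (F i) (br (E i) x) + br (H (coroot i)) x.
Proof. by rewrite (brJ idR) (br_EF idR) eqxx addrC. Qed.
Lemma sl2_HE i (x : L) :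
  br (H (coroot i)) (br (E i) x) = br (E i) (br (H (coroot i)) x) + 2%:R *: br (E i) x.
Proof. by rewrite (brJ idR) (br_HE idR) (brZl idR) simple_root_diag addrC. Qed.
Lemma sl2_HF i (x : L) :
  br (H (coroot i)) (br (F i) x) = br (F i) (br (H (coroot i)) x) - 2%:R *: br (F i) x.
Proof. by rewrite (brJ idR) (br_HF idR) (brZl idR) simple_root_diag scaleNr addrC. Qed.

(** Negating h exchanges the roles of e and f, so that the lemmas on sl_2 apply to strings in both
    directions. *)
Let Hm i (x : L) := - br (H (coroot i)) x.
Lemma sl2_FE i (x : L) : br (F i) (br (E i) x) = br (E i) (br (F i) x) + Hm i x.
Proof. by rewrite sl2_EF /Hm addrK. Qed.
Lemma sl2_HmF i (x : L) : Hm i (br (F i) x) = br (F i) (Hm i x) + 2%:R *: br (F i) x.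
Proof. by rewrite /Hm sl2_HF (brNr idR) opprB addrC. Qed.
Lemma sl2_HmE i (x : L) : Hm i (br (E i) x) = br (E i) (Hm i x) - 2%:R *: br (E i) x.
Proof. by rewrite /Hm sl2_HE (brNr idR) opprD. Qed.

Lemma wt_iterE i k v (x : L) : wt v x -> wt (v + alpha i *+ k) (iter k (br (E i)) x).
Proof.
move=> vx; elim: k => [|k IH]; first by rewrite addr0.
by rewrite mulrS addrCA; apply: (wt_br idR) IH; apply: (wt_E idR).
Qed.

Lemma wt_iterF i k v (x : L) : wt v x -> wt (v - alpha i *+ k) (iter k (br (F i)) x).
Proof.
move=> vx; elim: k => [|k IH]; first by rewrite subr0.
by rewrite mulrS opprD addrCA; apply: (wt_br idR) IH; apply: (wt_F idR).
Qed.

(** The element is killed by every f_k, so [singular_vector_eq0] applies. For k = i this is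
    [sl2_ef], whose factor vanishes at m = -a_ij; for the other k, f_k commutes with e_i and only
    [f_j, e_j] remains. *)
Lemma serre i j : i != j ->
  iter `|A i j|%N.+1 (br (E i)) (E j) = 0.
Proof.
move=> ij; set m := `|A i j|%N.
have mE : A i j = - m%:Z.
  have [_ h _] := gcmA; by have := h _ _ ij; rewrite /m; lia.
apply: (@singular_vector_eq0 (alpha j + alpha i *+ m.+1)).
- exact/wt_iterE/(wt_E idR).
- split.
    apply/eqP => /rowP/(_ j)/eqP; rewrite mxE mulmxnE !mxE !eqxx.
    by rewrite [j == i]eq_sym (negPf ij) mul0rn.
  move=> k; rewrite mxE mulmxnE; apply: addr_ge0; last apply: mulrn_wge0.
    by rewrite mxE; case: (_ && _).
  by rewrite mxE; case: (_ && _).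
move=> k; have [->|ki] := eqVneq k i.
  have Fj : br (F i) (E j) = 0 by rewrite (br_FE idR) (negPf ij).
  have hz : Hm i (E j) = m%:R *: E j.
    by rewrite /Hm (br_HE idR) simple_root_coroot mE mulrNz scaleNr opprK.
  rewrite (sl2_ef (br_linZ (E i)) (sl2_FE i) (sl2_HmE i) m hz Fj).
  by rewrite subrr mulr0 scale0r.
have -> l y : br (F k) (iter l (br (E i)) y) = iter l (br (E i)) (br (F k) y).
  by elim: l => //= l IH; rewrite (brJ idR) (br_FE idR) (negPf ki) (br0l idR) add0r IH.
rewrite (br_FE idR); have it0 l : iter l (br (E i)) 0 = 0.
  by elim: l => //= l ->; rewrite (br0r idR).
case: eqP => [->|_]; last exact: it0.
rewrite iterSr (brNr idR) (brC idR) opprK (br_HE idR) simple_root_coroot.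
(* What remains is (ad e_i)^m applied to a_ji e_i. It vanishes for m > 0 by [e_i, e_i] = 0, and for
   m = 0 because a_ji = 0 together with a_ij. *)
case me: m => [|m'].
  have [_ _ h] := gcmA; have := h j i; rewrite mE me oppr0 => /(_ erefl) ->.
  by rewrite scale0r.
by rewrite iterSr (brZr idR) (brxx idR) scaler0 it0.
Qed.

Lemma iter_brD u k (x y : L) : iter k (br u) (x + y) = iter k (br u) x + iter k (br u) y.
Proof. by elim: k => //= k ->; rewrite (brDr idR). Qed.
Lemma iter_brZ u k a (x : L) : iter k (br u) (a *: x) = a *: iter k (br u) x.
Proof. by elim: k => //= k ->; rewrite (brZr idR). Qed.
Lemma iter_br0 u k : iter k (br u) 0 = 0.
Proof. by elim: k => //= k ->; rewrite (br0r idR). Qed.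

Lemma iter_br_leibniz u k a b (x y : L) : iter a (br u) x = 0 -> iter b (br u) y = 0 ->
  (a + b <= k)%N -> iter k (br u) (br x y) = 0.
Proof.
elim: k a b x y => [|k IH] [|a] [|b] x y /= hx hy ab //.
- by rewrite hx (br0l idR).
- by rewrite hx (br0l idR) -iterS iter_br0.
- by rewrite hx (br0l idR) -iterS iter_br0.
- by rewrite hy (br0r idR) -iterS iter_br0.
rewrite -iterS iterSr (brJ idR) iter_brD (IH a b.+1 (br u x) y) ?add0r.
- by apply: (IH a.+1 b) => //; [rewrite -iterSr|lia].
- by rewrite -iterSr.
- by [].
- by lia.
Qed.

Lemma ad_E_nilpotent i (x : L) : exists p, iter p (br (E i)) x = 0.
Proof.
elim/(lm_gen): x => [j|j|h|x y [p px] [q qy]|a x [p px]|x y [p px] [q qy]].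
- have [<-|ij] := eqVneq i j; first by exists 1%N; rewrite /= (brxx idR).
  by eexists; exact: serre ij.
- exists 3%N; rewrite /= (br_EF idR); case: eqP => _; last by rewrite !(br0r idR).
  by rewrite [br _ (H _)](brC idR) (br_HE idR) -scaleNr (brZr idR) (brxx idR) scaler0.
- by exists 2%N; rewrite /= [br _ (H _)](brC idR) (br_HE idR) -scaleNr (brZr idR) (brxx idR) scaler0.
- exists (p + q)%N; rewrite iter_brD {1}addnC !iterD px qy.
  by rewrite !iter_br0 addr0.
- by exists p; rewrite iter_brZ px scaler0.
- by exists (p + q)%N; exact: iter_br_leibniz px qy (leqnn _).
Qed.

Lemma not_line (v : rlat) i : ~ (forall k, k != i -> v 0 k = 0) ->
  exists2 k, k != i & v 0 k != 0.
Proof.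
move=> h; apply: contrapT => nk; apply: h => k ki.
by apply: contrapT => /eqP vk; apply: nk; exists k.
Qed.

(** The coefficient at k is left alone, and one positive coefficient decides the sign of a root. *)
Lemma positive_shift (v : rlat) i k a : positive v -> k != i -> v 0 k != 0 ->
  km_root K A (v + a *: alpha i) -> positive (v + a *: alpha i).
Proof.
move=> [_ vp] ki vk /km_root_sign [//|[_ /(_ k)]].
rewrite !mxE (negPf ki) /= mulr0 addr0 oppr_ge0 => vk0.
by move: vk; rewrite (@le_anti _ _ (v 0 k) 0) ?eqxx // vk0 vp.
Qed.

(** After more than v_i steps the weight would be negative at i and still positive at k, so it is
    not a root. *)
Lemma ad_F_nilpotent i v (x : L) : wt v x -> positive v ->
  (exists2 k, k != i & v 0 k != 0) -> exists p, iter p (br (F i)) x = 0.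
Proof.
move=> vx vp [k ki vk]; pose c : int := v 0 i.
exists `|c|%N.+1; apply: contrapT => /eqP y0.
have r : km_root K A (v + (- (`|c|%N.+1)%:Z) *: alpha i).
  apply/km_rootP; split.
    apply: contraNneq vk => /rowP/(_ k); rewrite !mxE (negPf ki) /= mulr0 addr0.
    by move=> ->.
  exists (iter `|c|%N.+1 (br (F i)) x); split=> //.
  rewrite scaleNr -[Posz _]natz scaler_nat.
  exact: wt_iterF.
have [_ /(_ i)] := positive_shift vp ki vk r.
by rewrite !mxE !eqxx mulr1; case: vp => _ /(_ i); rewrite -/c; lia.
Qed.

(** A coefficient of v outside i makes both e_i and f_i locally nilpotent on x; [sl2_string], run in
    the direction given by the sign of the pairing, ends in a nonzero vector of the reflected
    weight. *)
Lemma km_root_refl v i : km_root K A v -> positive v -> v <> alpha i ->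
  km_root K A (refl A i v) /\ positive (refl A i v).
Proof.
move=> rv vp vi; have nl := not_line (fun h => vi (km_root_line rv vp h)).
have [k ki vk] := nl.
suff r : km_root K A (refl A i v).
  by split=> //; move: r; rewrite /refl -scaleNr; exact: positive_shift vp ki vk.
have v0 : refl A i v != 0.
  apply: contraNneq vk => /rowP/(_ k); rewrite !mxE (negPf ki) /= mulr0 subr0.
  by move=> ->.
apply/km_rootP; split=> //; case/km_rootP: rv => _ [x [x0 vx]].
have Hx : br (H (coroot i)) x = (pairing A (alpha i) v)%:~R *: x.
  by rewrite vx weight_coroot.
rewrite /refl; case: (pairing A (alpha i) v) Hx => m Hx.
  have [p px] := ad_E_nilpotent i x.
  have [q yq] := sl2_string (br_linZ (E i)) (br_linZ (F i)) (sl2_EF i) (sl2_HE i) (sl2_HF i) x0 Hx px.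
  exists (iter (m + q) (br (F i)) (iter q (br (E i)) x)); split=> //.
  have -> : v - m%:Z *: alpha i = v + alpha i *+ q - alpha i *+ (m + q).
    by rewrite -[Posz m]natz scaler_nat mulrnDr opprD addrACA subrr addr0.
  exact/wt_iterF/wt_iterE.
have [p px] := ad_F_nilpotent vx vp nl.
have Hmx : Hm i x = m.+1%:R *: x by rewrite /Hm Hx NegzE mulrNz scaleNr opprK.
have [q yq] := sl2_string (br_linZ (F i)) (br_linZ (E i)) (sl2_FE i) (sl2_HmF i) (sl2_HmE i) x0 Hmx px.
exists (iter (m.+1 + q) (br (E i)) (iter q (br (F i)) x)); split=> //.
have -> : v - Negz m *: alpha i = v - alpha i *+ q + alpha i *+ (m.+1 + q).
  rewrite NegzE scaleNr opprK -[Posz m.+1]natz scaler_nat mulrnDr.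
  by rewrite addrACA addNr addr0.
exact/wt_iterE/wt_iterF.
Qed.

Lemma km_root_up v i : km_root K A v -> positive v ->
  pairing A (alpha i) v < 0 -> km_root K A (v + alpha i).
Proof.
move=> rv vp neg; have nl : exists2 k, k != i & v 0 k != 0.
  apply: not_line => h; move: neg; rewrite (km_root_line rv vp h).
  rewrite /pairing /alpha -rowE mxE (bigD1 i) //= big1.
    by case: gcmA => d _ _; rewrite addr0 !mxE d !eqxx mulr1.
  by move=> j /negPf ji; rewrite !mxE ji andbF mulr0.
have [k ki vk] := nl.
have v0 : v + alpha i != 0.
  apply: contraNneq vk => /rowP/(_ k); rewrite !mxE (negPf ki) /= addr0.
  by move=> ->.
apply/km_rootP; split=> //; case/km_rootP: rv => _ [x [x0 vx]].
have Hx : br (H (coroot i)) x = (pairing A (alpha i) v)%:~R *: x.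
  by rewrite vx weight_coroot.
exists (br (E i) x); split; last by rewrite addrC; apply: (wt_br idR) vx; apply: (wt_E idR).
case: (pairing A (alpha i) v) neg Hx => // m _ Hx.
apply/eqP => Ex; have [p px] := ad_F_nilpotent vx vp nl.
(* A vector of negative weight killed by e_i would generate an infinite f_i-string. *)
have it j : iter j (br (F i)) x != 0.
  elim: j => //= j IH; apply: contraNneq IH => fy.
  have := sl2_ef (br_linZ (F i)) (sl2_EF i) (sl2_HF i) j Hx Ex.
  rewrite /= fy (br0r idR) => /esym/eqP; rewrite scaler_eq0 => /orP[|//].
  rewrite mulf_eq0 pnatr_eq0 /= NegzE mulrNz -opprD oppr_eq0 -natrD pnatr_eq0.
  by [].
by have := it p; rewrite px eqxx.
Qed.

End KMRoots.

(** * Semidefinite forms *)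

Definition connected_set (I : finType) (e : rel I) (Y : {set I}) : Prop :=
  forall C : {set I}, C \subset Y -> C != finset.set0 -> C != Y ->
  exists i j, [/\ i \in C, j \in Y, j \notin C & e i j].

Lemma connected_const (I : finType) (e : rel I) (Y : {set I}) (T : eqType) (f : I -> T) :
  connected_set e Y -> (forall i j, i \in Y -> j \in Y -> e i j -> f i = f j) ->
  forall i j, i \in Y -> j \in Y -> f i = f j.
Proof.
move=> cY fe i j iY jY; pose C := [set k in Y | f k == f i]%SET.
have CY : C = Y.
  apply: contrapT => /eqP CY.
  have [||k [l [kC lY lC ekl]]] := cY C _ _ CY.
  - by apply/fintype.subsetP => k; rewrite inE => /andP[].
  - by apply/finset.set0Pn; exists i; rewrite inE iY eqxx.
  move: kC; rewrite inE => /andP[kY /eqP fk]; move: lC; rewrite inE lY /=.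
  by rewrite -fk (fe k l) // eqxx.
by move: jY; rewrite -CY inE => /andP[_ /eqP].
Qed.

Section PSD.

Variables (F : realFieldType) (I : finType) (Y : {set I}).
Variables (a : I -> I -> F) (u : I -> F).
Hypotheses (sym : forall i j, a i j = a j i)
  (off : forall i j, i != j -> a i j <= 0)
  (u0 : forall i, i \in Y -> 0 < u i)
  (null : forall i, i \in Y -> \sum_(j in Y) a i j * u j = 0).

(** Writing z = u y with u in the kernel turns the form into a weighted sum of the squares of y_i -
    y_j. The factor 2 is there because each pair is counted in both orders. *)
Lemma psd_identity (z : I -> F) :
  \sum_(i in Y) \sum_(j in Y) - a i j * u i * u j * (z i / u i - z j / u j) ^+ 2 =
  2 * \sum_(i in Y) \sum_(j in Y) a i j * z i * z j.
Proof.
have half : \sum_(i in Y) \sum_(j in Y) (z i ^+ 2 / u i) * (a i j * u j) = 0.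
  by rewrite big1 // => i iY; rewrite -mulr_sumr null // mulr0.
have half' : \sum_(i in Y) \sum_(j in Y) (z j ^+ 2 / u j) * (a j i * u i) = 0.
  by rewrite exchange_big /= half.
transitivity (2 * (\sum_(i in Y) \sum_(j in Y) a i j * z i * z j) -
    (\sum_(i in Y) \sum_(j in Y) (z i ^+ 2 / u i) * (a i j * u j)) -
    (\sum_(i in Y) \sum_(j in Y) (z j ^+ 2 / u j) * (a j i * u i))); last first.
  by rewrite half half' !subr0.
rewrite [in RHS]mulr_sumr -!sumrB; apply: eq_bigr => i iY.
rewrite [in RHS]mulr_sumr -!sumrB; apply: eq_bigr => j jY.
rewrite (sym j i); have := u0 iY; have := u0 jY => uj ui.
by field; rewrite !gt_eqF.
Qed.

Let term_ge0 z i j : i \in Y -> j \in Y ->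
  0 <= - a i j * u i * u j * (z i / u i - z j / u j) ^+ 2.
Proof.
move=> iY jY; have [->|ij] := eqVneq i j; first by rewrite subrr expr0n mulr0.
rewrite mulr_ge0 ?sqr_ge0 // mulr_ge0 ?(ltW (u0 jY)) // mulr_ge0 ?(ltW (u0 iY)) //.
by rewrite oppr_ge0 off.
Qed.

Lemma psd_ge0 (z : I -> F) : 0 <= \sum_(i in Y) \sum_(j in Y) a i j * z i * z j.
Proof.
rewrite -(pmulr_rge0 _ (ltr0Sn F 1)) -psd_identity.
by do 2![apply: sumr_ge0 => ? ?]; apply: term_ge0.
Qed.

Lemma psd_eq0 (z : I -> F) : connected_set (fun i j => a i j != 0) Y ->
  \sum_(i in Y) \sum_(j in Y) a i j * z i * z j = 0 ->
  forall i j, i \in Y -> j \in Y -> z i * u j = z j * u i.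
Proof.
move=> cY q0 i j iY jY.
suff h : z i / u i = z j / u j.
  have ui := u0 iY; have uj := u0 jY.
  by apply/eqP; rewrite -eqr_div ?(gt_eqF ui) ?(gt_eqF uj) // h.
apply: (connected_const (f := fun k => z k / u k) cY) iY jY => {}i {}j iY jY aij.
have := psd_identity z; rewrite q0 mulr0 => /eqP.
rewrite psumr_eq0; last by move=> k kY; apply: sumr_ge0 => l lY; apply: term_ge0.
move/allP/(_ i (mem_index_enum _)); rewrite iY /= psumr_eq0; last first.
  by move=> l lY; apply: term_ge0.
move/allP/(_ j (mem_index_enum _)); rewrite jY /= mulf_eq0 sqrf_eq0 subr_eq0.
by rewrite !mulf_eq0 oppr_eq0 (negPf aij) (gt_eqF (u0 iY)) (gt_eqF (u0 jY)) /= => /eqP.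
Qed.

End PSD.

(** * The Weyl group on the root lattice *)

Section Lattice.

Variables (n : nat) (X : 'M[int]_n).
Hypotheses (gcmX : gcm X) (slX : simply_laced X).
Local Notation rlat := 'rV[int]_n.
Local Notation B := (pairing X).
Local Notation alpha := (@alpha n).
Implicit Types (u v b c : rlat) (i j : 'I_n) (w : seq 'I_n).

Lemma diagX i : X i i = 2. Proof. by case: gcmX. Qed.
Lemma offX i j : i != j -> X i j <= 0. Proof. by case: gcmX => _ h _; apply: h. Qed.
Lemma symX i j : X i j = X j i.
Proof. by rewrite -{1}slX mxE. Qed.

Lemma coefD u v i : (u + v) 0 i = u 0 i + v 0 i. Proof. by rewrite mxE. Qed.
Lemma coefN v i : (- v) 0 i = - v 0 i. Proof. by rewrite mxE. Qed.
Lemma coefB u v i : (u - v) 0 i = u 0 i - v 0 i. Proof. by rewrite !mxE. Qed.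
Lemma coefZ a v i : (a *: v) 0 i = a * v 0 i. Proof. by rewrite mxE. Qed.
Lemma coef0 i : (0 : rlat) 0 i = 0. Proof. by rewrite mxE. Qed.

Lemma pairDl u u' v : B (u + u') v = B u v + B u' v.
Proof. by rewrite /pairing !mulmxDl mxE. Qed.
Lemma pairDr u v v' : B u (v + v') = B u v + B u v'.
Proof. by rewrite /pairing linearD /= mulmxDr mxE. Qed.
Lemma pairZl a u v : B (a *: u) v = a * B u v.
Proof. by rewrite /pairing -!scalemxAl mxE. Qed.
Lemma pairZr a u v : B u (a *: v) = a * B u v.
Proof. by rewrite /pairing linearZ /= -scalemxAr mxE. Qed.
Lemma pairNl u v : B (- u) v = - B u v.
Proof. by rewrite -scaleN1r pairZl mulN1r. Qed.
Lemma pairNr u v : B u (- v) = - B u v.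
Proof. by rewrite -scaleN1r pairZr mulN1r. Qed.
Lemma pairBl u u' v : B (u - u') v = B u v - B u' v.
Proof. by rewrite pairDl pairNl. Qed.
Lemma pairBr u v v' : B u (v - v') = B u v - B u v'.
Proof. by rewrite pairDr pairNr. Qed.
Lemma pair0l v : B 0 v = 0. Proof. by rewrite -(scale0r 0) pairZl mul0r. Qed.
Lemma pair0r v : B v 0 = 0. Proof. by rewrite -(scale0r 0) pairZr mul0r. Qed.

Lemma pairC u v : B u v = B v u.
Proof.
rewrite /pairing -[u *m X *m v^T]trmxK mxE !trmx_mul trmxK slX.
by rewrite mulmxA.
Qed.

Definition pairE := (pairDl, pairDr, pairNl, pairNr, pairZl, pairZr).

Lemma pair_alpha i v : B (alpha i) v = \sum_j X i j * v 0 j.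
Proof.
by rewrite /pairing /Defs.alpha -rowE mxE; apply: eq_bigr => j _; rewrite !mxE.
Qed.

Lemma alphaE i j : alpha i 0 j = (j == i)%:R. Proof. by rewrite mxE eqxx. Qed.

Lemma sum_alpha v : v = \sum_i v 0 i *: alpha i.
Proof. exact: row_sum_delta. Qed.

Lemma pair_coef u v : B u v = \sum_i u 0 i * B (alpha i) v.
Proof.
rewrite {1}(sum_alpha u) (big_morph (fun x => B x v) (fun x y => pairDl x y v) (pair0l v)).
by apply: eq_bigr => i _; rewrite pairZl.
Qed.

Lemma pair_alpha2 i j : B (alpha i) (alpha j) = X i j.
Proof.
rewrite pair_alpha (bigD1 j) //= alphaE eqxx mulr1 big1 ?addr0 // => k /negPf kj.
by rewrite alphaE kj mulr0.
Qed.

Lemma norm_alpha i : B (alpha i) (alpha i) = 2.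
Proof. by rewrite pair_alpha2 diagX. Qed.

Lemma norm_even v : exists k : int, B v v = 2 * k.
Proof.
rewrite {1 2}(sum_alpha v).
apply: (big_ind (fun x => exists k : int, B x x = 2 * k)).
- by exists 0; rewrite pair0l.
- move=> x y [k hk] [l hl]; exists (k + l + B x y).
  by rewrite !pairE (pairC y x) hk hl; ring.
- by move=> i _; exists (v 0 i * v 0 i); rewrite !pairE norm_alpha; ring.
Qed.

Local Notation s i := (refl X i).

Lemma reflD i u v : s i (u + v) = s i u + s i v.
Proof. by rewrite /refl pairDr scalerDl opprD addrACA. Qed.
Lemma reflZ i a v : s i (a *: v) = a *: s i v.
Proof. by rewrite /refl pairZr scalerBr scalerA. Qed.
Lemma refl_pair i u v : B (s i u) (s i v) = B u v.
Proof.
rewrite /refl !(pairBl, pairBr, pairZl, pairZr) norm_alpha (pairC u (alpha i)); ring.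
Qed.
Lemma reflK i : involutive (s i).
Proof.
move=> v; have e : B (alpha i) (s i v) = - B (alpha i) v.
  by rewrite /refl pairBr pairZr norm_alpha; ring.
by rewrite {1}/refl e scaleNr opprK /refl subrK.
Qed.
Lemma refl_alpha i : s i (alpha i) = - alpha i.
Proof.
by rewrite /refl norm_alpha -{1}[alpha i]scale1r -scalerBl -[in RHS]scaleN1r.
Qed.
Lemma reflE i v j : s i v 0 j = v 0 j - B (alpha i) v * (j == i)%:R.
Proof. by rewrite !mxE eqxx. Qed.
Lemma reflE_neq i v j : j != i -> s i v 0 j = v 0 j.
Proof. by move=> /negPf ji; rewrite reflE ji mulr0 subr0. Qed.

Local Notation W := (weyl X).

Lemma weylD w u v : W w (u + v) = W w u + W w v.
Proof. by elim: w => //= i w ->; rewrite reflD. Qed.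
Lemma weylZ w a v : W w (a *: v) = a *: W w v.
Proof. by elim: w => //= i w ->; rewrite reflZ. Qed.
Lemma weylN w v : W w (- v) = - W w v.
Proof. by rewrite -scaleN1r weylZ scaleN1r. Qed.
Lemma weylB w u v : W w (u - v) = W w u - W w v.
Proof. by rewrite weylD weylN. Qed.
Lemma weyl_pair w u v : B (W w u) (W w v) = B u v.
Proof. by elim: w => //= i w IH; rewrite refl_pair. Qed.
Lemma weyl_cat w1 w2 v : W (w1 ++ w2) v = W w1 (W w2 v).
Proof. exact: foldr_cat. Qed.
Lemma weyl_rcons w i v : W (rcons w i) v = W w (s i v).
Proof. by rewrite -cats1 weyl_cat. Qed.
Lemma weylK w : cancel (W w) (W (rev w)).
Proof.
by elim: w => // i w IH v; rewrite rev_cons weyl_rcons /= reflK.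
Qed.
Lemma weylKr w : cancel (W (rev w)) (W w).
Proof. by move=> v; rewrite -{1}[w]revK weylK. Qed.

Lemma real_norm b : real_root X b -> B b b = 2.
Proof. by case=> w [i ->]; rewrite weyl_pair norm_alpha. Qed.
Lemma real_weyl w b : real_root X b -> real_root X (W w b).
Proof. by case=> w' [i ->]; exists (w ++ w'), i; rewrite weyl_cat. Qed.
Lemma real_alpha i : real_root X (alpha i). Proof. by exists [::], i. Qed.
Lemma realN b : real_root X b -> real_root X (- b).
Proof.
case=> w [i ->]; exists (rcons w i), i; by rewrite weyl_rcons refl_alpha weylN.
Qed.

Lemma weyl_refl w i v : W w (s i (W (rev w) v)) = v - B (W w (alpha i)) v *: W w (alpha i).
Proof.
rewrite /refl weylB weylKr weylZ; congr (_ - _ *: _).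
by rewrite -(weyl_pair w) weylKr.
Qed.

Lemma real_reflect b c : real_root X b -> real_root X c -> real_root X (c - B b c *: b).
Proof.
case=> w [i ->] /(real_weyl (w ++ i :: rev w)).
by rewrite weyl_cat /= weyl_refl.
Qed.

Lemma coroot_root_eq b bv : is_coroot X b bv -> bv = b.
Proof.
case=> w [i [-> ->]]; elim: w => //= j w ->.
by rewrite /corefl /refl pairC.
Qed.

Lemma real_is_coroot b : real_root X b -> is_coroot X b b.
Proof.
case=> w [i ->]; exists w, i; split=> //; elim: w => //= j w <-.
by rewrite /corefl /refl pairC.
Qed.

Lemma height_alpha i : height (alpha i) = 1.
Proof.
rewrite /height (bigD1 i) //= alphaE eqxx big1 ?addr0 // => j /negPf ji.
by rewrite alphaE ji.
Qed.

Lemma heightD u v : height (u + v) = height u + height v.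
Proof. by rewrite /height -big_split; apply: eq_bigr => i _; rewrite mxE. Qed.
Lemma heightZ a v : height (a *: v) = a * height v.
Proof. by rewrite /height mulr_sumr; apply: eq_bigr => i _; rewrite mxE. Qed.
Lemma heightN v : height (- v) = - height v.
Proof. by rewrite -scaleN1r heightZ mulN1r. Qed.
Lemma height_refl i v : height (s i v) = height v - B (alpha i) v.
Proof. by rewrite /refl heightD heightN heightZ height_alpha mulr1. Qed.

Lemma coef_le_height v i : (forall j, 0 <= v 0 j) -> v 0 i <= height v.
Proof.
move=> h; rewrite /height (bigD1 i) //= lerDl; exact: sumr_ge0.
Qed.

Definition coherent v := positive v \/ positive (- v).

Lemma positive_neq v : positive v -> exists i, 0 < v 0 i.
Proof.
case=> v0 vp; apply/existsP; apply: contraNT v0 => /existsPn h.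
by apply/eqP/rowP => i; apply/eqP; rewrite mxE eq_le vp andbT leNgt h.
Qed.

Lemma positive_notN v : positive v -> ~ positive (- v).
Proof.
move=> /positive_neq[i vi] [_ /(_ i)]; rewrite coefN; lia.
Qed.

Lemma coherent_pos v i : coherent v -> 0 < v 0 i -> positive v.
Proof. by case=> // -[_ /(_ i)]; rewrite coefN; lia. Qed.

Lemma coherent_mixed v i j : coherent v -> 0 < v 0 i -> v 0 j < 0 -> False.
Proof. by case=> -[_ h]; [have := h j|have := h i]; rewrite ?coefN; lia. Qed.

Lemma pos_alpha i : positive (alpha i).
Proof.
by split; [exact: alpha_neq0|move=> j; rewrite alphaE; case: (_ == _)].
Qed.

(** Letter by letter, a reflection keeps a positive root of g(X) positive, except that s_i negates
    alpha_i. The field [rat] disappears in [real_coherent]. *)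
Lemma real_km b : real_root X b ->
  (km_root rat X b /\ positive b) \/ (km_root rat X (- b) /\ positive (- b)).
Proof.
have step i c : km_root rat X c /\ positive c ->
    (km_root rat X (s i c) /\ positive (s i c)) \/
    (km_root rat X (- s i c) /\ positive (- s i c)).
  case=> kc pc; have [->|ci] := eqVneq c (alpha i).
    right; rewrite refl_alpha opprK; split; [exact: km_root_alpha|exact: pos_alpha].
  by left; apply: km_root_refl => //; apply/eqP.
case=> w [i ->]; elim: w => [|j w [h|h]] /=.
- by left; split; [exact: km_root_alpha|exact: pos_alpha].
- exact: step.
- have := step j _ h; rewrite -scaleN1r reflZ !scaleN1r opprK.
  by case; [right|left].
Qed.

Lemma real_coherent b : real_root X b -> coherent b.
Proof. by case/real_km=> -[_ h]; [left|right]. Qed.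

Lemma real_pos_refl b i : real_root X b -> positive b -> b != alpha i -> positive (s i b).
Proof.
move=> rb pb bi; case: (real_km rb) => -[kb pb']; last by have := positive_notN pb.
by apply: (km_root_refl gcmX kb pb _).2; apply/eqP.
Qed.

Lemma pos_norm_exists b : positive b -> 0 < B b b -> exists2 i, 0 < b 0 i & 0 < B (alpha i) b.
Proof.
move=> [_ pb]; rewrite pair_coef => h; apply: contrapT => ne; move: h.
apply/negP; rewrite -leNgt; apply: sumr_le0 => i _.
have [->|bi] := eqVneq (b 0 i) 0; first by rewrite mul0r.
have b0 : 0 < b 0 i by rewrite lt_neqAle eq_sym bi pb.
rewrite pmulr_rle0 // leNgt; apply/negP => h; apply: ne; by exists i.
Qed.

Lemma height_pos b : positive b -> 0 < height b.
Proof.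
move=> pb; have [i bi] := positive_neq pb.
by apply: lt_le_trans bi (coef_le_height _ _); case: pb.
Qed.

(** Induction on the height: reflecting in an i with (alpha_i | b) > 0 changes the support at most
    by removing i. *)
Lemma real_support_connected (C : {set 'I_n}) b : real_root X b -> positive b ->
    (forall i j, b 0 i != 0 -> b 0 j != 0 -> i \in C -> j \notin C -> X i j = 0) ->
  (forall i, b 0 i != 0 -> i \in C) \/ (forall i, b 0 i != 0 -> i \notin C).
Proof.
move: {2}(`|height b|%N) (leqnn `|height b|%N) => N.
elim: N b => [|N IH] b bN rb pb hC.
  have := height_pos pb; lia.
have [i bi Bi] : exists2 i, 0 < b 0 i & 0 < B (alpha i) b.
  by apply: pos_norm_exists; rewrite ?real_norm.
have [->|bni] := eqVneq b (alpha i).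
  have e j : alpha i 0 j != 0 -> j = i.
    by rewrite alphaE => h; apply/eqP; apply: contraNT h => /negPf ->.
  by case iC: (i \in C); [left|right] => j /e ->; rewrite ?iC.
have ps := real_pos_refl rb pb bni.
have sub j : s i b 0 j != 0 -> b 0 j != 0.
  by have [->|ji] := eqVneq j i; [rewrite (gt_eqF bi)|rewrite reflE_neq].
have hs : B (alpha i) (s i b) = - B (alpha i) b.
  by rewrite -{1}(reflK i (alpha i)) (refl_pair i (s i (alpha i)) b) refl_alpha pairNl.
have {}IH : (forall i0, s i b 0 i0 != 0 -> i0 \in C) \/
   (forall i0, s i b 0 i0 != 0 -> i0 \notin C).
  apply: IH => //.
  - by rewrite height_refl; have := height_pos ps; rewrite height_refl; lia.
  - exact: (real_weyl [:: i]).
  - by move=> j k /sub bj /sub bk; apply: hC.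
have bi0 : b 0 i != 0 by rewrite gt_eqF.
(* If i lay on the other side of C than the support of s_i b, it would have no neighbour there and
   be orthogonal to s_i b, against [hs]. *)
have key : (forall j, s i b 0 j != 0 -> X i j = 0) -> False.
  move=> h; move: hs; rewrite pair_alpha big1; first lia.
  move=> j _; have [->|/h ->] := eqVneq (s i b 0 j) 0; by rewrite ?mulr0 ?mul0r.
case: IH => h; [left|right] => j bj.
- have [ji|ji] := eqVneq j i; last by apply: h; rewrite reflE_neq.
  rewrite ji; apply: contrapT => /negP iC; apply: key => k sk.
  by rewrite symX; apply: hC => //; [exact: sub|exact: h].
- have [ji|ji] := eqVneq j i; last by apply: h; rewrite reflE_neq.
  rewrite ji; apply/negP => iC; apply: key => k sk.
  by apply: hC => //; [exact: sub|exact: h].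
Qed.

(* If w alpha_i < 0, the root alpha_i changes sign at some letter j of w, where
   it has become alpha_j; deleting that letter has the same effect as appending i. *)
Lemma weyl_exchange w i : positive (- W w (alpha i)) ->
  exists2 w', (size w' < size w)%N & forall v, W (rcons w i) v = W w' v.
Proof.
elim: w => [/(positive_notN (pos_alpha i)) []|j w IH] /= neg.
case: (real_coherent (real_weyl w (real_alpha i))) => [pos|/IH [w' sw' e]]; last first.
  by exists (j :: w') => // v /=; rewrite e.
have e : W w (alpha i) = alpha j.
  apply: contrapT => /eqP ne.
  have := real_pos_refl (real_weyl w (real_alpha i)) pos ne.
  by move/positive_notN.
exists w => // v; rewrite weyl_rcons -{1}(weylK w v) weyl_refl e.
by rewrite -/(s j _) reflK.
Qed.

Definition antidominant v := forall i, B (alpha i) v <= 0.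

(** Induction on the length through the last letter i of the word w i. If w alpha_i > 0, this letter
    adds the nonnegative vector -(alpha_i | v) w alpha_i; otherwise [weyl_exchange] shortens the
    word. In the second claim this addition must vanish, so w stabilizes v and s_i does not touch
    the coefficient at j. *)
Lemma antidominant_weyl w v : antidominant v ->
  (forall j, v 0 j <= W w v 0 j) /\
  (W w v = v -> forall u j, B (alpha j) v != 0 -> W w u 0 j = u 0 j).
Proof.
move=> av; move: {2}(size w) (leqnn (size w)) => N.
elim: N w => [|N IH] w wN; first by move: wN; rewrite leqn0 => /nilP ->.
case/lastP: w wN => [//|w i]; rewrite size_rcons ltnS => wN.
case: (real_coherent (real_weyl w (real_alpha i))) => [pos|neg]; last first.
  have [w' sw' e] := weyl_exchange neg.
  have [h1 h2] := IH w' (ltnW (leq_trans sw' wN)).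
  split; first by move=> j; rewrite e.
  by rewrite e => /h2 h u j; rewrite e; apply: h.
have [h1 h2] := IH w wN.
have c0 := av i; have [_ wp] := pos.
have we : W (rcons w i) v = W w v - B (alpha i) v *: W w (alpha i).
  by rewrite weyl_rcons /refl weylB weylZ.
split=> [j|e u j vj].
  by rewrite we coefB coefZ; have := h1 j; have := wp j; nia.
have [k wk] := positive_neq pos.
have key j' : W w v 0 j' = v 0 j' /\ B (alpha i) v * W w (alpha i) 0 j' = 0.
  have := congr1 (fun x : rlat => x 0 j') e; rewrite /= we coefB coefZ.
  by have := h1 j'; have := wp j'; nia.
have ci : B (alpha i) v = 0 by have [_] := key k; nia.
have wv : W w v = v by apply/rowP => j'; have [] := key j'.
have ji : j != i by apply: contraNneq vj => ->; rewrite ci.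
by rewrite weyl_rcons h2 // reflE_neq.
Qed.

Lemma antidominant_unique w u v : antidominant u -> antidominant v -> W w u = v -> u = v.
Proof.
move=> au av e; apply/rowP => i; apply/eqP; rewrite eq_le.
have [h1 _] := antidominant_weyl w au; have [h2 _] := antidominant_weyl (rev w) av.
by have := h1 i; have := h2 i; rewrite -e weylK e => -> ->.
Qed.

Implicit Types (d z : rlat).
(** * Affine subdiagrams *)

Definition supp v : {set 'I_n} := [set i | v 0 i != 0]%SET.
Definition adj : rel 'I_n := fun i j => X i j != 0.

Lemma suppP v i : (i \in supp v) = (v 0 i != 0). Proof. by rewrite inE. Qed.

Lemma supp_sub u v i : supp u \subset supp v -> v 0 i = 0 -> u 0 i = 0.
Proof.
move=> /fintype.subsetP h vi; apply: contrapT => /eqP ui.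
by have := h i; rewrite !suppP vi eqxx => /(_ ui).
Qed.

(** Criterion for the support of d to be an affine diagram: a positive vector in the kernel, and
    connectedness. Primitivity of d is separate; it comes from a functional with value -1 on d. *)
Definition affine_null d :=
  [/\ forall i, 0 <= d 0 i, forall i, i \in supp d -> B (alpha i) d = 0
    & connected_set adj (supp d)].

Section Affine.

Variable d : rlat.
Hypothesis affd : affine_null d.

Let d_ge0 i : 0 <= d 0 i. Proof. by case: affd. Qed.
Let d_null i : i \in supp d -> B (alpha i) d = 0. Proof. by case: affd => _ h _; apply: h. Qed.
Let d_gt0 i : i \in supp d -> 0 < d 0 i.
Proof. by rewrite suppP lt_neqAle eq_sym d_ge0 andbT. Qed.

Lemma pair_supp u v (Y : {set 'I_n}) : supp u \subset Y -> supp v \subset Y ->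
  B u v = \sum_(i in Y) \sum_(j in Y) X i j * u 0 i * v 0 j.
Proof.
move=> /fintype.subsetP uY /fintype.subsetP vY; rewrite pair_coef [RHS]big_mkcond; apply: eq_bigr => i _.
case: ifPn => [iY|iY]; last first.
  have : i \notin supp u by apply: contraNN iY; apply: uY.
  by rewrite suppP negbK => /eqP ->; rewrite mul0r.
rewrite pair_alpha mulr_sumr [RHS]big_mkcond; apply: eq_bigr => j _.
case: ifPn => [jY|jY]; first by ring.
have : j \notin supp v by apply: contraNN jY; apply: vY.
by rewrite suppP negbK => /eqP ->; rewrite !mulr0.
Qed.

Let a (i j : 'I_n) : rat := (X i j)%:~R.
Let ud (i : 'I_n) : rat := (d 0 i)%:~R.

Let a_sym i j : a i j = a j i. Proof. by rewrite /a (symX i j). Qed.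
Let a_off i j : i != j -> a i j <= 0. Proof. by move=> /offX; rewrite /a lerz0. Qed.
Let ud_gt0 i : i \in supp d -> 0 < ud i. Proof. by move=> /d_gt0; rewrite /ud ltr0z. Qed.
Let ud_null i : i \in supp d -> \sum_(j in supp d) a i j * ud j = 0.
Proof.
move=> id; transitivity ((\sum_j X i j * d 0 j)%:~R : rat); last first.
  by rewrite -pair_alpha d_null.
rewrite rmorph_sum /= [LHS]big_mkcond; apply: eq_bigr => j _.
by rewrite rmorphM /= suppP; case: eqP => //= ->; rewrite mulr0.
Qed.

Lemma affine_form z : supp z \subset supp d -> (B z z)%:~R =
  \sum_(i in supp d) \sum_(j in supp d) a i j * (z 0 i)%:~R * (z 0 j)%:~R.
Proof.
move=> zd; rewrite (pair_supp zd zd) rmorph_sum /=; apply: eq_bigr => i _.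
by rewrite rmorph_sum; apply: eq_bigr => j _; rewrite !rmorphM.
Qed.

Lemma affine_ge0 z : supp z \subset supp d -> 0 <= B z z.
Proof.
move=> zd; rewrite -(ler0z rat) affine_form //.
exact: (psd_ge0 a_sym a_off ud_gt0 ud_null).
Qed.

Lemma affine_eq0 z : supp z \subset supp d -> B z z = 0 ->
  forall i j, z 0 i * d 0 j = z 0 j * d 0 i.
Proof.
move=> zd z0 i j.
have [id|] := boolP (i \in supp d); last first.
  by rewrite suppP negbK => /eqP di; rewrite di (supp_sub zd di) mul0r mulr0.
have [jd|] := boolP (j \in supp d); last first.
  by rewrite suppP negbK => /eqP dj; rewrite dj (supp_sub zd dj) mul0r mulr0.
apply: (@intr_inj rat); rewrite !rmorphM /=.
apply: (psd_eq0 (z := fun k => (z 0 k)%:~R) a_sym a_off ud_gt0 ud_null) => //.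
  case: affd => _ _; move=> h C C1 C2 C3; have [k [l [? ? ? kl]]] := h C C1 C2 C3.
  by exists k, l; split=> //; rewrite /a intr_eq0.
by rewrite -affine_form // z0.
Qed.

Lemma affine_proper_eq0 z i : supp z \subset supp d -> B z z = 0 ->
  i \in supp d -> z 0 i = 0 -> z = 0.
Proof.
move=> zd z0 id zi; apply/rowP => j; have := affine_eq0 zd z0 i j.
by rewrite zi mul0r coef0 => /esym/eqP; rewrite mulf_eq0 (gt_eqF (d_gt0 id)) orbF => /eqP.
Qed.

(** Applying the functional c to the proportion z_i d_j = z_j d_i in the variable j computes the
    factor, which is thus an integer. The value -1 is that of the row of an overextending vertex. *)
Lemma affine_primitive_fun z (c : 'I_n -> int) : \sum_j c j * d 0 j = -1 ->
  supp z \subset supp d -> B z z = 0 -> z = - (\sum_j c j * z 0 j) *: d.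
Proof.
move=> dc zd z0; apply/rowP => i; rewrite coefZ.
have : \sum_j c j * (z 0 i * d 0 j) = \sum_j c j * (z 0 j * d 0 i).
  by apply: eq_bigr => j _; rewrite (affine_eq0 zd z0 i j).
rewrite (eq_bigr (fun j => (c j * d 0 j) * z 0 i)) => [|j _]; last by ring.
rewrite [RHS](eq_bigr (fun j => (c j * z 0 j) * d 0 i)) => [|j _]; last by ring.
by rewrite -!mulr_suml dc mulN1r mulNr => <-; rewrite opprK.
Qed.

Lemma affine_primitive z p : B (alpha p) d = -1 -> supp z \subset supp d -> B z z = 0 ->
  z = - B (alpha p) z *: d.
Proof. by rewrite !pair_alpha; apply: affine_primitive_fun. Qed.

Lemma suppN v : supp (- v) = supp v.
Proof. by apply/setP => i; rewrite !suppP coefN oppr_eq0. Qed.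

Lemma suppD u v (Y : {set 'I_n}) : supp u \subset Y -> supp v \subset Y -> supp (u + v) \subset Y.
Proof.
move=> /fintype.subsetP uY /fintype.subsetP vY; apply/fintype.subsetP => i; rewrite suppP coefD => h.
have [ui|/negbTE ui] := boolP (i \in supp u); first exact: uY.
have [vi|/negbTE vi] := boolP (i \in supp v); first exact: vY.
by move: ui vi h; rewrite !suppP => /negbFE/eqP -> /negbFE/eqP ->; rewrite addr0 eqxx.
Qed.

Lemma suppB u v (Y : {set 'I_n}) : supp u \subset Y -> supp v \subset Y -> supp (u - v) \subset Y.
Proof. by move=> hu hv; apply: suppD; rewrite ?suppN. Qed.

Lemma suppZ a0 u (Y : {set 'I_n}) : supp u \subset Y -> supp (a0 *: u) \subset Y.
Proof.
move=> /fintype.subsetP uY; apply/fintype.subsetP => i; rewrite suppP coefZ mulf_eq0 negb_or.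
by case/andP=> _ ui; apply: uY; rewrite suppP.
Qed.

Lemma supp_alpha i : supp (alpha i) = [set i]%SET.
Proof. by apply/setP => j; rewrite suppP alphaE inE; case: (j == i). Qed.

Lemma supp_refl i v (Y : {set 'I_n}) : i \in Y -> supp v \subset Y -> supp (s i v) \subset Y.
Proof. by move=> iY vY; apply: suppB => //; apply: suppZ; rewrite supp_alpha finset.sub1set. Qed.

(** Split z into its positive part and its negative part. Their product is at most 0, so their norms
    sum to at most 2. If both are nonzero, each misses a vertex of supp d, so its norm is positive
    and even, and the sum is at least 4. *)
Lemma affine_norm2_coherent z : supp z \subset supp d -> B z z = 2 -> coherent z.
Proof.
move=> zd z2.
have z_neq0 : z != 0 by apply: contra_eqN z2 => /eqP ->; rewrite pair0l.
pose zp : rlat := \row_i Num.max (z 0 i) 0; pose zm : rlat := \row_i Num.max (- z 0 i) 0.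
have zpE i : zp 0 i = Num.max (z 0 i) 0 by rewrite mxE.
have zmE i : zm 0 i = Num.max (- z 0 i) 0 by rewrite mxE.
have zE : z = zp - zm by apply/rowP => i; rewrite coefB zpE zmE; lia.
have zpd : supp zp \subset supp d.
  apply: fintype.subset_trans zd; apply/fintype.subsetP => i; rewrite !suppP zpE; lia.
have zmd : supp zm \subset supp d.
  apply: fintype.subset_trans zd; apply/fintype.subsetP => i; rewrite !suppP zmE; lia.
have le0 : B zp zm <= 0.
  rewrite (pair_supp zpd zmd); apply: sumr_le0 => i _; apply: sumr_le0 => j _.
  have [<-|/offX ij] := eqVneq i j.
    have [->|->] : zp 0 i = 0 \/ zm 0 i = 0; last by rewrite mulr0.
      by rewrite zpE zmE; lia.
    by rewrite mulr0 mul0r.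
  have zi : 0 <= zp 0 i by rewrite zpE; lia.
  have zj : 0 <= zm 0 j by rewrite zmE; lia.
  by rewrite -mulrA; apply: mulr_le0_ge0 => //; apply: mulr_ge0.
have [k1 e1] := norm_even zp; have [k2 e2] := norm_even zm.
have g1 := affine_ge0 zpd; have g2 := affine_ge0 zmd.
have sum2 : B zp zp + B zm zm <= 2.
  move: z2; rewrite {1 2}zE !(pairBl, pairBr) (pairC zm zp); lia.
have [p0|p0] := eqVneq zp 0.
  right; split; first by rewrite oppr_eq0.
  by move=> i; rewrite coefN; have := congr1 (fun v : rlat => v 0 i) p0; rewrite zpE coef0; lia.
have [m0|m0] := eqVneq zm 0.
  left; split=> // i; have := congr1 (fun v : rlat => v 0 i) m0; rewrite zmE coef0; lia.
have [i zi] : exists i, zp 0 i != 0.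
  apply/existsP; apply: contraNT p0 => /existsPn h; apply/eqP/rowP => i.
  by have := h i; rewrite negbK coef0 => /eqP.
have [j zj] : exists j, zm 0 j != 0.
  apply/existsP; apply: contraNT m0 => /existsPn h; apply/eqP/rowP => j.
  by have := h j; rewrite negbK coef0 => /eqP.
have zpj : zp 0 j = 0 by move: zj; rewrite zmE zpE; lia.
have zmi : zm 0 i = 0 by move: zi; rewrite zmE zpE; lia.
have p1 : B zp zp != 0.
  apply: contraNneq p0 => h; apply/eqP/(affine_proper_eq0 zpd h _ zpj).
  by apply: (fintype.subsetP zmd); rewrite suppP.
have m1 : B zm zm != 0.
  apply: contraNneq m0 => h; apply/eqP/(affine_proper_eq0 zmd h _ zmi).
  by apply: (fintype.subsetP zpd); rewrite suppP.
by lia.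
Qed.

End Affine.

(** * Antidominant and isotropic vectors *)

Lemma affine_antidominant d : affine_null d -> antidominant d.
Proof.
move=> [dge dn _] i; have [/dn -> //|] := boolP (i \in supp d).
rewrite suppP negbK => /eqP di; rewrite pair_alpha; apply: sumr_le0 => j _.
have [<-|ij] := eqVneq i j; first by rewrite di mulr0.
by apply: mulr_le0_ge0; [exact: offX|exact: dge].
Qed.

(* The reflections in b1 and b2 generate an infinite dihedral group, which moves
   b1 along the line b1 + 2 Z (b1 + b2). *)
Lemma isotropic_line b1 b2 (k : nat) : real_root X b1 -> real_root X b2 ->
  B b1 b2 = -2 -> real_root X (b1 + (2 * k%:Z) *: (b1 + b2)).
Proof.
move=> r1 r2 b12; have n1 := real_norm r1; have n2 := real_norm r2.
elim: k => [|k IH]; first by rewrite mulr0 scale0r addr0.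
have := real_reflect r1 (real_reflect r2 IH); congr real_root.
apply/rowP => i; rewrite !(coefD, coefN, coefZ, pairE) (pairC b2 b1) b12 n1 n2.
by rewrite (intS k); ring.
Qed.

(** If d had coefficients of both signs, so would the real roots b1 + 2k d for large k. *)
Lemma isotropic_coherent b1 b2 : real_root X b1 -> real_root X b2 ->
  B b1 b2 = -2 -> b1 + b2 != 0 -> coherent (b1 + b2).
Proof.
move=> r1 r2 b12; set d := b1 + b2 => d0.
have [/existsP[i di]|/existsPn hi] := boolP [exists i, 0 < d 0 i]; last first.
  right; split; first by rewrite oppr_eq0.
  by move=> i; rewrite coefN oppr_ge0 leNgt; apply: hi.
left; split=> // j; rewrite leNgt; apply/negP => dj.
have [k ki kj] : exists2 k : nat, - b1 0 i < k%:Z & b1 0 j < k%:Z.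
  move: (b1 0 i) (b1 0 j) => x y; exists (`|x| + `|y| + 1)%N; lia.
have := real_coherent (isotropic_line k r1 r2 b12).
move=> /(coherent_mixed (i := i) (j := j)); apply; rewrite -/d coefD coefZ -mulrA.
  have : k%:Z <= k%:Z * d 0 i by rewrite ler_peMr //; lia.
  by move: (_ * d 0 i) => z; lia.
have : k%:Z * d 0 j <= - k%:Z by rewrite -mulrN1 ler_wpM2l //; lia.
by move: (_ * d 0 j) => z; lia.
Qed.

(** Reflections with (alpha_i | d) > 0 lower the height. They cannot make d negative, since d would
    then be a multiple of alpha_i and not isotropic. The induction carries b1 and b2 because the
    sign of d is known only through them. *)
Lemma antidominant_conj b1 b2 : real_root X b1 -> real_root X b2 ->
  B b1 b2 = -2 -> positive (b1 + b2) ->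
  exists w, positive (W w (b1 + b2)) /\ antidominant (W w (b1 + b2)).
Proof.
move: {2}(`|height (b1 + b2)|%N) (leqnn `|height (b1 + b2)|%N) => N.
elim: N b1 b2 => [|N IH] b1 b2 hN r1 r2 b12 pd; have hd := height_pos pd; first lia.
have dd : B (b1 + b2) (b1 + b2) = 0.
  by rewrite !pairE (pairC b2) b12 !real_norm.
have [/existsP[i di]|/existsPn h] := boolP [exists i, 0 < B (alpha i) (b1 + b2)]; last first.
  by exists [::]; split=> // i; rewrite leNgt; apply: h.
have ps : positive (s i (b1 + b2)).
  have c : coherent (s i (b1 + b2)).
    rewrite reflD; apply: isotropic_coherent.
    - exact: (real_weyl [:: i]).
    - exact: (real_weyl [:: i]).
    - by rewrite refl_pair.
    - rewrite -reflD; apply: contraTneq di => e.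
      by rewrite -(refl_pair i) e pair0r.
  case: c => // neg; exfalso.
  have e j : j != i -> (b1 + b2) 0 j = 0.
    move=> ji; have := neg.2 j; rewrite coefN reflE_neq // oppr_ge0 => le.
    by apply/eqP; rewrite eq_le le pd.2.
  have de : b1 + b2 = (b1 + b2) 0 i *: alpha i.
    apply/rowP => j; rewrite coefZ alphaE; have [->|/e ->] := eqVneq j i.
      by rewrite mulr1.
    by rewrite mulr0.
  move: dd di; rewrite de !pairE norm_alpha; nia.
rewrite reflD in ps; have [] := IH (s i b1) (s i b2).
- by rewrite -reflD height_refl; have := height_pos ps; rewrite -reflD height_refl; lia.
- exact: (real_weyl [:: i]).
- exact: (real_weyl [:: i]).
- by rewrite refl_pair.
- by [].
by move=> w; rewrite -reflD -weyl_rcons => h; exists (rcons w i).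
Qed.

Lemma antidominant_isotropic d : (forall i, 0 <= d 0 i) -> antidominant d -> B d d = 0 ->
  forall i, i \in supp d -> B (alpha i) d = 0.
Proof.
move=> dge ad dd i; rewrite suppP => di.
move: dd; rewrite pair_coef => /eqP; rewrite -oppr_eq0 -sumrN psumr_eq0.
  move/allP/(_ i (mem_index_enum _)) => /=; rewrite oppr_eq0 mulf_eq0 (negPf di) /=.
  by move/eqP.
by move=> j _; rewrite oppr_ge0 mulr_ge0_le0.
Qed.

Lemma orth_supp d b : (forall i, 0 <= d 0 i) -> antidominant d -> real_root X b -> B b d = 0 ->
  forall i, i \in supp b -> B (alpha i) d = 0.
Proof.
move=> dge ad rb; case: (real_coherent rb) => -[_ bge] bd i.
  rewrite suppP => bi; move: bd; rewrite pair_coef => /eqP.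
  rewrite -oppr_eq0 -sumrN psumr_eq0.
    move/allP/(_ i (mem_index_enum _)) => /=; rewrite oppr_eq0 mulf_eq0 (negPf bi) /=.
    by move/eqP.
  by move=> j _; rewrite oppr_ge0 mulr_ge0_le0.
rewrite suppP => bi; move: bd; rewrite pair_coef => /eqP; rewrite psumr_eq0.
  move/allP/(_ i (mem_index_enum _)) => /=; rewrite mulf_eq0 (negPf bi) /=.
  by move/eqP.
by move=> j _; apply: mulr_le0 => //; have := bge j; rewrite coefN; lia.
Qed.

Lemma real_supp_connected (C : {set 'I_n}) b : real_root X b ->
    (forall i j, i \in supp b -> j \in supp b -> i \in C -> j \notin C -> X i j = 0) ->
  supp b \subset C \/ supp b \subset (~: C)%SET.
Proof.
move=> rb hC.
have [c [rc pc sc]] : exists c, [/\ real_root X c, positive c & supp c = supp b].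
  case: (real_coherent rb) => pb; first by exists b.
  by exists (- b); split=> //; [exact: realN|exact: suppN].
have [i j ci cj|h|h] := real_support_connected (C := C) rc pc.
- by apply: hC; rewrite -sc suppP.
- by left; apply/fintype.subsetP => i; rewrite -sc suppP; apply: h.
- by right; apply/fintype.subsetP => i; rewrite -sc suppP inE; apply: h.
Qed.

Lemma pair_unlinked u v : (forall i j, i \in supp u -> j \in supp v -> X i j = 0) -> B u v = 0.
Proof.
move=> h; rewrite pair_coef big1 // => i _; rewrite pair_alpha.
have [ui|] := boolP (i \in supp u); last by rewrite suppP negbK => /eqP ->; rewrite mul0r.
rewrite big1 ?mulr0 // => j _.
have [vj|] := boolP (j \in supp v); last by rewrite suppP negbK => /eqP ->; rewrite mulr0.
by rewrite h ?mul0r.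
Qed.

(** The supports of b1 and b2 might leave supp d by cancellation. Their vertices are orthogonal to
    d, so those outside supp d have no neighbour in it. Hence a union C of components of supp d
    contains or avoids each support, and the same for both as (b1 | b2) is not 0; both cannot avoid
    C, since their sum is d. C = supp d gives the inclusions, a smaller C connectedness. *)
Lemma isotropic_affine b1 b2 (d := b1 + b2) : real_root X b1 -> real_root X b2 ->
    B b1 b2 = -2 -> positive d -> antidominant d ->
  [/\ affine_null d, supp b1 \subset supp d & supp b2 \subset supp d].
Proof.
move=> r1 r2 b12 pd ad; have n1 := real_norm r1; have n2 := real_norm r2.
have [d0 dge] := pd.
have dd : B d d = 0 by rewrite /d !pairE (pairC b2) b12 n1 n2.
have dn := antidominant_isotropic dge ad dd.
have bd1 : B b1 d = 0 by rewrite /d pairDr n1 b12.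
have bd2 : B b2 d = 0 by rewrite /d pairDr n2 pairC b12.
have link i j : B (alpha i) d = 0 -> i \notin supp d -> j \in supp d -> X i j = 0.
  move=> id ni jd; move: id; rewrite pair_alpha => /eqP.
  rewrite -oppr_eq0 -sumrN psumr_eq0.
    move/allP/(_ j (mem_index_enum _)) => /=; rewrite oppr_eq0 mulf_eq0.
    by move: jd; rewrite suppP => /negPf ->; rewrite orbF => /eqP.
  move=> k _; rewrite oppr_ge0; have [ki|ik] := eqVneq i k.
    by move: ni; rewrite ki suppP negbK => /eqP ->; rewrite mulr0.
  by apply: mulr_le0_ge0 => //; exact: offX.
have split (C : {set 'I_n}) : C \subset supp d ->
    (forall i j, i \in C -> j \in supp d -> j \notin C -> X i j = 0) ->
    (supp b1 \subset C /\ supp b2 \subset C) \/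
    (supp b1 \subset (~: C)%SET /\ supp b2 \subset (~: C)%SET).
  move=> /fintype.subsetP Cd hC.
  have lC i j : B (alpha j) d = 0 -> i \in C -> j \notin C -> X i j = 0.
    move=> jd iC jC; have [jY|jY] := boolP (j \in supp d); first exact: hC.
    by rewrite symX; apply: link => //; apply: Cd.
  have o1 := orth_supp dge ad r1 bd1; have o2 := orth_supp dge ad r2 bd2.
  have [] := @real_supp_connected C b1 r1; first by move=> i j _ /o1; apply: lC.
    move=> h1; have [] := @real_supp_connected C b2 r2.
    - by move=> i j _ /o2; apply: lC.
    - by left.
    move=> h2; exfalso; move: b12; rewrite pair_unlinked // => i j ib jb.
    apply: lC; first exact: o2.
      exact: (fintype.subsetP h1).
    by have := fintype.subsetP h2 _ jb; rewrite inE.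
  move=> h1; have [] := @real_supp_connected C b2 r2.
  - by move=> i j _ /o2; apply: lC.
  - move=> h2; exfalso; move: b12; rewrite pair_unlinked // => i j ib jb.
    rewrite symX; apply: lC; first exact: o1.
      exact: (fintype.subsetP h2).
    by have := fintype.subsetP h1 _ ib; rewrite inE.
  - by right.
have noC (C : {set 'I_n}) i : i \in C -> i \in supp d ->
    supp b1 \subset (~: C)%SET -> supp b2 \subset (~: C)%SET -> False.
  move=> iC id h1 h2; have := fintype.subsetP (suppD h1 h2) i id.
  by rewrite inE iC.
have [i di] := positive_neq pd.
have iY : i \in supp d by rewrite suppP gt_eqF.
have [h1 h2] : supp b1 \subset supp d /\ supp b2 \subset supp d.
  have [//||//|[h1 h2]] := split (supp d); first by move=> ? ? _ ->.
  by case: (noC _ _ iY iY h1 h2).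
split=> //; split=> // C Cd C0 Cn; apply: contrapT => no.
have [//|k l kC ld lC|[c1 c2]|[c1 c2]] := split C.
- apply: contrapT => /eqP kl; apply: no; exists k, l; split=> //.
- by case/eqP: Cn; apply/eqP; rewrite finset.eqEsubset Cd (suppD c1 c2).
- have [k kC] := finset.set0Pn _ C0.
  exact: noC kC (fintype.subsetP Cd _ kC) c1 c2.
Qed.

(** The terms of (b | d) = -1 are at most 0, so a single vertex p of supp b is not orthogonal to d,
    and b_p = 1. When no reflection fixing d lowers b any more, the other terms of (b | b) = 2 are
    at most 0, so (alpha_p | b) >= 2 = 2 b_p: no neighbour of p is in supp b, and b = alpha_p by
    connectedness. *)
Lemma conj_simple d b : antidominant d -> real_root X b -> B b d = -1 ->
  exists w p, [/\ W w d = d, W w b = alpha p & B (alpha p) d = -1].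
Proof.
move=> ad rb bd; have pb : positive b.
  case: (real_coherent rb) => // -[_ h]; exfalso.
  have : 0 <= B b d; last by rewrite bd.
  rewrite pair_coef; apply: sumr_ge0 => i _; apply: mulr_le0 => //.
  by have := h i; rewrite coefN; lia.
move: {2}(`|height b|%N) (leqnn `|height b|%N) => N.
elim: N b rb bd pb => [|N IH] b rb bd pb hN; have hb := height_pos pb; first lia.
have [/existsP[i /andP[/eqP di bi]]|/existsPn h] :=
    boolP [exists i, (B (alpha i) d == 0) && (0 < B (alpha i) b)].
  have bni : b != alpha i by apply: contra_eqN bd => /eqP ->; rewrite di.
  have ps := real_pos_refl rb pb bni.
  have sd : s i d = d by rewrite /refl di scale0r subr0.
  have [] := IH (s i b) (real_weyl [:: i] rb) _ ps.
  - by rewrite -{1}sd refl_pair.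
  - by have := height_pos ps; rewrite height_refl; lia.
  move=> w [p [wd wb pd]]; exists (rcons w i), p.
  by rewrite !weyl_rcons sd.
have {}h i : B (alpha i) d = 0 -> B (alpha i) b <= 0.
  by move=> di; have := h i; rewrite di eqxx /= -leNgt.
have [_ bge] := pb.
have [p bp gp] : exists2 p, 0 < b 0 p & B (alpha p) d < 0.
  apply: contrapT => no; move: bd; rewrite pair_coef big1 // => i _.
  have [->|bi] := eqVneq (b 0 i) 0; first by rewrite mul0r.
  have := ad i; rewrite le_eqVlt => /orP[/eqP ->|gi]; first by rewrite mulr0.
  by case: no; exists i => //; rewrite lt_neqAle eq_sym bi bge.
have bd' := bd; rewrite pair_coef (bigD1 p) //= in bd'.
have rest_le0 (P : pred 'I_n) : \sum_(i | P i) b 0 i * B (alpha i) d <= 0.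
  by apply: sumr_le0 => i _; apply: mulr_ge0_le0.
have [bp1 gp1] : b 0 p = 1 /\ B (alpha p) d = -1.
  move: (rest_le0 (fun i => i != p)) bd' bp gp.
  by move: (\sum_(i | _) _) (b 0 p) (B _ d) => r x y ? ? ? ?; split; nia.
have rest0 i : i != p -> b 0 i * B (alpha i) d = 0.
  move=> ip; move: (rest_le0 (fun j => (j != p) && (j != i))).
  move: (mulr_ge0_le0 (bge i) (ad i)) bd'; rewrite (bigD1 i) //= bp1 gp1.
  by move: (\sum_(j | _) _) (b 0 i * _) => x y; lia.
have n2 := real_norm rb; rewrite pair_coef (bigD1 p) //= bp1 mul1r in n2.
have le1 : \sum_(i | i != p) b 0 i * B (alpha i) b <= 0.
  apply: sumr_le0 => i ip; have /eqP := rest0 i ip; rewrite mulf_eq0 => /orP[/eqP ->|/eqP /h hi].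
    by rewrite mul0r.
  exact: mulr_ge0_le0.
have offp j : j != p -> X p j * b 0 j <= 0.
  by move=> jp; apply: mulr_le0_ge0 => //; apply: offX; rewrite eq_sym.
have bpE := pair_alpha p b; rewrite (bigD1 p) //= bp1 diagX mulr1 in bpE.
have zero j : j != p -> X p j * b 0 j = 0.
  move=> jp; have : \sum_(k | (k != p) && (k != j)) X p k * b 0 k <= 0.
    by apply: sumr_le0 => k /andP[kp _]; apply: offp.
  have : 2 <= B (alpha p) b by move: n2 le1; move: (\sum_(i | _) _) => x; lia.
  rewrite bpE (bigD1 j) //=; move: (offp j jp).
  by move: (\sum_(k | _) _) (X p j * _) => x y; lia.
have [i j _ jb /set1P -> jp|sb|sb] := @real_supp_connected [set p]%SET b rb.
- have := zero j; rewrite inE in jp; move=> /(_ jp)/eqP; rewrite mulf_eq0.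
  by move: jb; rewrite suppP => /negPf ->; rewrite orbF => /eqP.
- exists [::], p; split=> //=; apply/rowP => j; rewrite alphaE.
  have [->|jp] := eqVneq j p; first by rewrite bp1.
  apply: contrapT => /eqP bj; have := fintype.subsetP sb j.
  by rewrite suppP inE (negPf jp) => /(_ bj).
- by have := fintype.subsetP sb p; rewrite suppP !inE eqxx (gt_eqF bp) => /(_ isT).
Qed.

(** * Overextensions and the highest root *)

Lemma norm_sub u v : B (u - v) (u - v) = B u u - 2 * B u v + B v v.
Proof. by rewrite !(pairBl, pairBr) (pairC v u); ring. Qed.

(* The vertices of supp d and p form a diagram of Ext type, with null root d and
   with o the only neighbour of p. *)
Definition ext_at d p o :=
  [/\ affine_null d, B (alpha p) d = -1, o \in supp d, d 0 o = 1
    & forall j, j \in supp d -> X p j = - (j == o)%:R].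

(** The integers X p j * d j are at most 0 and sum to -1, so exactly one of them is -1. *)
Lemma ext_vertex d p : affine_null d -> B (alpha p) d = -1 -> exists o, ext_at d p o.
Proof.
move=> affd dp; have [dge dn _] := affd.
have np : p \notin supp d by apply: contra_eqN dp => /dn ->.
have neg j : j \in supp d -> X p j * d 0 j <= 0.
  move=> jd; apply: mulr_le0_ge0 => //; apply: offX.
  by apply: contraNneq np => ->.
have all0 j : X p j * d 0 j <= 0.
  have [/neg//|] := boolP (j \in supp d); rewrite suppP negbK => /eqP ->.
  by rewrite mulr0.
have := dp; rewrite pair_alpha => sm.
have [o Xo] : exists o, X p o * d 0 o != 0.
  apply/existsP; apply: contra_eqT sm => /existsPn h; rewrite big1 // => j _.
  by have := h j; rewrite negbK => /eqP.
have od : o \in supp d by rewrite suppP; apply: contraNneq Xo => ->; rewrite mulr0.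
have d1 : 1 <= d 0 o by move: od; rewrite suppP; have := dge o; lia.
rewrite (bigD1 o) //= in sm.
have rest (P : pred 'I_n) : \sum_(j | P j) X p j * d 0 j <= 0 by apply: sumr_le0.
have Xo1 : X p o * d 0 o = -1.
  move: sm (rest (fun j => j != o)) (all0 o) Xo.
  by move: (\sum_(j | _) _) (X p o * _) => x y; lia.
have [Xpo do1] : X p o = -1 /\ d 0 o = 1.
  move: Xo1 d1; move: (X p o) (d 0 o) => x y xy y1.
  have x1 : x <= -1 by nia.
  by split; nia.
exists o; split=> // j jd; have [->|jo] := eqVneq j o; first by rewrite Xpo.
have : X p j * d 0 j = 0.
  move: sm (rest (fun k => (k != o) && (k != j))) (all0 j).
  rewrite (bigD1 j) //= Xo1.
  by move: (\sum_(k | _) _) (X p j * _) => x y; lia.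
by move/eqP; rewrite mulf_eq0; move: jd; rewrite suppP => /negPf ->; rewrite orbF => /eqP ->.
Qed.

Section Ext.

Variables (d : rlat) (p o : 'I_n).
Hypothesis extd : ext_at d p o.

Let affd : affine_null d. Proof. by case: extd. Qed.
Let dp : B (alpha p) d = -1. Proof. by case: extd. Qed.
Let od : o \in supp d. Proof. by case: extd. Qed.
Let do1 : d 0 o = 1. Proof. by case: extd. Qed.

Lemma ext_pair z : supp z \subset supp d -> B (alpha p) z = - z 0 o.
Proof.
move=> zd; have [_ _ _ _ h] := extd.
rewrite pair_alpha (bigD1 o) //= h // eqxx mulN1r big1 ?addr0 // => j /negPf jo.
have [jd|] := boolP (j \in supp d); first by rewrite h // jo mul0r.
by rewrite suppP negbK => /eqP dj; rewrite (supp_sub zd dj) mulr0.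
Qed.

Lemma ext_notin : p \notin supp d.
Proof. by have [_ dn _] := affd; apply: contra_eqN dp => /dn ->. Qed.

Lemma pair_null z : supp z \subset supp d -> B z d = 0.
Proof.
move=> zd; rewrite pair_coef big1 // => i _; have [_ dn _] := affd.
have [/dn ->|] := boolP (i \in supp d); first by rewrite mulr0.
by rewrite suppP negbK => /eqP di; rewrite (supp_sub zd di) mul0r.
Qed.

(* The highest root of the finite root system on supp d minus o. *)
Definition theta : rlat := d - alpha o.

Lemma theta_supp : supp theta \subset supp d.
Proof. by apply: suppB => //; rewrite supp_alpha finset.sub1set. Qed.

Lemma pair_theta z : supp z \subset supp d -> B z theta = - B z (alpha o).
Proof. by move=> zd; rewrite pairBr pair_null // sub0r. Qed.

Lemma theta_norm : B theta theta = 2.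
Proof.
rewrite pair_theta ?theta_supp // pairC pairBr norm_alpha pair_null ?sub0r ?opprK //.
by rewrite supp_alpha finset.sub1set.
Qed.

Lemma theta_o : theta 0 o = 0.
Proof. by rewrite coefB do1 alphaE eqxx. Qed.

Lemma theta_gt0 i : i \in supp d -> i != o -> 0 < theta 0 i.
Proof.
move=> id /negPf io; rewrite coefB alphaE io subr0.
by have [dge _ _] := affd; rewrite lt_neqAle eq_sym -suppP id dge.
Qed.

(** d - z has norm 2 and coefficient 1 at o, hence is positive. This bounds the ascent in
    [conj_theta]. *)
Lemma norm2_le z : supp z \subset supp d -> z 0 o = 0 -> B z z = 2 ->
  forall i, z 0 i <= d 0 i.
Proof.
move=> zd zo z2; have c : coherent (d - z).
  apply: (affine_norm2_coherent affd); first exact: suppB.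
  by rewrite !(pairBl, pairBr) (pairC d z) !pair_null // z2.
have /(coherent_pos c) [_ h] : 0 < (d - z) 0 o by rewrite coefB zo do1.
by move=> i; have := h i; rewrite coefB subr_ge0.
Qed.

(** (z | theta) > 0, and z - theta has norm 4 - 2 (z | theta) >= 0. If (z | theta) = 2, this norm is
    0 and z = theta. If it is 1, z - theta has norm 2 and one sign: positive contradicts (z - theta
    | theta) = -1 as theta is dominant, negative contradicts (z - theta | z) = 1 as z is. *)
Lemma dominant_theta z : supp z \subset supp d -> z 0 o = 0 -> B z z = 2 ->
  (forall i, i \in supp d -> i != o -> 0 <= B (alpha i) z) -> z = theta.
Proof.
move=> zd zo z2 dom; have [dge _ _] := affd.
have tc : B z theta = \sum_i theta 0 i * B (alpha i) z by rewrite pairC -pair_coef.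
have term i : 0 <= theta 0 i * B (alpha i) z.
  have [id|] := boolP (i \in supp d); last first.
    by rewrite suppP negbK => /eqP di; rewrite (supp_sub theta_supp di) mul0r.
  have [->|io] := eqVneq i o; first by rewrite theta_o mul0r.
  by apply: mulr_ge0; [exact/ltW/theta_gt0|exact: dom].
have [i zi Bi] : exists2 i, z 0 i != 0 & B (alpha i) z != 0.
  apply: contrapT => no; move: z2; rewrite pair_coef big1 // => i _.
  have [->|zi] := eqVneq (z 0 i) 0; first by rewrite mul0r.
  have [->|Bi] := eqVneq (B (alpha i) z) 0; first by rewrite mulr0.
  by case: no; exists i.
have id : i \in supp d by apply: (fintype.subsetP zd); rewrite suppP.
have io : i != o by apply: contraNneq zi => ->; rewrite zo.
have zt : 0 < B z theta.
  rewrite tc (bigD1 i) //= ltr_wpDr ?sumr_ge0 //.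
  by rewrite mulr_gt0 ?theta_gt0 // lt_neqAle eq_sym Bi dom.
have ed : supp (z - theta) \subset supp d by apply: suppB => //; exact: theta_supp.
have en : B (z - theta) (z - theta) = 4 - 2 * B z theta.
  by rewrite norm_sub z2 theta_norm; ring.
have := affine_ge0 affd ed; rewrite en => en0.
have [e2|e2] := eqVneq (B z theta) 2.
  apply/eqP; rewrite -subr_eq0; apply/eqP.
  apply: (affine_proper_eq0 affd ed _ od); first by rewrite en e2.
  by rewrite coefB zo theta_o.
have e1 : B z theta = 1 by lia.
have zdom j : (z - theta) 0 j != 0 -> j \in supp d /\ j != o.
  move=> h; split; first by apply: (fintype.subsetP ed); rewrite suppP.
  by apply: contraNneq h => ->; rewrite coefB zo theta_o.
have ez : B (z - theta) z = 1 by rewrite pairBl z2 (pairC theta) e1.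
have et : B (z - theta) theta = -1 by rewrite pairBl e1 theta_norm.
exfalso; have [] := affine_norm2_coherent affd ed; first by rewrite en e1.
  move=> [_ pos]; have : 0 <= B (z - theta) theta; last by rewrite et.
  rewrite pair_coef; apply: sumr_ge0 => j _.
  have [->|/zdom[jd jo]] := eqVneq ((z - theta) 0 j) 0; first by rewrite mul0r.
  apply: mulr_ge0 => //; rewrite pair_theta ?supp_alpha ?finset.sub1set //.
  by rewrite pair_alpha2 oppr_ge0 offX.
move=> [_ pos]; have : B (z - theta) z <= 0; last by rewrite ez.
rewrite pair_coef; apply: sumr_le0 => j _.
have [->|/zdom[jd jo]] := eqVneq ((z - theta) 0 j) 0; first by rewrite mul0r.
apply: mulr_le0_ge0; last exact: dom.
by have := pos j; rewrite coefN; lia.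
Qed.

(** Reflections in vertices of supp d other than o fix both d and alpha_p; those with (alpha_i | z)
    < 0 raise z until it is dominant. *)
Lemma conj_theta z : supp z \subset supp d -> z 0 o = 0 -> B z z = 2 ->
  exists w, [/\ W w d = d, W w (alpha p) = alpha p & W w z = theta].
Proof.
move: {2}(`|height d - height z|%N) (leqnn `|height d - height z|%N) => N.
elim: N z => [|N IH] z hN zd zo z2.
(* The base case runs along: with height difference 0, a reflection that raises z contradicts
   [hz]. *)
all: have [/existsP[i /and3P[id io Bi]]|/existsPn h] :=
  boolP [exists i, [&& i \in supp d, i != o & B (alpha i) z < 0]]; last first.
all: try (exists [::]; split=> //=; apply: dominant_theta => // i id io;
          by have := h i; rewrite id io /= -leNgt).
all: have zd' : supp (s i z) \subset supp d by exact: supp_refl.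
all: have zo' : s i z 0 o = 0 by rewrite reflE_neq // eq_sym.
all: have z2' : B (s i z) (s i z) = 2 by rewrite refl_pair.
all: have hz : height (s i z) <= height d by apply: ler_sum => j _; exact: norm2_le.
  by move: hz hN; rewrite height_refl; lia.
have [|w [wd wp wz]] := IH (s i z) _ zd' zo' z2'.
  by move: hz hN; rewrite height_refl; lia.
have [_ dn _] := affd; have [_ _ _ _ Xp] := extd.
exists (rcons w i); rewrite !weyl_rcons; split=> //.
  by rewrite {1}/refl dn // scale0r subr0.
by rewrite {1}/refl pair_alpha2 symX Xp // (negPf io) oppr0 scale0r subr0.
Qed.

(** theta is conjugate to any alpha_i with i in supp d other than o; its nonzero norm provides such
    an i. *)
Lemma theta_real : real_root X theta.
Proof.
have [i id io] : exists2 i, i \in supp d & i != o.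
  apply: contrapT => no; have := theta_norm; rewrite pair_coef big1 // => i _.
  have [id|] := boolP (i \in supp d); last first.
    by rewrite suppP negbK => /eqP di; rewrite (supp_sub theta_supp di) mul0r.
  have [->|io] := eqVneq i o; first by rewrite theta_o mul0r.
  by case: no; exists i.
have si : supp (alpha i) \subset supp d by rewrite supp_alpha finset.sub1set.
have oi : alpha i 0 o = 0 by rewrite alphaE eq_sym (negPf io).
have [w [_ _ <-]] := conj_theta si oi (norm_alpha i).
exact/real_weyl/real_alpha.
Qed.

End Ext.

Lemma ext_normal_form b0 b1 b2 : real_root X b0 -> real_root X b1 -> real_root X b2 ->
    B b0 b1 = -1 -> B b0 b2 = 0 -> B b1 b2 = -2 -> positive (b1 + b2) ->
  exists w d p o, [/\ ext_at d p o, W w b0 = alpha p, W w b1 = alpha o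
                    & W w b2 = theta d o].
Proof.
move=> r0 r1 r2 b01 b02 b12 pd.
have [w1 [pd1 ad1]] := antidominant_conj r1 r2 b12 pd.
set d := W w1 (b1 + b2) in pd1 ad1.
have dE : d = W w1 b1 + W w1 b2 by rewrite /d weylD.
have [affd s1 s2] : [/\ affine_null d, supp (W w1 b1) \subset supp d
                      & supp (W w1 b2) \subset supp d].
  rewrite dE; apply: isotropic_affine; rewrite -?dE ?weyl_pair //; exact: real_weyl.
have bd : B (W w1 b0) d = -1 by rewrite weyl_pair pairDr b01 b02 addr0.
have [w2 [p [w2d w2b dp]]] := conj_simple ad1 (real_weyl w1 r0) bd.
have [o extd] := ext_vertex affd dp.
have e2 : W (w2 ++ w1) b1 + W (w2 ++ w1) b2 = d by rewrite !weyl_cat -weylD -dE w2d.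
(* w2 fixes d but moves the images of b1 and b2, so their supports are located anew. By [ext_pair],
   (b0 | b2) = 0 then says that the image of b2 avoids o. *)
have [_ t1 t2] : [/\ affine_null d, supp (W (w2 ++ w1) b1) \subset supp d
                      & supp (W (w2 ++ w1) b2) \subset supp d].
  rewrite -e2; apply: isotropic_affine; rewrite ?e2 ?weyl_pair //; exact: real_weyl.
have o2 : W (w2 ++ w1) b2 0 o = 0.
  by have := ext_pair extd t2; rewrite -w2b -weyl_cat weyl_pair b02 => /eqP; rewrite eq_sym oppr_eq0 => /eqP.
have n2 : B (W (w2 ++ w1) b2) (W (w2 ++ w1) b2) = 2 by rewrite weyl_pair real_norm.
have [w3 [w3d w3p w3b]] := conj_theta extd t2 o2 n2.
exists (w3 ++ w2 ++ w1), d, p, o; split=> //.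
- by rewrite weyl_cat weyl_cat w2b.
- rewrite weyl_cat; apply: (addIr (W w3 (W (w2 ++ w1) b2))).
  by rewrite -weylD e2 w3d w3b /theta addrC subrK.
- by rewrite weyl_cat.
Qed.

(** * Uniqueness of the overextending vertex *)

Definition indv (s : seq 'I_n) : rlat := \sum_(k <- s) alpha k.

Lemma pair_sumr u (J : Type) (r : seq J) (P : pred J) (f : J -> rlat) :
  B u (\sum_(k <- r | P k) f k) = \sum_(k <- r | P k) B u (f k).
Proof. exact: (big_morph _ (pairDr u) (pair0r u)). Qed.

Lemma indv_coef (s : seq 'I_n) i : uniq s -> indv s 0 i = (i \in s)%:R.
Proof.
elim: s => [|k s IH] /=; first by rewrite /indv big_nil coef0.
case/andP=> ks us; rewrite /indv big_cons coefD -/(indv s) IH // alphaE inE.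
by have [->|] := eqVneq i k; rewrite ?(negPf ks) ?addr0 ?add0r.
Qed.

Lemma indv_supp (s : seq 'I_n) (U : {set 'I_n}) : uniq s -> {subset s <= U} ->
  supp (indv s) \subset U.
Proof.
move=> us sU; apply/fintype.subsetP => i; rewrite suppP indv_coef //.
by case: (boolP (i \in s)) => [/sU|].
Qed.

Section Branch.

Variable U : {set 'I_n}.
Hypothesis posU : forall z, supp z \subset U -> z != 0 -> 2 <= B z z.

Definition link : rel 'I_n := fun i j => [&& i \in U, j \in U & adj i j].

Lemma link_sym : symmetric link.
Proof. by move=> i j; rewrite /link /adj symX andbCA. Qed.

(** Adding x to the path gives norm 4 + 2 (alpha_x | rest) >= 2, while (alpha_x | rest) <= -1: a
    path in U has neither chords nor multiple edges. *)
Lemma path_indv x s : x \in U -> path link x s -> uniq (x :: s) ->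
  [/\ {subset x :: s <= U}, B (indv (x :: s)) (indv (x :: s)) = 2
    & s != [::] -> B (alpha x) (indv s) = -1].
Proof.
elim: s x => [|y s IH] x xU /=.
  move=> _ _; split=> //; last by rewrite /indv big_seq1 norm_alpha.
  by move=> i; rewrite inE => /eqP ->.
case/andP=> /and3P[_ yU xy] ps /andP[xs us].
have [sub n2 _] := IH y yU ps us.
have subx : {subset x :: y :: s <= U}.
  by move=> i; rewrite inE => /orP[/eqP ->|/sub].
have ux : uniq (x :: y :: s) by rewrite /= xs.
have le : B (alpha x) (indv (y :: s)) <= -1.
  rewrite /indv big_cons pairDr pair_alpha2 pair_sumr.
  have xk k : k \in y :: s -> X x k <= 0.
    by move=> ky; apply: offX; apply: contraNneq xs => ->.
  have := xk y (mem_head _ _); move: xy; rewrite /adj.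
  have : \sum_(k <- s) B (alpha x) (alpha k) <= 0.
    rewrite big_seq; apply: sumr_le0 => k ks; rewrite pair_alpha2.
    by apply: xk; rewrite inE ks orbT.
  by move: (\sum_(k <- s) _) (X x y) => a b; lia.
have e : B (indv (x :: y :: s)) (indv (x :: y :: s)) =
    4 + 2 * B (alpha x) (indv (y :: s)).
  rewrite {1 2}/indv big_cons -/(indv (y :: s)) !pairE norm_alpha n2.
  by rewrite (pairC (indv _)); ring.
have ge : 2 <= B (indv (x :: y :: s)) (indv (x :: y :: s)).
  apply: posU; first exact: indv_supp.
  apply/eqP => /(congr1 (fun v : rlat => v 0 x)).
  by rewrite indv_coef // mem_head coef0.
have e1 : B (alpha x) (indv (y :: s)) = -1.
  by move: le ge; rewrite e; move: (B _ _) => z; clear; lia.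
by split=> //; rewrite e e1.
Qed.

Lemma connect_link (a b : 'I_n) : connected_set adj U -> a \in U -> b \in U -> connect link a b.
Proof.
move=> cU aU bU; pose C := [set k in U | connect link a k]%SET.
suff CU : C = U by move: bU; rewrite -CU inE => /andP[].
apply: contrapT => /eqP CU.
have [||i [j [iC jU jC ij]]] := cU C _ _ CU.
- by apply/fintype.subsetP => k; rewrite inE => /andP[].
- by apply/finset.set0Pn; exists a; rewrite inE aU connect0.
move: iC; rewrite inE => /andP[iU ai]; move: jC; rewrite inE jU /= => /negP; apply.
by apply: connect_trans ai (connect1 _); rewrite /link iU jU.
Qed.

(** Edges are counted with multiplicity. *)
Definition degree_in i := \sum_(j in U | j != i) - X i j.

(* The vector with coefficient 2 on a path from a to b and 1 on the other
   neighbours of a and b is isotropic or negative. *)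
Lemma two_branch_points (a b : 'I_n) : connected_set adj U -> a \in U -> b \in U -> a != b ->
  3 <= degree_in a -> 3 <= degree_in b -> False.
Proof.
move=> cU aU bU ab da db.
have /connectP[s0 ps0 lb0] := connect_link cU aU bU.
case: (shortenP ps0) lb0 => s ps us _ lb.
have [sub n2 ha] := path_indv aU ps us.
have s0n : s != [::] by apply: contraNneq ab => s0E; rewrite lb s0E.
set sg := indv (a :: s) in n2.
have Ba : B (alpha a) sg = 1.
  by rewrite /sg /indv big_cons pairDr norm_alpha -/(indv s) (ha s0n).
have Bb : B (alpha b) sg = 1.
  have : path link b (rev (belast a s)).
    rewrite lb rev_path; apply: sub_path ps => i j; by rewrite link_sym.
  have perm : perm_eq (b :: rev (belast a s)) (a :: s).
    by rewrite lb -rev_rcons -lastI perm_rev.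
  move=> pr; have ur : uniq (b :: rev (belast a s)) by rewrite (perm_uniq perm).
  have [_ _ hb] := path_indv bU pr ur.
  have e : sg = indv (b :: rev (belast a s)) by apply/esym/perm_big.
  rewrite e /indv big_cons pairDr norm_alpha -/(indv (rev (belast a s))) hb //.
  by rewrite -size_eq0 size_rev size_belast size_eq0.
pose h j := - (X a j + X b j).
pose Q := [pred j | (j \in U) && (j \notin a :: s)].
have aP : a \in a :: s by rewrite mem_head.
have bP : b \in a :: s by rewrite lb mem_last.
have offP i j : i \in a :: s -> Q j -> X i j <= 0.
  by move=> iP /andP[_ jP]; apply: offX; apply: contraNneq jP => <-.
have h_ge0 j : Q j -> 0 <= h j.
  by move=> Qj; rewrite /h oppr_ge0; rewrite -(addr0 0) lerD // offP.
(* An end of the path has one edge on it, so at least two of its edges leave it. *)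
have out (c : 'I_n) : c \in a :: s -> B (alpha c) sg = 1 -> 3 <= degree_in c -> 2 <= \sum_(j | Q j) - X c j.
  move=> cP Bc; rewrite /degree_in (bigID (fun j => j \in a :: s)) /=.
  rewrite [X in _ + X](eq_bigl Q); last first.
    move=> j /=; case jP: (j \in a :: s); rewrite ?andbF //= ?andbT.
    have [jc|] := eqVneq j c; last by rewrite andbT.
    by move: jP; rewrite jc cP.
  have -> : \sum_(i | (i \in U) && (i != c) && (i \in a :: s)) - X c i = 1.
    rewrite sumrN (eq_bigl (fun i => (i \in a :: s) && (i != c))); last first.
      move=> i /=; case iP: (i \in a :: s); rewrite ?andbF //=.
      by rewrite (sub _ iP) andbT.
    have := Bc; rewrite /sg /indv pair_sumr (big_uniq _ us) /= (bigD1 c) //=.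
    rewrite norm_alpha (eq_bigr (fun i => X c i)) => [|i _]; last by rewrite pair_alpha2.
    by move: (\sum_(i | _) _) => x; clear; lia.
  by move: (\sum_(i | Q i) _) => x; clear; lia.
have hsum : 4 <= \sum_(j | Q j) h j.
  have := out a aP Ba da; have := out b bP Bb db.
  have -> : \sum_(j | Q j) h j = \sum_(j | Q j) - X a j + \sum_(j | Q j) - X b j.
    by rewrite -big_split; apply: eq_bigr => j _; rewrite /h opprD.
  by move: (\sum_(j | Q j) - X a j) (\sum_(j | Q j) - X b j) => x y; clear; lia.
pose N := [seq j <- enum Q | h j != 0].
have uN : uniq N by rewrite filter_uniq // enum_uniq.
have NQ j : j \in N -> Q j && (h j != 0).
  by rewrite mem_filter mem_enum => /andP[-> Qj]; rewrite andbT.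
have n3 : B (indv N) (indv N) <= \sum_(j <- N) 2.
  rewrite {2}/indv pair_sumr big_seq [X in _ <= X]big_seq; apply: ler_sum => j jN.
  rewrite pairC {1}/indv pair_sumr (big_uniq _ uN) /= (bigD1 j) //= norm_alpha gerDl.
  by apply: sumr_le0 => k /andP[_ kj]; rewrite pair_alpha2 offX // eq_sym.
have n4 : B sg (indv N) <= \sum_(j <- N) - h j.
  rewrite {1}/indv pair_sumr big_seq [X in _ <= X]big_seq; apply: ler_sum => j /NQ/andP[Qj _].
  rewrite pairC /sg /indv pair_sumr (big_uniq _ us) /= (bigD1 a) //= (bigD1 b) ?bP 1?eq_sym //=.
  rewrite !pair_alpha2 (symX j a) (symX j b) /h opprK addrA gerDl.
  by apply: sumr_le0 => k /andP[/andP[kP _] _]; rewrite pair_alpha2 symX offP.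
have hN : \sum_(j <- N) h j = \sum_(j | Q j) h j.
  rewrite big_filter /= big_enum_cond /= [RHS](bigID (fun j => h j != 0)) /=.
  by rewrite [X in _ = _ + X]big1 ?addr0 // => j /andP[_]; rewrite negbK => /eqP.
have card : \sum_(j <- N) (2 : int) <= \sum_(j <- N) 2 * h j.
  rewrite big_seq [X in _ <= X]big_seq; apply: ler_sum => j /NQ/andP[Qj hj].
  by move: (h_ge0 j Qj) hj; move: (h j) => x; clear; lia.
(* With H the sum of h, this norm is at most 8 - 4 H + 2 |N|. Since h >= 1 on N, it is at most 8 - 2
   H, and H >= 4. *)
have ge : 2 <= B (2 *: sg + indv N) (2 *: sg + indv N).
  apply: posU.
    apply: suppD; first by apply: suppZ; exact: indv_supp.
    by apply: indv_supp => // j /NQ/andP[/andP[]].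
  apply/eqP => /(congr1 (fun v : rlat => v 0 a)).
  rewrite coefD coefZ !indv_coef // mem_head coef0.
  by case: (a \in N).
move: ge; rewrite !pairE (pairC (indv N)) n2.
move: n3 n4 card; rewrite -mulr_sumr hN sumrN hN; move: hsum.
move: (\sum_(j <- N) 2) (\sum_(j | Q j) h j) (B sg (indv N)) (B (indv N) (indv N)) => x y z t.
by clear; lia.
Qed.

End Branch.

Definition two_ext d p o d' p' o' :=
  [/\ ext_at d p o, ext_at d' p' o', p != p' & (p |: supp d = p' |: supp d')%SET].

Lemma two_ext_sym d p o d' p' o' : two_ext d p o d' p' o' -> two_ext d' p' o' d p o.
Proof. by case=> e e' pp' eZ; split=> //; rewrite eq_sym. Qed.

Lemma two_ext_in d p o d' p' o' : two_ext d p o d' p' o' -> p' \in supp d.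
Proof.
case=> e e' pp' eZ; have : p' \in (p |: supp d)%SET by rewrite eZ setU11.
by rewrite in_setU1 eq_sym (negPf pp').
Qed.

Lemma two_ext_mem d p o d' p' o' j : two_ext d p o d' p' o' ->
  j \in supp d -> j != p' -> j \in supp d'.
Proof.
case=> e e' pp' eZ jd jp'; have : j \in (p |: supp d)%SET by rewrite in_setU1 jd orbT.
by rewrite eZ in_setU1 (negPf jp').
Qed.

Lemma two_ext_pair d p o d' p' o' : two_ext d p o d' p' o' -> B d' d = - d' 0 p.
Proof.
move=> t2; have [e _ _ _] := t2; have [[_ dn _] dp _ _ _] := e.
rewrite pair_coef (bigD1 p) //= dp mulrN1 big1 ?addr0 // => i ip.
have [id|id] := boolP (i \in supp d); first by rewrite dn // mulr0.
have : i \notin supp d'.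
  by apply: contraNN id => id'; exact: two_ext_mem (two_ext_sym t2) id' ip.
by rewrite suppP negbK => /eqP ->; rewrite mul0r.
Qed.

(** Both sides are -(d | d'). *)
Lemma two_ext_mark d p o d' p' o' : two_ext d p o d' p' o' -> d' 0 p = d 0 p'.
Proof.
move=> t2; apply: oppr_inj; rewrite -(two_ext_pair t2) pairC.
exact: two_ext_pair (two_ext_sym t2).
Qed.

Lemma ext_neq d p o : ext_at d p o -> o != p.
Proof.
by move=> e; have [_ _ od _ _] := e; apply: contraNneq (ext_notin e) => <-.
Qed.

(** The rest of supp d lies in supp d', so o' is the only possible neighbour of p' there, and the
    null condition of d at p' has only two terms. *)
Lemma two_ext_double d p o d' p' o' : two_ext d p o d' p' o' ->
  d 0 o' = 2 * d 0 p' /\ o' \in supp d.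
Proof.
move=> t2; have [e e' pp' _] := t2; have [[dge dn _] dp _ _ _] := e.
have p'd := two_ext_in t2; have [_ _ _ _ X'] := e'.
have o'p' := ext_neq e'.
have : B (alpha p') d = 0 by apply: dn.
rewrite pair_alpha (bigD1 p') //= diagX (bigD1 o') //= big1 => [|j /andP[jp' jo']].
  rewrite X'; last by have [_ _ ? _ _] := e'.
  rewrite eqxx mulN1r addr0 => h.
  have e1 : d 0 o' = 2 * d 0 p' by move: h; move: (d 0 o') (d 0 p') => x y; clear; lia.
  split=> //; rewrite suppP e1 mulf_eq0 /=; move: p'd; by rewrite suppP.
have [jd|] := boolP (j \in supp d); last by rewrite suppP negbK => /eqP ->; rewrite mulr0.
by rewrite X' ?(negPf jo') ?oppr0 ?mul0r //; exact: two_ext_mem t2 jd jp'.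
Qed.

Lemma supp_gt0 d i : (forall j, 0 <= d 0 j) -> i \in supp d -> 1 <= d 0 i.
Proof. by move=> h; rewrite suppP -gtz0_ge1 lt_neqAle eq_sym h andbT. Qed.

(** Z may exceed the support, so that the conditions of d and d' at t become sums over one index
    set. *)
Lemma null_row_sum (Z : {set 'I_n}) z t : supp z \subset Z -> t \in Z -> B (alpha t) z = 0 ->
  \sum_(j in Z | j != t) - X t j * z 0 j = 2 * z 0 t.
Proof.
move=> zZ tZ; rewrite pair_alpha (bigD1 t) //= diagX.
rewrite (bigID (fun j => j \in Z)) /= [X in _ + (_ + X)]big1 => [|j /andP[_ jZ]]; last first.
  rewrite (_ : z 0 j = 0) ?mulr0 //; apply/eqP; rewrite -[_ == _]negbK -suppP.
  by apply: contraNN jZ; apply: (fintype.subsetP zZ).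
rewrite addr0 => h; have -> : 2 * z 0 t = - \sum_(i | (i != t) && (i \in Z)) X t i * z 0 i.
  by apply/eqP; rewrite -subr_eq0 opprK h.
rewrite -sumrN; apply: eq_big => [j|j _]; last by rewrite mulNr.
by rewrite andbC.
Qed.

(** If a and its neighbour c have mark 1, the null condition at a leaves at most 1 for the other
    neighbours. So the vertices of mark 1 with a neighbour of mark 1 form a set that no edge leaves,
    as in a cycle. *)
Lemma mark_one_edge d i j : affine_null d -> i \in supp d -> j \in supp d ->
  i != j -> X i j != 0 -> d 0 i = 1 -> d 0 j = 1 -> forall k, k \in supp d -> d 0 k = 1.
Proof.
move=> affd id jd ij Xij di dj k kd; have [dge dn cd] := affd.
pose T := [set a in supp d | (d 0 a == 1) &&
  [exists b in supp d, [&& b != a, X a b != 0 & d 0 b == 1]]]%SET.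
suff TY : T = supp d by move: kd; rewrite -TY inE => /and3P[_ /eqP].
apply: contrapT => /eqP TY.
have [||a [b [aT bd bT ab]]] := cd T _ _ TY.
- by apply/fintype.subsetP => a; rewrite inE => /andP[].
- apply/finset.set0Pn; exists i; rewrite inE id di eqxx /=.
  by apply/existsP; exists j; rewrite jd eq_sym ij Xij dj eqxx.
move: (aT); rewrite inE => /and3P[ad /eqP da /existsP[c /and4P[cd' ca Xac /eqP dc]]].
have ba : b != a by apply: contraNneq bT => ->.
have {}ab : X a b != 0 := ab.
have db : d 0 b = 1.
  have [->//|bc] := eqVneq b c.
  have := null_row_sum (subxx _) ad (dn _ ad).
  rewrite (bigD1 c) ?cd' //= (bigD1 b) /= ?bd ?ba // da dc mulr1.
  have : 0 <= \sum_(i0 | (i0 \in supp d) && (i0 != a) && (i0 != c) && (i0 != b)) - X a i0 * d 0 i0.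
    apply: sumr_ge0 => l /andP[/andP[/andP[_ la] _] _]; apply: mulr_ge0 => //.
    by rewrite oppr_ge0 offX // eq_sym.
  have := offX (i := a) (j := b); rewrite eq_sym ba => /(_ isT).
  have := offX (i := a) (j := c); rewrite eq_sym ca => /(_ isT).
  have := supp_gt0 dge bd; move: ab Xac.
  move: (\sum_(_ | _) _) (X a b) (X a c) (d 0 b) => x y z u; clear; nia.
move: bT; rewrite inE bd db eqxx /= => /existsP; case; exists a.
by rewrite ad eq_sym ba symX ab da eqxx.
Qed.

Lemma degree_setU1 (S : {set 'I_n}) (a t : 'I_n) : a \notin S -> a != t ->
  degree_in (a |: S)%SET t = - X t a + degree_in S t.
Proof.
by move=> aS at0; rewrite /degree_in big_mkcondr big_setU1 //= at0 -big_mkcondr.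
Qed.

(** A neighbour of o in supp d has mark at least 2: otherwise all marks would be 1, against d o' = 2
    d p'. So 2 = 2 d o leaves room for a single edge at o besides that to p. *)
Lemma two_ext_leaf d p o d' p' o' : two_ext d p o d' p' o' ->
  degree_in (p |: supp d)%SET o <= 2.
Proof.
move=> t2; have [e e' pp' eZ] := t2; have [[dge dn cd] dp od do1 Xp] := e.
have affd : affine_null d by [].
have p'd := two_ext_in t2; have [do' o'd] := two_ext_double t2.
have m1 := supp_gt0 dge p'd.
have nomark j : j \in supp d -> j != o -> X o j != 0 -> 2 <= d 0 j.
  move=> jd jo Xoj; have := supp_gt0 dge jd; rewrite le_eqVlt => /orP[/eqP dj|]; last first.
    by move: (d 0 j) => x; clear; lia.
  have oj : o != j by rewrite eq_sym.
  have := mark_one_edge affd od jd oj Xoj do1 (esym dj) o'd; rewrite do'.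
  by move: m1; move: (d 0 p') => x; clear; lia.
have := null_row_sum (subxx _) od (dn _ od); rewrite do1 mulr1.
have po : p != o by rewrite eq_sym (ext_neq e).
rewrite degree_setU1 ?(ext_notin e) // symX Xp // eqxx opprK /degree_in => sm.
suff : 2 * \sum_(i in supp d | i != o) - X o i <= 2.
  by move: (\sum_(i in supp d | _) _) => x; clear; lia.
rewrite -[X in _ <= X]sm mulr_sumr; apply: ler_sum => j /andP[jd jo].
have [->|Xoj] := eqVneq (X o j) 0; first by rewrite !mulr0 mulNr mul0r.
have := nomark j jd jo Xoj; have := offX (i := o) (j := j); rewrite eq_sym jo => /(_ isT).
move: (X o j) (d 0 j) => x y; clear; nia.
Qed.

(** At a vertex t of degree 2 with simple edges the marks continue linearly: 2k - (k - 1) = k + 1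
    for d, and 2(k + 1)m - km = (k + 2)m for d'. *)
Lemma chain_step d p o d' p' o' (m := d 0 p') (k : int) (s0 t : 'I_n) :
    two_ext d p o d' p' o' -> 1 <= k ->
    t \in supp d -> t \in supp d' -> s0 \in (p |: supp d)%SET -> s0 != t -> X t s0 != 0 ->
    d 0 t = k -> d' 0 t = (k + 1) * m -> d 0 s0 = k - 1 -> d' 0 s0 = k * m ->
    degree_in (p |: supp d)%SET t <= 2 ->
  exists r, [/\ r \in supp d, r \in supp d', r != t & X r t != 0] /\
            (d 0 r = k + 1 /\ d' 0 r = (k + 2) * m).
Proof.
move=> t2 k1 td td' sZ st Xts dt dt' ds ds' deg; set Z := (p |: supp d)%SET in sZ deg.
have [e e' pp' eZ] := t2; have [[dge dn cd] dp od do1 Xp] := e.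
have [[dge' dn' _] _ _ _ _] := e'.
have tZ : t \in Z by rewrite in_setU1 td orbT.
have dZ : supp d \subset Z by exact: finset.subsetUr.
have d'Z : supp d' \subset Z by rewrite /Z eZ; exact: finset.subsetUr.
have sm := null_row_sum dZ tZ (dn _ td); have sm' := null_row_sum d'Z tZ (dn' _ td').
have f_ge0 j : j != t -> 0 <= - X t j by move=> jt; rewrite oppr_ge0 offX // eq_sym.
have fs : 1 <= - X t s0 by have := f_ge0 s0 st; move: Xts; move: (X t s0) => x; clear; lia.
have sP : (s0 \in Z) && (s0 != t) by rewrite sZ.
rewrite /degree_in (bigD1 s0) //= in deg.
rewrite (bigD1 s0) //= ds in sm; rewrite (bigD1 s0) //= ds' in sm'.
(* Were s0 the only neighbour, at most a double edge, then 2k <= 2(k - 1). *)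
have [r rP Xr] : exists2 r, [&& r \in Z, r != t & r != s0] & X t r != 0.
  apply: contrapT => no; move: sm; rewrite big1 ?addr0 => [|j /andP[/andP[jZ jt] js]].
    have : - X t s0 <= 2.
      have : 0 <= \sum_(i in Z | (i != t) && (i != s0)) - X t i.
        by apply: sumr_ge0 => j /and3P[_ jt _]; apply: f_ge0.
      move: deg; rewrite (eq_bigl _ _ (fun i => andbA _ _ _)).
      by move: (\sum_(_ | _) _) (X t s0) => x y; clear; lia.
    rewrite dt; move: k1 fs; move: (X t s0) (k) => x y; clear; nia.
  have [->|Xj] := eqVneq (X t j) 0; first by rewrite oppr0 mul0r.
  by case: no; exists j; rewrite ?jZ ?jt.
have /and3P[rZ rt rs] := rP.
have fr : 1 <= - X t r by have := f_ge0 r rt; move: Xr; move: (X t r) => x; clear; lia.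
have rP' : (r \in Z) && (r != t) && (r != s0) by rewrite rZ rt.
rewrite (bigD1 r) //= in deg; rewrite (bigD1 r) //= in sm; rewrite (bigD1 r) //= in sm'.
pose P := [pred i | (i \in Z) && (i != t) && (i != s0) && (i != r)].
have rest_ge0 i : P i -> 0 <= - X t i by case/andP=> /andP[/andP[_ it] _] _; apply: f_ge0.
have [fs1 fr1 rest0] : [/\ X t s0 = -1, X t r = -1 & \sum_(i | P i) - X t i = 0].
  have : 0 <= \sum_(i | P i) - X t i by apply: sumr_ge0.
  have : - X t s0 + (- X t r + \sum_(i | P i) - X t i) <= 2 := deg.
  move: fs fr.
  by move: (\sum_(_ | _) _) (X t s0) (X t r) => x y z; clear; split; lia.
have zero i : P i -> - X t i = 0.
  by move=> Pi; have /eqP := rest0; rewrite psumr_eq0 // => /allP/(_ i (mem_index_enum _)); rewrite Pi => /eqP.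
have dr : d 0 r = k + 1.
  move: sm; rewrite [X in _ + (_ + X)]big1 => [|i Pi]; last by rewrite zero ?mul0r.
  rewrite fs1 fr1 dt; move: (d 0 r) (k) => x y; clear; lia.
have dr' : d' 0 r = (k + 2) * m.
  move: sm'; rewrite [X in _ + (_ + X)]big1 => [|i Pi]; last by rewrite zero ?mul0r.
  rewrite fs1 fr1 dt'; move: (d' 0 r) (k) (m) => x y z; clear; nia.
have m1 : 1 <= m by apply: supp_gt0 => //; exact: two_ext_in t2.
exists r; split=> //; split=> //.
- by rewrite suppP dr; move: k1; clear; lia.
- by rewrite suppP dr'; move: k1 m1; clear; nia.
- by rewrite symX.
Qed.

(* If all degrees were at most 2, a path p, o, ... would run through vertices
   where (d, d') is (0, m), (1, 2m), (2, 3m), ..., with m = d p'. *)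
Lemma two_ext_branch d p o d' p' o' : two_ext d p o d' p' o' ->
  exists t, [/\ t \in supp d, t \in supp d', d' 0 t = (d 0 t + 1) * d 0 p'
            & 3 <= degree_in (supp d :&: supp d')%SET t].
Proof.
move=> t2; set m : int := d 0 p'; set Z := (p |: supp d)%SET.
have [e e' pp' eZ] := t2; have [[dge dn cd] dp od do1 Xp] := e.
have [[dge' dn' _] _ o'd' do'1 Xp'] := e'.
have m1 : 1 <= m by apply: supp_gt0 => //; exact: two_ext_in t2.
have [do' o'd] := two_ext_double t2.
have [do'' _] := two_ext_double (two_ext_sym t2).
rewrite (two_ext_mark t2) -/m in do''.
apply: contrapT => no.
have deg2 t : t \in supp d -> t \in supp d' -> d' 0 t = (d 0 t + 1) * m -> degree_in Z t <= 2.
  move=> td td' dt; rewrite leNgt; apply/negP => deg; apply: no; exists t; split=> //.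
  (* t differs from o by its degree and from o' by its marks, since (2m + 1)m is not 1. So t is
     adjacent to neither p nor p', and its degree in Z is that in the intersection. *)
  have to : t != o.
    apply: contraTneq deg => ->; rewrite -leNgt; exact: two_ext_leaf t2.
  have to' : t != o'.
    apply: contra_eqN dt => /eqP ->; rewrite do' do'1 -/m.
    by apply/eqP; move: m1; move: (m) => y; clear; nia.
  have tp : p != t by apply: contraNneq (ext_notin e) => ->.
  move: deg; rewrite degree_setU1 ?(ext_notin e) // symX Xp // (negPf to).
  rewrite !oppr0 add0r /degree_in.
  have tp' : p' != t by apply: contraNneq (ext_notin e') => ->.
  rewrite (bigD1 p') /=; last by rewrite (two_ext_in t2).
  rewrite symX Xp' // (negPf to') !oppr0 add0r => deg.
  have -> : \sum_(j in (supp d :&: supp d')%SET | j != t) - X t j =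
      \sum_(i | (i \in supp d) && (i != t) && (i != p')) - X t i; last by [].
    apply: eq_bigl => j; rewrite inE.
    have [->|jp'] := eqVneq j p'; first by rewrite (negPf (ext_notin e')) !andbF.
    rewrite andbT; have [jd|//] := boolP (j \in supp d).
    by rewrite (two_ext_mem t2 jd jp').
have chain (k : nat) : exists s0 t, [/\ t \in supp d, t \in supp d', s0 \in Z, s0 != t & X t s0 != 0]
    /\ [/\ d 0 t = k.+1%:Z, d' 0 t = (k.+1%:Z + 1) * m, d 0 s0 = k.+1%:Z - 1 & d' 0 s0 = k.+1%:Z * m].
  elim: k => [|k [s0 [t [[td td' sZ st Xts] [dt dt' ds ds']]]]].
    exists p, o; split; split=> //.
    - by have [_ ?] := two_ext_double (two_ext_sym t2).
    - by rewrite setU11.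
    - by rewrite eq_sym (ext_neq e).
    - by rewrite symX Xp // eqxx.
    - by have := ext_notin e; rewrite suppP negbK => /eqP.
    - by rewrite (two_ext_mark t2) mul1r.
  have k1 : 1 <= k.+1%:Z by [].
  have dg : degree_in Z t <= 2 by apply: deg2; rewrite ?dt.
  have [r [[rd rd' rt Xr] [dr dr']]] := chain_step t2 k1 td td' sZ st Xts dt dt' ds ds' dg.
  exists t, r; split; split=> //.
  - by rewrite in_setU1 td orbT.
  - by rewrite eq_sym.
  - by rewrite dr [k.+2%:Z]intS addrC.
  - by rewrite dr' -/m [k.+2%:Z]intS; move: (k.+1%:Z) (m) => x y; ring.
  - by rewrite dt' -/m [k.+2%:Z]intS addrC.
(* After this many steps the mark of d exceeds the height of d. *)
have [s0 [t [_ [dt _ _ _]]]] := chain `|height d|%N.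
have := coef_le_height t dge; rewrite dt; clear; lia.
Qed.

Lemma two_ext_posdef d p o d' p' o' z : two_ext d p o d' p' o' ->
  supp z \subset (supp d :&: supp d')%SET -> z != 0 -> 2 <= B z z.
Proof.
move=> t2 zU z0; have [e e' _ _] := t2; have [affd _ _ _ _] := e.
have zd : supp z \subset supp d by apply: fintype.subset_trans zU (finset.subsetIl _ _).
have zp' : z 0 p' = 0.
  apply/eqP; rewrite -[_ == _]negbK -suppP; apply: contraNN (ext_notin e').
  by move=> /(fintype.subsetP zU); rewrite inE => /andP[].
have nz : B z z != 0.
  by apply: contraNneq z0 => h; apply/eqP/(affine_proper_eq0 affd zd h (two_ext_in t2) zp').
have := affine_ge0 affd zd; have [k] := norm_even z; move: nz.
by move: (B z z) => x; clear; lia.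
Qed.

(** The intersection is supp d without p', whose only neighbour there is o'. If C contains o',
    adding p' to C keeps the edge given by supp d from ending in p'. *)
Lemma two_ext_connected d p o d' p' o' : two_ext d p o d' p' o' ->
  connected_set adj (supp d :&: supp d')%SET.
Proof.
move=> t2; have [e e' pp' eZ] := t2; have [[_ _ cd] _ _ _ _] := e.
have [_ _ o'd' _ Xp'] := e'; set U := (supp d :&: supp d')%SET.
have p'd := two_ext_in t2; have p'U : p' \notin U by rewrite inE (negPf (ext_notin e')) andbF.
have Y'U j : j \in supp d -> j != p' -> j \in U.
  by move=> jd jp'; rewrite inE jd (two_ext_mem t2 jd jp').
have Ud j : j \in U -> j \in supp d by rewrite inE => /andP[].
have Ud' j : j \in U -> j \in supp d' by rewrite inE => /andP[].
have leaf j : j \in U -> X p' j != 0 -> j = o'.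
  by move=> /Ud'/Xp' -> h; apply/eqP; apply: contraNT h => /negPf ->.
move=> C CU C0 Cn; have Cp' : p' \notin C.
  by apply: contraNN p'U; apply: (fintype.subsetP CU).
have [o'C|o'C] := boolP (o' \in C).
  have [|||i [j [iC jd jC ij]]] := cd (p' |: C)%SET.
  - apply/fintype.subsetP => k; rewrite in_setU1 => /orP[/eqP -> //|kC].
    exact/Ud/(fintype.subsetP CU).
  - by apply/finset.set0Pn; exists p'; rewrite setU11.
  - apply: contraNneq Cn => e1; apply/eqP/setP => k; apply/idP/idP => [|kU].
      exact: (fintype.subsetP CU).
    by have := Ud k kU; rewrite -e1 in_setU1; case: eqP => // kp'; move: p'U; rewrite -kp' kU.
  move: jC; rewrite in_setU1 negb_or => /andP[jp' jC].
  move: iC; rewrite in_setU1 => /orP[/eqP ip'|iC].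
    by move: jC; rewrite (leaf j (Y'U j jd jp')) ?o'C // -ip'.
  by exists i, j; split=> //; exact: Y'U.
have [|||i [j [iC jd jC ij]]] := cd C => //.
- by apply/fintype.subsetP => k kC; exact/Ud/(fintype.subsetP CU).
- by apply: contraNneq Cp' => ->.
exists i, j; split=> //; apply: Y'U => //; apply: contraNneq o'C => jp'.
by rewrite -(leaf i) // ?(fintype.subsetP CU) // symX -jp'.
Qed.

Lemma ext_vertex_unique d p o d' p' o' : ext_at d p o -> ext_at d' p' o' ->
  (p |: supp d = p' |: supp d')%SET -> p = p' /\ d = d'.
Proof.
move=> e e' eZ; have pp' : p = p'.
  apply: contrapT => /eqP pp'; have t2 : two_ext d p o d' p' o' by [].
  have t2' := two_ext_sym t2.
  have [t [td td' dt degt]] := two_ext_branch t2.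
  have [u [ud' ud du degu]] := two_ext_branch t2'.
  have [[dge _ _] _ _ _ _] := e; have [[dge' _ _] _ _ _ _] := e'.
  rewrite finset.setIC in degu; rewrite (two_ext_mark t2) in du.
  apply: (two_branch_points (fun z => two_ext_posdef t2) (two_ext_connected t2)
           (a := t) (b := u)) => //; rewrite ?finset.in_setI ?td ?td' ?ud ?ud' //.
  (* If t = u, then x = d' t satisfies x = ((x + 1)m + 1)m, which is larger than x. *)
  apply: contra_eqN dt => /eqP tu; rewrite -tu in du; rewrite du.
  have := supp_gt0 dge' td'; have := supp_gt0 dge (two_ext_in t2).
  move: (d' 0 t) (d 0 p') => x y y1 x1; apply/eqP.
  have : x + 1 <= (x + 1) * y by rewrite ler_peMr //; lia.
  have : (x + 1) * y + 1 <= ((x + 1) * y + 1) * y by rewrite ler_peMr //; nia.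
  by move: (((x + 1) * y + 1) * y) ((x + 1) * y) => u1 u2; lia.
split=> //; have [affd dp _ _ _] := e; have [[_ dn' _] dp' _ _ _] := e'.
have sE : supp d' \subset supp d.
  apply/fintype.subsetP => j jd'; have : j \in (p' |: supp d')%SET by rewrite in_setU1 jd' orbT.
  rewrite -eZ in_setU1 => /orP[/eqP jp|//].
  by move: jd'; rewrite jp pp' (negPf (ext_notin e')).
(* An isotropic vector on supp d is a multiple of d, and (alpha_p | d') = -1 makes the factor 1. *)
have n0 : B d' d' = 0 := pair_null e' (subxx _).
by rewrite (affine_primitive affd dp sE n0) pp' dp' opprK scale1r.
Qed.

(** * Orbits of pi-systems *)

(** The sign is a boolean so that the pairs of a subdiagram and a sign form a finite type, which is
    counted in the end. *)
Definition flip (e : bool) v : rlat := if e then - v else v.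

Lemma flip_pair e u v : B (flip e u) (flip e v) = B u v.
Proof. by case: e; rewrite /flip ?pairE ?opprK. Qed.
Lemma flipD e u v : flip e (u + v) = flip e u + flip e v.
Proof. by case: e; rewrite /flip ?opprD. Qed.
Lemma flipK e : involutive (flip e).
Proof. by case: e => v; rewrite /flip ?opprK. Qed.
Lemma weyl_flip w e v : W w (flip e v) = flip e (W w v).
Proof. by case: e; rewrite /flip ?weylN. Qed.
Lemma flip_real e b : real_root X b -> real_root X (flip e b).
Proof. by case: e => //; apply: realN. Qed.

Definition ext_triple e d p o : set rlat :=
  [set x | [\/ x = flip e (alpha p), x = flip e (alpha o) | x = flip e (theta d o)]].

Lemma ext_gram d p o : ext_at d p o ->
  [/\ B (alpha p) (alpha o) = -1, B (alpha p) (theta d o) = 0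
    & B (alpha o) (theta d o) = -2].
Proof.
move=> e; have [_ _ od _ Xp] := e.
have os : supp (alpha o) \subset supp d by rewrite supp_alpha finset.sub1set.
split; first by rewrite pair_alpha2 Xp // eqxx.
  by rewrite (ext_pair e) ?(theta_o e) ?oppr0 //; exact: theta_supp e.
by rewrite (pair_theta e) // norm_alpha.
Qed.

(** The product -2 singles out the two members with sum d up to sign, and the product -1 with this
    sum singles out alpha_p up to sign; w respects both. *)
Lemma ext_orbit_unique w e d p o e' d' p' o' : ext_at d p o -> ext_at d' p' o' ->
  W w @` ext_triple e d p o = ext_triple e' d' p' o' -> [/\ e = e', d = d' & p = p'].
Proof.
move=> ed ed' im; have [g1 g2 g3] := ext_gram ed; have [g1' g2' g3'] := ext_gram ed'.
have [affd dp od _ _] := ed; have [affd' dp' od' _ _] := ed'.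
have mem x : ext_triple e d p o x -> ext_triple e' d' p' o' (W w x).
  by move=> hx; rewrite -im; exists x.
have dE : d = alpha o + theta d o by rewrite /theta addrC subrK.
have dE' : d' = alpha o' + theta d' o' by rewrite /theta addrC subrK.
have n2' := theta_norm ed'.
have wd : W w (flip e d) = flip e' d'.
  rewrite {1}dE {1}dE' (flipD e (alpha o)) (flipD e' (alpha o')) weylD.
  have : B (W w (flip e (alpha o))) (W w (flip e (theta d o))) = -2.
    by rewrite weyl_pair flip_pair.
  have := mem _ (Or32 _ _ erefl); have := mem _ (Or33 _ _ erefl).
  case=> [->|->|->] [->|->|->]; rewrite flip_pair ?norm_alpha ?g1' ?g2' ?n2' //.
  - by rewrite pairC g1'.
  - by rewrite pairC g2'.
  - by rewrite addrC.
have wp : W w (flip e (alpha p)) = flip e' (alpha p').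
  have : B (W w (flip e (alpha p))) (flip e' d') = -1.
    by rewrite -wd weyl_pair flip_pair.
  have := mem _ (Or31 _ _ erefl); case=> [->|->|->] //; rewrite flip_pair.
    by have [[_ dn _] _ _ _ _] := ed'; rewrite dn.
  by rewrite (pair_null ed') //; exact: theta_supp ed'.
have ad := affine_antidominant affd; have ad' := affine_antidominant affd'.
have {}wd : W w d = flip e (flip e' d') by rewrite -wd weyl_flip flipK.
have {}wp : W w (alpha p) = flip e (flip e' (alpha p')) by rewrite -wp weyl_flip flipK.
have [mono _] := antidominant_weyl w ad.
have ee' : e = e'.
  apply: contrapT => /eqP ne; have := mono o; rewrite wd.
  have -> : flip e (flip e' d') = - d' by move: ne; case: (e); case: (e') => //=; rewrite ?opprK.
  have [_ _ _ -> _] := ed; have [dge' _ _] := affd'.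
  by rewrite coefN; have := dge' o; lia.
rewrite -ee' flipK in wd; rewrite -ee' flipK in wp.
have dd' := antidominant_unique ad ad' wd; split=> //.
(* w stabilizes d and so keeps the coefficient at p, where d is not orthogonal: w alpha_p has
   coefficient 1 there. *)
have [_ stab] := antidominant_weyl w ad; rewrite -dd' in wd.
have := stab wd (alpha p) p; rewrite dp wp !alphaE eqxx => /(_ isT).
by case: eqP.
Qed.

(** The differences have coefficients of both signs, hence are no roots. *)
Lemma ext_triple_pi_system (K : numFieldType) e d p o : ext_at d p o ->
  pi_systems K X A1pp (ext_triple e d p o).
Proof.
move=> ed; have [g1 g2 g3] := ext_gram ed; have [affd dp od do1 Xp] := ed.
have [dge dn _] := affd.
have rp := real_alpha p; have ro := real_alpha o; have rt := theta_real ed.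
have n2 := theta_norm ed.
pose b (i : 'I_3) : rlat := flip e (nth 0 [:: alpha p; alpha o; theta d o] i).
have rb (k : 'I_3) : real_root X (b k).
  by case: k => [[|[|[|//]]] hi]; apply: flip_real.
have Sb : ext_triple e d p o = range b.
  apply/seteqP; split=> x.
    by case=> ->; [exists ord0|exists (inord 1)|exists (inord 2)]; rewrite /b ?inordK.
  by case=> -[[|[|[|//]]]] /= hi _ <-; [constructor 1|constructor 2|constructor 3].
have nroot (x : rlat) i j : 0 < x 0 i -> x 0 j < 0 -> ~ km_root K X x /\ ~ km_root K X (- x).
  move=> xi xj; split=> /km_root_sign.
    by move=> c; apply: coherent_mixed c xi xj.
  rewrite opprK => c; have {}c : coherent x by case: c; [right|left].
  exact: coherent_mixed c xi xj.
have op : o != p := ext_neq ed.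
have np : d 0 p = 0 by have := ext_notin ed; rewrite suppP negbK => /eqP.
(* theta is positive at r, which makes its differences with alpha_p and alpha_o negative there. *)
have [r rd ro'] : exists2 r, r \in supp d & r != o.
  apply: contrapT => no; have := n2; rewrite pair_coef big1 // => i _.
  have [id|] := boolP (i \in supp d); last first.
    by rewrite suppP negbK => /eqP di; rewrite (supp_sub (theta_supp ed) di) mul0r.
  have [->|io] := eqVneq i o; first by rewrite (theta_o ed) mul0r.
  by case: no; exists i.
have tr := theta_gt0 ed rd ro'.
have rp' : r != p by apply: contraNneq (ext_notin ed) => <-.
have n_po : ~ km_root K X (alpha p - alpha o) /\ ~ km_root K X (- (alpha p - alpha o)).
  apply: (nroot _ p o); rewrite coefB !alphaE eqxx.
    by rewrite eq_sym (negPf op).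
  by rewrite (negPf op).
have n_pt : ~ km_root K X (alpha p - theta d o) /\ ~ km_root K X (- (alpha p - theta d o)).
  apply: (nroot _ p r); rewrite coefB alphaE.
    by rewrite eqxx coefB np alphaE eq_sym (negPf op).
  by rewrite (negPf rp') sub0r oppr_lt0.
have n_ot : ~ km_root K X (alpha o - theta d o) /\ ~ km_root K X (- (alpha o - theta d o)).
  apply: (nroot _ o r); rewrite coefB alphaE.
    by rewrite eqxx (theta_o ed).
  by rewrite (negPf ro') sub0r oppr_lt0.
split.
  split.
  - by rewrite Sb; apply: finite_image; exact: finite_finset.
  - by rewrite Sb => _ [i _ <-].
  - have fB u v : flip e u - flip e v = flip e (u - v) by case: (e); rewrite /flip // opprD.
    have nf u v : ~ km_root K X (u - v) /\ ~ km_root K X (- (u - v)) ->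
        ~ km_root K X (flip e u - flip e v) /\ ~ km_root K X (flip e v - flip e u).
      by case=> h1 h2; rewrite -[flip e v - _]opprB !fB; case: (e); rewrite /flip ?opprK.
    move=> x y [->|->|->] [->|->|->] // _.
    + exact: (nf _ _ n_po).1.
    + exact: (nf _ _ n_pt).1.
    + exact: (nf _ _ n_po).2.
    + exact: (nf _ _ n_ot).1.
    + exact: (nf _ _ n_pt).2.
    + exact: (nf _ _ n_ot).2.
exists b, b; split=> //.
- have bB (k l : 'I_3) : B (b k) (b l) = A1pp k l.
    rewrite /b flip_pair mxE.
    by case: k l => [[|[|[|//]]] hi] [[|[|[|//]]] hj] /=;
      rewrite ?norm_alpha ?g1 ?g2 ?g3 ?n2 // pairC ?g1 ?g2 ?g3.
  move=> i j bij; have := bB i j; rewrite bij bB !mxE.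
  by case: i j {bij} => [[|[|[|//]]] hi] [[|[|[|//]]] hj] //= _; apply: val_inj.
- by move=> i; apply: real_is_coroot.
- apply/matrixP => i j; rewrite [RHS]mxE /b flip_pair mxE.
  by case: i j => [[|[|[|//]]] hi] [[|[|[|//]]] hj] /=;
    rewrite ?norm_alpha ?g1 ?g2 ?g3 ?n2 // pairC ?g1 ?g2 ?g3.
Qed.

Lemma pi_system_ext_triple (K : fieldType) (S : set rlat) : pi_systems K X A1pp S ->
  exists w e d p o, ext_at d p o /\ W w @` S = ext_triple e d p o.
Proof.
case=> _ [b [bv [_ SE cb ME]]].
have rb (k : 'I_3) : real_root X (b k) by have [w [j [-> _]]] := cb k; exists w, j.
have bB (k l : 'I_3) : B (b k) (b l) = A1pp k l.
  by have /matrixP/(_ k l) := ME; rewrite [RHS]mxE (coroot_root_eq (cb k)) => ->.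
pose i0 : 'I_3 := ord0; pose i1 : 'I_3 := inord 1; pose i2 : 'I_3 := inord 2.
have b01 : B (b i0) (b i1) = -1 by rewrite bB mxE /i1 inordK.
have b02 : B (b i0) (b i2) = 0 by rewrite bB mxE /i2 inordK.
have b12 : B (b i1) (b i2) = -2 by rewrite bB mxE /i1 /i2 !inordK.
(* Its product with b0 is -1. *)
have s0 : b i1 + b i2 != 0.
  by apply: contra_eqN b01 => /eqP e; rewrite -[B _ _]addr0 -b02 -pairDr e pair0r.
have I3 (i : 'I_3) : [\/ i = i0, i = i1 | i = i2].
  by case: i => [[|[|[|//]]] hi]; [constructor 1|constructor 2|constructor 3];
    apply: val_inj; rewrite /= ?inordK.
have key (e : bool) : positive (flip e (b i1) + flip e (b i2)) ->
    exists w d p o, ext_at d p o /\ W w @` S = ext_triple e d p o.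
  move=> pos; have [w [d [p [o [ed w0 w1 w2]]]]] : exists w d p o,
      [/\ ext_at d p o, W w (flip e (b i0)) = alpha p, W w (flip e (b i1)) = alpha o
        & W w (flip e (b i2)) = theta d o].
    by apply: ext_normal_form; rewrite ?flip_pair //; exact: flip_real.
  exists w, d, p, o; split=> //.
  have wf (k : 'I_3) x : W w (flip e (b k)) = x -> W w (b k) = flip e x.
    by move=> <-; rewrite weyl_flip flipK.
  rewrite SE; apply/seteqP; split=> x.
    case=> _ [i _ <-] <-; case: (I3 i) => ->.
    + by constructor 1; apply: wf.
    + by constructor 2; apply: wf.
    + by constructor 3; apply: wf.
  case=> ->; [exists (b i0)|exists (b i1)|exists (b i2)]; by [eexists|apply: wf].
have [pos|neg] := isotropic_coherent (rb i1) (rb i2) b12 s0.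
  by have [w [d [p [o h]]]] := key false pos; exists w, false, d, p, o.
have [w [d [p [o h]]]] : exists w d p o, ext_at d p o /\ W w @` S = ext_triple true d p o.
  by apply: key; rewrite /flip -opprD.
by exists w, true, d, p, o.
Qed.

(** * Null roots of affine type *)

(** Reflections with (alpha_i | v) > 0 lower the height and stop only at a simple root. Hence
    imaginary roots have nonpositive norm. *)
Lemma km_root_real (K : numFieldType) v : km_root K X v -> positive v -> 0 < B v v ->
  real_root X v.
Proof.
move: {2}(`|height v|%N) (leqnn `|height v|%N) => N.
elim: N v => [|N IH] v hN kv pv nv; have hv := height_pos pv; first lia.
have [i vi Bi] := pos_norm_exists pv nv.
have [->|ne] := eqVneq v (alpha i); first exact: real_alpha.
have [ks ps] := km_root_refl gcmX kv pv (elimN eqP ne).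
rewrite -(reflK i v); apply: (real_weyl [:: i]); apply: IH => //.
  by have := height_pos ps; rewrite height_refl; lia.
by rewrite refl_pair.
Qed.

Lemma subset_full v d : supp d = [set: 'I_n]%SET -> supp v \subset supp d.
Proof. by move=> ->; apply: finset.subsetT. Qed.

Section FullSupport.

Variables (d : rlat) (c : 'I_n -> int).
Hypotheses (affd : affine_null d) (fulld : supp d = [set: 'I_n]%SET)
  (dc : \sum_j c j * d 0 j = -1).

Let d_gt0 i : 0 < d 0 i.
Proof.
have [dge _ _] := affd; rewrite lt_neqAle eq_sym dge andbT -suppP fulld.
by rewrite finset.in_setT.
Qed.

Lemma full_null v : B v d = 0.
Proof.
rewrite pair_coef big1 // => i _; have [_ dn _] := affd.
by rewrite dn ?mulr0 // fulld finset.in_setT.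
Qed.

(** The functional c stands for the row of an overextending vertex, which lies outside this diagram;
    it makes t an integer. *)
Lemma full_multiple v : positive v -> B v v <= 0 -> exists2 t : int, 1 <= t & v = t *: d.
Proof.
move=> pv nv; have v0 : B v v = 0.
  by apply/eqP; rewrite eq_le nv (affine_ge0 affd) // subset_full.
have := affine_primitive_fun affd dc (subset_full v fulld) v0.
set t := - _ => vE; exists t => //.
have [i vi] := positive_neq pv; move: vi; rewrite vE coefZ.
by move: (d_gt0 i); move: (d 0 i) (t) => x y; clear; nia.
Qed.

(* A maximal root below d has nonpositive norm, hence equals d. *)
Lemma full_km_root (K : numFieldType) : km_root K X d.
Proof.
have climb (N : nat) v : (`|height d - height v| < N)%N -> km_root K X v -> positive v ->
    (forall i, v 0 i <= d 0 i) -> km_root K X d.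
  elim: N v => [//|N IH] v hN kv pv vd; have [_ vge] := pv.
  have [/existsP[i /andP[vi Bi]]|/existsPn h] :=
    boolP [exists i, (v 0 i < d 0 i) && (B (alpha i) v < 0)]; last first.
    have nv : B v v <= 0.
      (* This is (v | v) = -(d - v | v); as v cannot be raised below d, no term of the sum is
         negative. *)
      have -> : B v v = - \sum_i (d - v) 0 i * B (alpha i) v.
        by rewrite -pair_coef pairBl (pairC d v) full_null sub0r opprK.
      rewrite oppr_le0; apply: sumr_ge0 => i _; have := h i; rewrite coefB.
      rewrite negb_and -!leNgt => /orP[dv|Bi].
        by rewrite (@le_anti _ _ (v 0 i) (d 0 i)) ?vd ?dv // subrr mul0r.
      by apply: mulr_ge0 => //; rewrite subr_ge0.
    have [t t1 vE] := full_multiple pv nv; have [i vi] := positive_neq pv.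
    have t2 : t = 1.
      have := vd i; have := d_gt0 i; rewrite vE coefZ.
      by move: t1; move: (d 0 i) (t) => x y; clear; nia.
    by rewrite -[d]scale1r -t2 -vE.
  have pv' : positive (v + alpha i).
    split=> [|j].
      apply/eqP => /(congr1 (fun x : rlat => x 0 i)); rewrite coefD alphaE eqxx coef0.
      by have := vge i; move: (v 0 i) => x; clear; lia.
    by rewrite coefD alphaE; apply: addr_ge0 => //; case: (_ == _).
  have vd' j : (v + alpha i) 0 j <= d 0 j.
    rewrite coefD alphaE; have := vd j; have [->|ji] := eqVneq j i; last by rewrite addr0.
    by move: vi; move: (v 0 i) (d 0 i) => x y; clear; lia.
  have hd' : height (v + alpha i) <= height d by apply: ler_sum.
  rewrite heightD height_alpha in hd'.
  apply: (IH (v + alpha i)) => //; last exact: km_root_up.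
  by rewrite heightD height_alpha; move: hd' hN; move: (height v) (height d) => x y; clear; lia.
have [i _] : exists i : 'I_n, true.
  apply: contrapT => no; move: dc; rewrite big1 // => i; by case: no; exists i.
apply: (climb _ (alpha i) (ltnSn _)); [exact: km_root_alpha|exact: pos_alpha|].
move=> j; rewrite alphaE; have := d_gt0 j; case: (_ == _); move: (d 0 j) => x; clear; lia.
Qed.

Lemma full_null_root (K : numFieldType) : null_root K X d.
Proof.
have [i _] : exists i : 'I_n, true.
  apply: contrapT => no; move: dc; rewrite big1 // => i; by case: no; exists i.
have pd : positive d.
  split=> [|j]; last exact/ltW/d_gt0.
  apply/eqP => /(congr1 (fun x : rlat => x 0 i)); rewrite coef0.
  by have := d_gt0 i; move: (d 0 i) => x; clear; lia.
split=> [|v [kv nr pv]].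
  by split=> //; [exact: full_km_root|move=> /real_norm; rewrite full_null].
have nv : B v v <= 0 by rewrite leNgt; apply/negP => /(km_root_real kv pv).
have [t t1 ->] := full_multiple pv nv; rewrite heightZ.
have := height_pos pd; move: t1; move: (height d) (t) => x y; clear; nia.
Qed.

End FullSupport.

Section AffineType.

Variable R : realType.

Let a (i j : 'I_n) : R := (X i j)%:~R.
Let a_sym i j : a i j = a j i. Proof. by rewrite /a (symX i j). Qed.
Let a_off i j : i != j -> a i j <= 0. Proof. by move=> /offX; rewrite /a lerz0. Qed.

Let mapE (v : 'cV[R]_n) i : (map_mx intr X *m v) i 0 = \sum_(j in [set: 'I_n]%SET) a i j * v j 0.
Proof.
rewrite mxE; under [RHS]eq_bigl do rewrite finset.in_setT.
by apply: eq_bigr => j _; rewrite mxE.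
Qed.

Let connected_full : indecomposable X <-> connected_set adj [set: 'I_n]%SET.
Proof.
split=> [h C _ C0 CT|h C C0 CT].
  by have [i [j [iC jC ij]]] := h C C0 CT; exists i, j; split=> //; rewrite finset.in_setT.
by have [i [j [iC _ jC ij]]] := h C (finset.subsetT C) C0 CT; exists i, j.
Qed.

Lemma full_affine_type d (i0 : 'I_n) : affine_null d -> supp d = [set: 'I_n]%SET ->
  affine_type R X.
Proof.
move=> affd fulld; have [dge dn cd] := affd; rewrite fulld in cd.
pose u i : R := (d 0 i)%:~R.
have u0 i : i \in [set: 'I_n]%SET -> 0 < u i.
  by rewrite -fulld suppP /u ltr0z lt_neqAle eq_sym dge andbT.
have null i : i \in [set: 'I_n]%SET -> \sum_(j in [set: 'I_n]%SET) a i j * u j = 0.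
  rewrite -fulld => /dn; rewrite pair_alpha => h; rewrite fulld.
  under eq_bigl do rewrite finset.in_setT.
  transitivity ((\sum_j X i j * d 0 j)%:~R : R); last by rewrite h.
  by rewrite rmorph_sum; apply: eq_bigr => j _; rewrite rmorphM.
have ca : connected_set (fun i j => a i j != 0) [set: 'I_n]%SET.
  move=> C C1 C2 C3; have [k [l [? ? ? kl]]] := cd C C1 C2 C3.
  by exists k, l; split=> //; rewrite /a intr_eq0.
pose uc : 'cV[R]_n := \col_i u i.
have ucE i : uc i 0 = u i by rewrite mxE.
have Auc : map_mx intr X *m uc = 0.
  apply/colP => i; rewrite mapE mxE -[RHS](null i) ?finset.in_setT //.
  by apply: eq_bigr => j _; rewrite ucE.
have symA : (map_mx intr X)^T = map_mx intr X :> 'M[R]_n.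
  by rewrite map_trmx slX.
have ucA : uc^T *m map_mx intr X = 0.
  by apply: trmx_inj; rewrite trmx_mul symA trmxK trmx0.
split.
- exact/connected_full.
- have -> : (n - \rank (map_mx intr X : 'M[R]_n) = \rank (kermx (map_mx intr X : 'M[R]_n)))%N.
    by rewrite mxrank_ker.
  (* A kernel vector has norm 0, so [psd_eq0] makes it proportional to u. *)
  have -> : \rank (kermx (map_mx intr X : 'M[R]_n)) = \rank uc^T.
    apply: eqmx_rank; apply/andP; split; last by apply/sub_kermxP.
    apply/rV_subP => w /sub_kermxP wA.
    have wA' : map_mx intr X *m w^T = 0.
      by apply: trmx_inj; rewrite trmx_mul symA trmxK trmx0.
    have q0 : \sum_(i in [set: 'I_n]%SET) \sum_(j in [set: 'I_n]%SET) a i j * w 0 i * w 0 j = 0.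
      rewrite big1 // => i _; transitivity (w 0 i * (map_mx intr X *m w^T) i 0).
        by rewrite mapE mulr_sumr; apply: eq_bigr => j _; rewrite mxE; ring.
      by rewrite wA' mxE mulr0.
    have prop i j := psd_eq0 (z := fun k => w 0 k) a_sym a_off u0 null ca q0
      (finset.in_setT i) (finset.in_setT j).
    suff -> : w = (w 0 i0 / u i0) *: uc^T by apply: scalemx_sub.
    apply/rowP => j; rewrite !mxE; have ui := u0 i0 (finset.in_setT i0).
    by rewrite mulrAC (prop i0 j) mulfK // gt_eqF.
  apply/eqP; rewrite eqn_leq rank_leq_row lt0n mxrank_eq0.
  apply/eqP => /(congr1 (fun x : 'rV[R]_n => x 0 i0)); rewrite !mxE => ui0.
  by have := u0 i0 (finset.in_setT i0); rewrite ui0 ltxx.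
- by exists uc; split=> // i; rewrite ucE u0 ?finset.in_setT.
- move=> v Av; apply/colP => i; rewrite [RHS]mxE.
  (* The nonnegative entries of A v have sum 0 with the positive weights u. *)
  have : (uc^T *m map_mx intr X *m v) 0 0 = 0 by rewrite ucA mul0mx mxE.
  rewrite -mulmxA mxE => /eqP; rewrite psumr_eq0 => [/allP/(_ i (mem_index_enum _))|j _].
    rewrite /= mxE ucE mulf_eq0 gt_eqF ?u0 ?finset.in_setT //= => /eqP.
    by [].
  by rewrite mxE ucE mulr_ge0 // ltW // u0 ?finset.in_setT.
Qed.

(** The real kernel vector makes the form semidefinite; an imaginary root has norm at most 0, hence
    0, and is proportional to this vector. *)
Lemma affine_type_null (K : numFieldType) d : affine_type R X ->
  positive_imaginary_root K X d -> affine_null d /\ supp d = [set: 'I_n]%SET.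
Proof.
rewrite /affine_type /= => -[ind _ [uc [uc0 Auc]] _] [kd nr pd].
have cd := connected_full.1 ind.
pose u i := uc i 0.
have u0 i : i \in [set: 'I_n]%SET -> 0 < u i by move=> _; apply: uc0.
have null i : i \in [set: 'I_n]%SET -> \sum_(j in [set: 'I_n]%SET) a i j * u j = 0.
  by move=> _; rewrite -mapE Auc mxE.
have ca : connected_set (fun i j => a i j != 0) [set: 'I_n]%SET.
  move=> C C1 C2 C3; have [k [l [? ? ? kl]]] := cd C C1 C2 C3.
  by exists k, l; split=> //; rewrite /a intr_eq0.
have nd : B d d <= 0 by rewrite leNgt; apply/negP => /(km_root_real kd pd).
have formE : \sum_(i in [set: 'I_n]%SET) \sum_(j in [set: 'I_n]%SET)
    a i j * (d 0 i)%:~R * (d 0 j)%:~R = (B d d)%:~R.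
  rewrite (pair_supp (finset.subsetT _) (finset.subsetT _)) rmorph_sum; apply: eq_bigr => i _.
  by rewrite rmorph_sum; apply: eq_bigr => j _; rewrite !rmorphM.
have q0 : \sum_(i in [set: 'I_n]%SET) \sum_(j in [set: 'I_n]%SET)
    a i j * (d 0 i)%:~R * (d 0 j)%:~R = 0.
  apply/eqP; rewrite eq_le (psd_ge0 a_sym a_off u0 null) andbT formE.
  by rewrite lerz0.
have prop i j := psd_eq0 (z := fun k => (d 0 k)%:~R) a_sym a_off u0 null ca q0
  (finset.in_setT i) (finset.in_setT j).
have [k dk] := positive_neq pd; have [_ dge] := pd.
have dpos i : 0 < d 0 i.
  rewrite lt_neqAle dge andbT eq_sym; apply/eqP => di.
  have := prop k i; rewrite di mul0r => /eqP; rewrite mulf_eq0 intr_eq0.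
  by rewrite (gt_eqF dk) (gt_eqF (u0 i _)) // finset.in_setT.
have fulld : supp d = [set: 'I_n]%SET.
  by apply/setP => i; rewrite suppP finset.in_setT gt_eqF.
split=> //; split=> [//|i _|]; last by rewrite fulld.
rewrite pair_alpha; apply: (@intr_inj R); apply: (mulIf (lt0r_neq0 (u0 k (finset.in_setT k)))).
rewrite mul0r rmorph_sum mulr_suml.
transitivity (\sum_(j in [set: 'I_n]%SET) (a i j * u j) * (d 0 k)%:~R); last first.
  by rewrite -mulr_suml null ?mul0r // finset.in_setT.
under [RHS]eq_bigl do rewrite finset.in_setT.
apply: eq_bigr => j _; transitivity (a i j * ((d 0 j)%:~R * u k)).
  by rewrite rmorphM -mulrA.
by rewrite (prop j k); ring.
Qed.

End AffineType.

End Lattice.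

(** * Subdiagrams *)

Section Transport.

Variables (m n : nat) (f : 'I_m -> 'I_n) (f_inj : injective f).
Variables (M : 'M[int]_m) (X : 'M[int]_n) (ME : forall i j, M i j = X (f i) (f j)).

(** The map f is general because Y = Z - p is a subdiagram of the subdiagram Z, indexed through two
    [enum_val]. *)
Definition push (v : 'rV[int]_m) : 'rV[int]_n := \sum_i v 0 i *: alpha (f i).
Definition pull (v : 'rV[int]_n) : 'rV[int]_m := \row_i v 0 (f i).

Lemma push_coef v i : push v 0 (f i) = v 0 i.
Proof.
rewrite summxE (bigD1 i) //= coefZ alphaE eqxx mulr1 big1 ?addr0 // => j ji.
by rewrite coefZ alphaE (inj_eq f_inj) eq_sym (negPf ji) mulr0.
Qed.

Lemma push_out v j : j \notin [set f i | i in [set: 'I_m]]%SET -> push v 0 j = 0.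
Proof.
move=> jf; rewrite summxE big1 // => i _; rewrite coefZ alphaE.
have [jE|_] := eqVneq j (f i); last by rewrite mulr0.
by move: jf; rewrite jE imset_f ?finset.in_setT //.
Qed.

Lemma pullK d : supp d \subset [set f i | i in [set: 'I_m]]%SET -> push (pull d) = d.
Proof.
move=> df; apply/rowP => j; have [/imsetP[i _ ->]|jf] :=
  boolP (j \in [set f i | i in [set: 'I_m]]%SET); first by rewrite push_coef mxE.
rewrite push_out //; apply/esym/eqP; rewrite -[_ == _]negbK -suppP.
by apply: contraNN jf; apply: (fintype.subsetP df).
Qed.

Lemma pair_push p v : pairing X (alpha p) (push v) = \sum_i X p (f i) * v 0 i.
Proof.
rewrite pair_sumr; apply: eq_bigr => i _.
by rewrite pairZr pair_alpha2 mulrC.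
Qed.

Lemma pair_push_alpha i v : pairing X (alpha (f i)) (push v) = pairing M (alpha i) v.
Proof. by rewrite pair_push pair_alpha; apply: eq_bigr => j _; rewrite ME. Qed.

Lemma connected_push : connected_set (adj M) [set: 'I_m]%SET <->
  connected_set (adj X) [set f i | i in [set: 'I_m]]%SET.
Proof.
split=> [cM C CS C0 Cn|cX C _ C0 Cn].
  pose C' : {set 'I_m} := [set i | f i \in C]%SET.
  have CE j : j \in C -> exists2 i, j = f i & i \in C'.
    move=> jC; have /imsetP[i _ ji] := fintype.subsetP CS j jC.
    by exists i => //; rewrite inE -ji.
  have [||i [j [iC _ jC ij]]] := cM C' (finset.subsetT _).
  - have [j jC] := finset.set0Pn _ C0; have [i _ iC'] := CE j jC.
    by apply/finset.set0Pn; exists i.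
  - apply: contraNneq Cn => C'T; apply/eqP/setP => j; apply/idP/idP.
      exact: (fintype.subsetP CS).
    case/imsetP=> i _ ->; have : i \in C' by rewrite C'T finset.in_setT.
    by rewrite inE.
  exists (f i), (f j); split.
  - by move: iC; rewrite inE.
  - by rewrite imset_f ?finset.in_setT //.
  - by move: jC; rewrite inE.
  - by move: ij; rewrite /adj ME.
have [|||_ [b [/imsetP[i iC ->] /imsetP[j _ ->] jC ij]]] := cX [set f i | i in C]%SET.
- by apply: imsetS; apply: finset.subsetT.
- have [i iC] := finset.set0Pn _ C0; apply/finset.set0Pn; exists (f i); exact: imset_f.
- by apply: contraNneq Cn => /(imset_inj f_inj) ->.
exists i, j; split=> //.
  by apply: contraNN jC => jC; apply: imset_f.
by move: ij; rewrite /adj ME.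
Qed.

Lemma affine_push v : affine_null M v -> supp v = [set: 'I_m]%SET ->
  affine_null X (push v) /\ supp (push v) = [set f i | i in [set: 'I_m]]%SET.
Proof.
move=> [vge vn cv] fullv.
have sE : supp (push v) = [set f i | i in [set: 'I_m]]%SET.
  apply/setP => j; have [/imsetP[i _ ->]|jf] :=
      boolP (j \in [set f i | i in [set: 'I_m]]%SET).
    by rewrite suppP push_coef -suppP fullv finset.in_setT.
  by rewrite suppP push_out // eqxx.
split=> //; split=> [j|j|].
- have [/imsetP[i _ ->]|jf] := boolP (j \in [set f i | i in [set: 'I_m]]%SET).
    by rewrite push_coef.
  by rewrite push_out.
- by rewrite sE => /imsetP[i _ ->]; rewrite pair_push_alpha vn // fullv finset.in_setT.
- by rewrite sE; apply/connected_push; rewrite -fullv.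
Qed.

Lemma affine_pull d : affine_null X d -> supp d = [set f i | i in [set: 'I_m]]%SET ->
  affine_null M (pull d) /\ supp (pull d) = [set: 'I_m]%SET.
Proof.
move=> [dge dn cd] sE.
have full : supp (pull d) = [set: 'I_m]%SET.
  apply/setP => i; rewrite suppP mxE -suppP sE imset_f ?finset.in_setT //.
split=> //; split=> [i|i _|]; first by rewrite mxE.
  by rewrite -pair_push_alpha pullK ?sE // dn // sE imset_f ?finset.in_setT.
by rewrite full; apply/connected_push; rewrite -sE.
Qed.

End Transport.

Section Subdiagram.

Variables (R : realType) (n : nat) (X : 'M[int]_n).
Hypotheses (gcmX : gcm X) (slX : simply_laced X).

Lemma ext_subdiagP (Z : {set 'I_n}) : ext_type R (subdiag X Z) <->
  exists d p o, ext_at X d p o /\ Z = (p |: supp d)%SET.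
Proof.
have setup (p0 : 'I_#|Z|) (Y := [set~ p0]%SET) (M := subdiag (subdiag X Z) Y)
    (f := fun i : 'I_#|Y| => enum_val (enum_val i)) :
    [/\ injective f, forall i j, M i j = X (f i) (f j), gcm M, simply_laced M
      & [set f i | i in [set: 'I_#|Y|]]%SET = (Z :\ enum_val p0)%SET].
  have fi : injective f by move=> i j /enum_val_inj/enum_val_inj.
  have ME i j : M i j = X (f i) (f j) by rewrite !mxE.
  split=> //.
  - split=> [i|i j ij|i j]; rewrite !ME; first exact: diagX.
      by apply: offX => //; rewrite (inj_eq fi).
    by rewrite (symX slX).
  - by apply/matrixP => i j; rewrite mxE !ME (symX slX).
  - apply/setP => j; apply/imsetP/setD1P => [[i _ ->]|[jp jZ]].
      split; last exact: enum_valP.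
      by rewrite (inj_eq enum_val_inj); have := enum_valP i; rewrite !inE.
    have kY : enum_rank_in jZ j \in Y.
      rewrite !inE; apply: contraNneq jp => <-; by rewrite enum_rankK_in.
    exists (enum_rank_in kY (enum_rank_in jZ j)); first by rewrite finset.in_setT.
    by rewrite /f !enum_rankK_in.
have pairE p0 (d' : 'rV[int]_#|[set~ p0]%SET|) :
    pairing (subdiag X Z) (Defs.incl d') (alpha p0) =
    pairing X (alpha (enum_val p0)) (push (fun i => enum_val (enum_val i)) d').
  rewrite pair_push /Defs.incl.
  rewrite (big_morph (fun x => pairing (subdiag X Z) x (alpha p0))
    (fun x y => pairDl (subdiag X Z) x y _) (pair0l (subdiag X Z) _)).
  apply: eq_bigr => i _; rewrite pairZl pair_alpha2 mulrC mxE.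
  by rewrite (symX slX).
split=> [[p0 [aff [d' [[posd' _] dp]]]]|[d [p [o [ed ZE]]]]].
  have [fi ME gM sM im] := setup p0.
  have [ad' fd'] := affine_type_null gM sM aff posd'.
  have [ad sd] := affine_push fi ME ad' fd'.
  rewrite im in sd; rewrite pairE in dp.
  have [o ed] := ext_vertex gcmX ad dp.
  eexists; exists (enum_val p0), o; split; first exact: ed.
  by rewrite sd finset.setD1K // enum_valP.
have pZ : p \in Z by rewrite ZE setU11.
pose p0 := enum_rank_in pZ p; have p0E : enum_val p0 = p by rewrite enum_rankK_in.
have [fi ME gM sM im] := setup p0; rewrite p0E in im.
have [ad dp od _ _] := ed.
have sd : supp d = (Z :\ p)%SET by rewrite ZE setU1K // (ext_notin ed).
rewrite -im in sd; have [apl fpl] := affine_pull fi ME ad sd.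
exists p0; have /imsetP[i0 _ _] : o \in [set enum_val (enum_val i) |
  i in [set: 'I_#|[set~ p0]%SET|]]%SET by rewrite -sd.
split; first exact: (full_affine_type gM sM R i0 apl fpl).
exists (pull (fun i => enum_val (enum_val i)) d); split; last first.
  by rewrite pairE p0E (pullK fi) // sd.
(* The row of p, restricted to Y, is the functional with value -1 on d. *)
apply: (full_null_root (c := fun i => X p (enum_val (enum_val i))) gM sM apl fpl).
by rewrite -pair_push (pullK fi) // sd.
Qed.

End Subdiagram.

(** * The count of orbits *)

Lemma card_eq_ord (T : Type) (k : nat) (h : 'I_k -> T) : injective h -> (range h #= `I_k)%card.
Proof.
move=> hi; apply: card_eq_trans (inj_card_eq (in2W hi)) _.
have <- : range (@nat_of_ord k) = `I_k.
  apply/seteqP; split=> [_ [i _ <-] //=|j /= jk]; by exists (Ordinal jk).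
by rewrite card_eq_sym; apply: inj_card_eq; apply: in2W; exact: val_inj.
Qed.

Theorem theorem6p2 (R : realType) (n : nat) (X : 'M[int]_n)
    (gcmX : gcm X) (slX : simply_laced X) :
  ((exists S, pi_systems R[i] X A1pp S) <->
   (exists Z : {set 'I_n}, ext_type R (subdiag X Z)))
  /\
  (weyl_orbits X (pi_systems R[i] X A1pp)
    #= `I_(2 * #|ext_subdiagrams R X|))%card.
Proof.
split.
  split=> [[S /(pi_system_ext_triple gcmX slX)[w [e [d [p [o [ed _]]]]]]]|[Z]].
    by exists (p |: supp d)%SET; apply/ext_subdiagP => //; exists d, p, o.
  move=> /(ext_subdiagP R gcmX slX)[d [p [o [ed _]]]].
  exists (ext_triple false d p o); exact: ext_triple_pi_system.
set E := ext_subdiagrams R X.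
(* [option] provides a default outside E, since 'I_n may be empty. *)
have [|g gP] := @choice {set 'I_n} ('rV[int]_n * option ('I_n * 'I_n)) (fun Z t =>
    Z \in E -> exists p o, [/\ t.2 = Some (p, o), ext_at X t.1 p o & Z = (p |: supp t.1)%SET]).
  move=> Z; have [|_] := boolP (Z \in E); last by exists (0, None).
  rewrite inE => /asboolP/(ext_subdiagP R gcmX slX)[d [p [o [ed ZE]]]].
  by exists (d, Some (p, o)) => _; exists p, o.
pose F (x : {set 'I_n} * bool) : set (set 'rV[int]_n) :=
  if (g x.1).2 is Some po then weyl_orbit X (ext_triple x.2 (g x.1).1 po.1 po.2) else classical_sets.set0.
pose D : {set {set 'I_n} * bool} := finset.setX E [set: bool]%SET.
have cardD : #|D| = (2 * #|E|)%N by rewrite cardsX cardsT card_bool mulnC.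
rewrite -cardD.
have FD x : x \in D -> exists d p o, [/\ ext_at X d p o, x.1 = (p |: supp d)%SET
    & F x = weyl_orbit X (ext_triple x.2 d p o)].
  rewrite inE => /andP[/gP[p [o [gE ed ZE]]] _].
  by exists (g x.1).1, p, o; split=> //; rewrite /F gE.
have memD d p o e : ext_at X d p o -> ((p |: supp d)%SET, e) \in D.
  move=> ed; rewrite !inE andbT; apply/asboolP/ext_subdiagP => //; by exists d, p, o.
have orbit_eq w (S S' : set 'rV[int]_n) : weyl X w @` S = S' -> weyl_orbit X S = weyl_orbit X S'.
  have comp u v (T : set 'rV[int]_n) : weyl X u @` (weyl X v @` T) = weyl X (u ++ v) @` T.
    by rewrite image_comp; apply: eq_imagel => z _ /=; rewrite weyl_cat.
  move=> <-; apply/seteqP; split=> _ [u _ <-].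
    exists (u ++ rev w) => //; rewrite comp -catA; apply: eq_imagel => z _.
    by rewrite weyl_cat weyl_cat (weylK gcmX).
  by exists (u ++ w) => //; rewrite comp.
have -> : weyl_orbits X (pi_systems R[i] X A1pp) = range (F \o @enum_val _ (mem D)).
  apply/seteqP; split=> [_ [S /(pi_system_ext_triple gcmX slX)[w [e [d [p [o [ed SE]]]]]] <-]|_ [k _ <-]].
    have xD := memD d p o e ed; exists (enum_rank_in xD ((p |: supp d)%SET, e)) => //=.
    rewrite enum_rankK_in //; have [d' [p' [o' [ed' /= ZE ->]]]] := FD _ xD.
    have [pE dE] := ext_vertex_unique gcmX slX ed ed' ZE.
    rewrite -dE -pE in ed' *; rewrite (orbit_eq _ _ _ SE).
    (* Both are the only neighbour of p in supp d. *)
    suff -> : o' = o by [].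
    have [_ _ od _ Xp] := ed; have [_ _ _ _ Xp'] := ed'.
    by have := Xp' o od; rewrite Xp // eqxx; case: (eqVneq o o') => [->|].
  have [d [p [o [ed _ /= ->]]]] := FD _ (enum_valP k).
  by exists (ext_triple (enum_val k).2 d p o) => //; exact: ext_triple_pi_system.
apply: card_eq_ord => k l /= FE; apply: enum_val_inj.
have [d [p [o [ed ZE Fk]]]] := FD _ (enum_valP k).
have [d' [p' [o' [ed' ZE' Fl]]]] := FD _ (enum_valP l).
move: FE; rewrite Fk Fl => FE.
(* The second triple lies in its own orbit, hence in that of the first, which provides the w for
   [ext_orbit_unique]. *)
have : weyl_orbit X (ext_triple (enum_val l).2 d' p' o')
    (ext_triple (enum_val l).2 d' p' o').
  by exists [::] => //; rewrite image_id.
rewrite -FE => -[w _ wE]; have [eE dE pE] := ext_orbit_unique gcmX slX ed ed' wE.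
by rewrite [LHS]surjective_pairing [RHS]surjective_pairing ZE ZE' eE dE pE.
Qed.
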